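(* Let $\Psi(-i\xi)=i\langle a,\xi\rangle-\langle\xi,D\xi\rangle+z\int_{\mathbb{R}^d\setminus\{0\}}(e^{i\langle\varphi,\xi\rangle}-1)\,dr(\varphi)$, $\xi\in\mathbb{R}^d$, where $a\in\mathbb{R}^d$, $D$ is a real positive semidefinite $d\times d$ matrix, $z\ge0$ and $r$ is a probability measure on $\mathbb{R}^d\setminus\{0\}$ with compact support $\mathrm{supp}(r)\subset\mathbb{R}^d$. Let $f=e^{-V}$ with $V(\varphi)=\langle\lambda^{(2)},\varphi^{\otimes2}\rangle_2=\sum_{X_1,X_2=1}^d\lambda^{(2)}_{X_1X_2}\varphi_{X_1}\varphi_{X_2}$, $\lambda^{(2)}$ real symmetric and positive definite. Let $t>0$, $\phi\in\mathbb{R}^d$ and $a_m=\frac{(-1)^m}{m!}\sum_{G\in\bar F(m)}\mathcal{V}[G](t,\phi)$. Then $\zeta\mapsto\Phi^\zeta_t(\phi)$ fulfils the conditions of Watson's theorem: for every $R>0$ it is analytic on $C_R=\{\zeta\in\mathbb{C}:\Re\zeta^{-1}>R^{-1}\}$ and there are constants $A,\sigma>0$ (which may depend on $t,\phi$) such that $$\Big|\Phi^\zeta_t(\phi)-\sum_{m=0}^{N-1}a_m\zeta^m\Big|\le A\sigma^NN!\,|\zeta|^N$$ for all $N$ and all $\zeta\in C_R$. In particular, there is $\sigma=\sigma(t,\phi)<\infty$ such that the series $$B(\tau,t,\phi)=\sum_{m=0}^{\infty}\frac{(-\tau)^m}{(m!)^2}\sum_{G\in\bar F(m)}\mathcal{V}[G](t,\phi)$$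 converges for $\tau$ in the ball of radius $1/\sigma$ centered at $0$ and has an analytic continuation in $\tau$ to the strip $S_\sigma=\{\tau\in\mathbb{C}:\mathrm{dist}(\tau,\mathbb{R}_+)<1/\sigma\}$; denoting this continuation by the same symbol, the solution $\Phi_t$ of the Cauchy problem $\frac{\partial}{\partial t}\Phi_t=\Psi(\nabla)\Phi_t$, $\Phi_0=f$, is given by $$\Phi_t(\phi)=\int_0^\infty e^{-\tau}B(\tau,t,\phi)\,d\tau .$$
   Context: Fourier transform: $\mathcal{F}(g)(\xi)=\int_{\mathbb{R}^d}g(\varphi)e^{i\langle\xi,\varphi\rangle}d\varphi$, extended to $\mathcal{S}'(\mathbb{R}^d)$. $\Psi(\nabla)=\mathcal{F}^{-1}\circ(\text{multiplication by }\Psi(-i\xi))\circ\mathcal{F}$. Let $\nu_t=\mathcal{F}^{-1}(e^{t\Psi(-i\xi)})$. The solution of the Cauchy problem is the convolution $\Phi_t=\nu_t*f$; for $\Re\zeta>0$ put $\Phi_t^\zeta=\nu_t*e^{-\zeta V}$, so $\Phi_t=\Phi_t^1$. Since $\xi\mapsto\Psi(-i\xi)$ is analytic at $0$, $\Psi$ is holomorphic near $0$; put $C^{(n)}_{X_1\cdots X_n}=\frac{\partial^n}{\partial\xi_{X_1}\cdots\partial\xi_{X_n}}\Psi(\xi)|_{\xi=0}$ for $n\ge1$, $X_i\in\{1,\dots,d\}$. Feynman graphs (for quadratic $V$): let $m\in\mathbb{N}_0$ and $\Omega=\{(1,n),(2,n):n=1,\dots,m\}$. A graph $G\in\bar F(m)$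 has $m$ distinguishable ''inner full'' vertices, the $n$-th one having two distinguishable legs labelled $(1,n),(2,n)$; finitely many ''inner empty'' and ''outer empty'' vertices, indistinguishable within each type and with indistinguishable legs; each leg of an inner full vertex is joined by an edge to exactly one empty vertex and these are all the edges; every inner empty vertex is met by at least one edge and every outer empty vertex by exactly one edge. (Equivalently, $G$ is a surjective map from $\Omega$ to a finite set of vertices each marked inner or outer, injective over outer ones, up to type-preserving relabelling of these vertices.) $\bar F(0)$ consists of the empty graph, of value $1$. Feynman rules: $\mathcal{V}[G](t,\phi)$ is obtained as follows: assign to each leg $a=(s,n)\in\Omega$ an index $X_a=X^n_s\in\{1,\dots,d\}$; for each outer empty vertex multiply by $\phi_{X_b}$, $b$ the leg joined to it; for each inner empty vertex joined to legs $a_1,\dots,a_l$ multiply by $t\,C^{(l)}_{X_{a_1}\cdots X_{a_l}}$; for each $j=1,\dots,m$ multiply by $\lambda^{(2)}_{X^j_1X^j_2}$; finally sum over all indices. *)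

(* Defs.v *)
From HB Require Import structures.
From mathcomp Require Import all_boot all_order all_algebra.
From mathcomp Require Import complex.
From mathcomp Require Import all_classical all_reals all_analysis.

Set Implicit Arguments.
Unset Strict Implicit.
Unset Printing Implicit Defensive.

Import Order.TTheory GRing.Theory Num.Theory.
Import numFieldNormedType.Exports.

Local Open Scope classical_set_scope.
Local Open Scope ring_scope.
Local Open Scope complex_scope.

(* R[i] with the normed space structure of any numFieldType over itself. *)
HB.instance Definition _ (R : realType) := GRing.ComAlgebra.copy R[i] R[i]^o.
HB.instance Definition _ (R : realType) := Vector.copy R[i] R[i]^o.
HB.instance Definition _ (R : realType) := NormedModule.copy R[i] R[i]^o.

(* The Borel sets of R^n, generated by the coordinates, as the library does
   for n.-tuple T. *)
Definition measure_rV_display : measure_display.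
Proof. exact: default_measure_display. Qed.

Section measurable_rV.
Context {R : realType}.
Variable n : nat.

Let coors : 'I_n -> 'rV[R]_n -> measurableTypeR R := fun i x => x ord0 i.

Let rV_set0 : g_sigma_preimage coors set0.
Proof. exact: sigma_algebra0. Qed.

Let rV_setC A : g_sigma_preimage coors A -> g_sigma_preimage coors (~` A).
Proof. exact: sigma_algebraC. Qed.

Let rV_bigcup (F : _^nat) : (forall i, g_sigma_preimage coors (F i)) ->
  g_sigma_preimage coors (\bigcup_i (F i)).
Proof. exact: sigma_algebra_bigcup. Qed.

HB.instance Definition _ := @isMeasurable.Build measure_rV_display
  'rV[R]_n (g_sigma_preimage coors) rV_set0 rV_setC rV_bigcup.

End measurable_rV.

Section lebesgue_rV.
Context {R : realType}.

Lemma measurable_coord n (i : 'I_n) :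
  measurable_fun setT (fun x : 'rV[R]_n => x ord0 i : measurableTypeR R).
Proof.
move=> _ Y mY; rewrite setTI; apply: sub_sigma_algebra => /=.
rewrite -bigcup_seq/=; exists i => /=; first by rewrite mem_index_enum.
by exists Y => //; rewrite setTI.
Qed.

Lemma measurable_fun_rV d (T : measurableType d) n (f : T -> 'rV[R]_n) :
  (forall i, measurable_fun setT (fun x => f x ord0 i : measurableTypeR R)) ->
  measurable_fun setT f.
Proof.
move=> mf; apply: (@measurability _ _ T 'rV[R]_n setT f
  (\big[setU/set0]_(i < n) preimage_set_system setT
     (fun x : 'rV[R]_n => x ord0 i : measurableTypeR R) measurable)) => //.
move=> _ [A + <-]; rewrite -bigcup_seq => -[i _ [B mB <-]].
by rewrite setTI; exact: mf.
Qed.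

Definition cons_rV n (p : measurableTypeR R * 'rV[R]_n) : 'rV[R]_n.+1 :=
  \row_j oapp (p.2 ord0) p.1 (unlift ord0 j).

Lemma measurable_cons_rV n : measurable_fun setT (@cons_rV n).
Proof.
apply: measurable_fun_rV => i; rewrite /cons_rV.
case: (unliftP ord0 i) => [j|] ij.
  rewrite (_ : (fun x => _) = (fun x : 'rV[R]_n => x ord0 j) \o snd).
    by apply: measurableT_comp => //; exact: measurable_coord.
  by apply/funext => x /=; rewrite mxE ij liftK.
rewrite (_ : (fun x => _) = fst)//.
by apply/funext => x /=; rewrite mxE ij unlift_none.
Qed.

Section step.
Variables (n : nat) (mu : {sigma_finite_measure set 'rV[R]_n -> \bar R}).

Let step := pushforward (@lebesgue_measure R \x mu)%E (@cons_rV n).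

Let step0 : step set0 = 0%E.
Proof. by rewrite /step /pushforward preimage_set0 measure0. Qed.

Let step_ge0 A : (0 <= step A)%E.
Proof. exact: (@measure_ge0 _ _ _ (@lebesgue_measure R \x mu)%E). Qed.

Let step_sigma_additive : semi_sigma_additive step.
Proof.
apply: (@measure_semi_sigma_additive _ _ _
  (pushforward (@lebesgue_measure R \x mu)%E (@cons_rV n)
     : {measure set _ -> \bar R})).
exact: measurable_cons_rV.
Qed.

HB.instance Definition _ := isMeasure.Build _ _ _ step
  step0 step_ge0 step_sigma_additive.

Let step_sigma_finite : sigma_finite setT step.
Proof.
pose g (x : 'rV[R]_n.+1) : measurableTypeR R * 'rV[R]_n :=
  (x ord0 ord0, \row_j x ord0 (lift ord0 j)).
have mg : measurable_fun setT g.
  apply: measurable_fun_pair; first exact: measurable_coord.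
  apply: measurable_fun_rV => i; under eq_fun do rewrite mxE.
  exact: measurable_coord.
have consK : cancel (@cons_rV n) g.
  move=> [x v]; rewrite /g /cons_rV mxE unlift_none/=; congr pair.
  by apply/rowP => j; rewrite !mxE liftK.
have /sigma_finiteP[F [TF ndF Foo]] :=
  sigma_finiteT (lebesgue_stieltjes_measure (@idfun R)).
have /sigma_finiteP[G [TG ndG Goo]] := sigma_finiteT mu.
exists (fun k => g @^-1` (F k `*` G k)).
  rewrite -preimage_bigcup (_ : \bigcup_k _ = setT) ?preimage_setT//.
  rewrite -setXTT TF TG predeqE => -[x y]; split.
    by move=> [k _ []/= ? ?]; split; exists k.
  move=> [/= [k _ Fkx] [l _ Gly]]; exists (maxn k l) => //; split.
    by move: x Fkx; exact/subsetPset/ndF/leq_maxl.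
  by move: y Gly; exact/subsetPset/ndG/leq_maxr.
move=> k; have [? ?] := Foo k; have [? ?] := Goo k; split.
  by rewrite -[X in measurable X]setTI; apply: mg => //; exact: measurableX.
rewrite /step /pushforward (_ : _ @^-1` _ = F k `*` G k); last first.
  rewrite -comp_preimage (_ : g \o _ = idfun) ?preimage_id//.
  by apply/funext; exact: consK.
by rewrite product_measure1E// lte_mul_pinfty// ge0_fin_numE.
Qed.

HB.instance Definition _ := Measure_isSigmaFinite.Build _ _ _ step
  step_sigma_finite.

Definition lebesgue_cons : {sigma_finite_measure set 'rV[R]_n.+1 -> \bar R} :=
  step.

End step.

(* Lebesgue measure on R^n, as the n-fold product of the one on R. *)
Fixpoint lebesgue_rV n : {sigma_finite_measure set 'rV[R]_n -> \bar R} :=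
  if n is n'.+1 then lebesgue_cons (lebesgue_rV n') else \d_(0 : 'rV[R]_0).

End lebesgue_rV.
Arguments lebesgue_rV {R} n.

Section complex_analysis.
Context {R : realType}.
Local Notation C := R[i].

Definition cexp (w : C) : C :=
  (expR (complex.Re w) * cos (complex.Im w))
  +i* (expR (complex.Re w) * sin (complex.Im w)).

Definition cintegral d (T : measurableType d) (mu : {measure set T -> \bar R})
    (D : set T) (f : T -> C) : C :=
  (\int[mu]_(x in D) complex.Re (f x)) +i* (\int[mu]_(x in D) complex.Im (f x)).

Definition cintegrable d (T : measurableType d)
    (mu : {measure set T -> \bar R}) (D : set T) (f : T -> C) : Prop :=
  mu.-integrable D (fun x => (complex.Re (f x))%:E) /\
  mu.-integrable D (fun x => (complex.Im (f x))%:E).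

Definition analytic_on (U : set C) (f : C -> C) : Prop :=
  forall w0, U w0 -> exists e : R, 0 < e /\ exists c : C^nat,
    forall w, `|w - w0| < e%:C ->
      series (fun n => c n * (w - w0) ^+ n) @ \oo --> f w.

(* The disc C_rho of Watson's theorem; the convention 0^-1 = 0 excludes 0. *)
Definition watson_disc (rho : R) : set C :=
  [set w | rho^-1 < complex.Re w^-1].

Definition dist_Rplus (tau : C) : R :=
  inf [set complex.Re `|tau - x%:C| | x in [set x : R | 0 <= x]].

Definition strip (sigma : R) : set C := [set tau | dist_Rplus tau < sigma^-1].

End complex_analysis.

Definition dot (K : pzRingType) n (x y : 'rV[K]_n) : K :=
  \sum_k x ord0 k * y ord0 k.

Section fourier.
Context {R : realType} {d : nat}.
Local Notation C := R[i].
Local Notation vec := 'rV[R]_d.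

Definition cvec (x : vec) : 'rV[C]_d := \row_k (x ord0 k)%:C.

Definition fourier (g : vec -> C) (xi : vec) : C :=
  cintegral (lebesgue_rV d) setT
    (fun phi => g phi * cexp ('i * (dot xi phi)%:C)).

Definition inv_fourier (g : vec -> C) (phi : vec) : C :=
  ((2 * pi) ^- d)%:C * cintegral (lebesgue_rV d) setT
    (fun xi => g xi * cexp (- 'i * (dot xi phi)%:C)).

(* Tempered distributions act on test functions; only their values matter here,
   so their continuity is not recorded. *)
Definition functional : Type := (vec -> C) -> C.

Definition regular_distribution (h : vec -> C) : functional :=
  fun g => cintegral (lebesgue_rV d) setT (fun x => h x * g x).

Definition dist_inv_fourier (u : functional) : functional :=
  fun g => u (inv_fourier g).

Definition dist_convolution (u : functional) (f : vec -> C) : vec -> C :=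
  fun phi => u (fun psi => f (phi - psi)).

End fourier.

Section levy.
Context {R : realType} {d : nat}.
Local Notation C := R[i].
Local Notation vec := 'rV[R]_d.

Definition supp (r : set vec -> \bar R) : set vec :=
  [set x | forall U, open U -> U x -> r U != 0%E].

Section symbol.
Variables (a : vec) (D : 'M[R]_d) (z : R) (r : probability vec R).

(* xi |-> Psi(-i xi), the bilinear pairings being extended to complex xi. *)
Definition levy_symbol (xi : 'rV[C]_d) : C :=
  'i * dot (cvec a) xi
  - dot xi (xi *m (map_mx (real_complex R) D)^T)
  + z%:C * cintegral r [set~ 0]
             (fun phi => cexp ('i * dot (cvec phi) xi) - 1).

Definition levy_char (w : 'rV[C]_d) : C := levy_symbol ('i *: w).

Lemma levy_char_real (xi : vec) : levy_char (- 'i *: cvec xi) =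
  'i * (dot a xi)%:C - (dot xi (xi *m D^T))%:C
  + z%:C * cintegral r [set~ 0] (fun phi => cexp ('i * (dot phi xi)%:C) - 1).
Proof.
have dotC (x y : vec) : dot (cvec x) (cvec y) = (dot x y)%:C.
  rewrite /dot raddf_sum; apply: eq_bigr => k _.
  by rewrite !mxE -rmorphM.
rewrite /levy_char scalerA mulrN -expr2 sqr_i opprK scale1r /levy_symbol dotC.
rewrite (_ : cvec xi *m _ = cvec (xi *m D^T)); last first.
  apply/rowP => k; rewrite !mxE raddf_sum; apply: eq_bigr => j _.
  by rewrite !mxE -rmorphM.
by rewrite dotC; under eq_fun do rewrite dotC.
Qed.

End symbol.

Section evolution.
Variable Psi : 'rV[C]_d -> C.

Definition pseudo_diff (g : vec -> C) : vec -> C :=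
  inv_fourier (fun xi => Psi (- 'i *: cvec xi) * fourier g xi).

Definition nu (t : R) : functional :=
  dist_inv_fourier (regular_distribution
    (fun xi => cexp (t%:C * Psi (- 'i *: cvec xi)))).

Definition quad_form (lam : 'M[R]_d) (phi : vec) : R :=
  \sum_X1 \sum_X2 lam X1 X2 * phi ord0 X1 * phi ord0 X2.

Definition Phi (lam : 'M[R]_d) (zeta : C) (t : R) : vec -> C :=
  dist_convolution (nu t) (fun phi => cexp (- zeta * (quad_form lam phi)%:C)).

Definition solves_cauchy (f : vec -> C) (u : R -> vec -> C) : Prop :=
  [/\ forall phi, u 0 phi = f phi,
      forall phi,
        complex.Re (u s phi) @[s --> 0^'+] --> complex.Re (f phi) /\
        complex.Im (u s phi) @[s --> 0^'+] --> complex.Im (f phi) &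
      forall (t : R) phi, 0 < t ->
        is_derive t (1 : R) (fun s => complex.Re (u s phi))
          (complex.Re (pseudo_diff (u t) phi)) /\
        is_derive t (1 : R) (fun s => complex.Im (u s phi))
          (complex.Im (pseudo_diff (u t) phi))].

(* [:: X_1; ...; X_n] |-> C^(n)_{X_1 ... X_n}; complex partial derivatives. *)
Definition partial (k : 'I_d) (f : 'rV[C]_d -> C) : 'rV[C]_d -> C :=
  fun w => 'D_(delta_mx ord0 k : 'rV[C]_d) f w.

Definition Ccoef (X : seq 'I_d) : C := foldr partial Psi X 0.

End evolution.
End levy.

(* The leg (s, n) of the n-th inner full vertex, both indices from 0. *)
Definition leg (m : nat) : finType := ('I_2 * 'I_m)%type.

(* A graph, i.e. a map from the legs onto marked vertices up to relabelling of
   the vertices, is the set of its fibres with their marks: G.1 is the set of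
   inner empty vertices and G.2 the set of outer empty ones, a vertex being
   identified with the set of legs joined to it. *)
Definition graphs (m : nat) :
    {set {set {set leg m}} * {set {set leg m}}} :=
  [set G : {set {set leg m}} * {set {set leg m}} |
    [&& [disjoint G.1 & G.2], finset.partition (G.1 :|: G.2) [set: leg m]
      & [forall B in G.2, #|B| == 1%N]]].

Section feynman_rules.
Context {R : realType} {d : nat}.
Local Notation C := R[i].
Variables (Psi : 'rV[C]_d -> C) (lam : 'M[R]_d) (t : R) (phi : 'rV[R]_d).

Definition graph_value m (G : {set {set leg m}} * {set {set leg m}}) : C :=
  \sum_(X : {ffun leg m -> 'I_d})
    (\prod_(B in G.2) \prod_(b in B) (phi ord0 (X b))%:C)
    * (\prod_(B in G.1) (t%:C * Ccoef Psi [seq X b | b <- enum B]))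
    * (\prod_(j < m) (lam (X (ord0, j)) (X (ord_max, j)))%:C).

Definition graph_sum (m : nat) : C := \sum_(G in graphs m) graph_value G.

End feynman_rules.

(* Main.v *)
Require Import Defs.
From HB Require Import structures.
From mathcomp Require Import all_boot all_order all_algebra.
From mathcomp Require Import complex.
From mathcomp Require Import all_classical all_reals all_analysis.
From mathcomp Require Import measurable_realfun.
From mathcomp Require Import ring lra.

(** The evolution generated by [Psi] averages over the increments of a Levy process.
    Let X have the law of minus the increment over time [t]: an independent sum of a
    drift, of normal variables along lines on which [D] is a sum of squares, and of
    a compound Poisson variable. The jumps being bounded, all exponential moments
    of X are finite and E exp <w, X> = exp (t Psi (w)) for every complex w
    ([is_mgf_levy]). For [Re zeta > 0] the function exp (- zeta V) satisfies Fourier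
    inversion ([gaussian_fourier], by completing squares), whence ([Phi_expectation])

      Phi^zeta_t (phi) = E exp (- zeta Q),   Q = V (phi + X) >= 0.

    The theorem is thus about the Laplace transform of a nonnegative random variable
    Q that is quadratic in a variable with exponential moments.

    Watson's conditions. On the left half-plane the exponential series has remainder
    at most |y|^N / N!, so that the remainder of the expansion in [zeta] is at most
    E Q^N |zeta|^N / N! ([laplace_taylor]); and E Q^N is at most a constant times
    4^-N (N!)^2, because (2 N)! <= 4^N (N!)^2 ([moment_le]). The same series around a
    point of the half-plane gives analyticity ([laplace_analytic]).

    Graphs. The moments of the coordinates of phi + X are derivatives at 0 of the
    exponential of <w, phi> + t Psi (w). By Leibniz' formula they are sums over
    partitions of the set of legs of products of cumulants ([mom_cumulant]). A block
    of l legs has the cumulant t C^(l), to which phi is added if l = 1: an inner and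
    an outer vertex. Contracting with lambda gives E Q^m as the sum of the graphs
    with m full vertices ([graph_sumE]).

    Borel summation. Exponential moments of every order are finite, so the series of
    (- tau)^m E Q^m / (m!)^2 converges everywhere, to an entire function
    ([entire_sum]). For [tau >= 0] it is E F (tau Q) with F (x) = J_0 (2 sqrt x),
    which is bounded by 1 ([bessel_le1], by an energy argument), and the integral of
    e^-tau F (tau v) over the half-line is e^-v ([bessel_expw]). Fubini's theorem
    then gives the Borel integral ([borel_sum]).

    Cauchy problem. The Fourier transform of Phi_t is exp (t Psi) times that of the
    initial value ([fourier_Phi]); the latter decays exponentially while the symbol
    grows at most quadratically, so that derivatives in time are taken under the
    integral ([Phi_solves_cauchy]). *)

Set Implicit Arguments.
Unset Strict Implicit.
Unset Printing Implicit Defensive.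

Import Order.TTheory GRing.Theory Num.Theory.
Import numFieldNormedType.Exports.

Local Open Scope classical_set_scope.
Local Open Scope ring_scope.
Local Open Scope complex_scope.

(** * Complex modulus and exponential *)

Section complex_basics.
Context {R : realType}.
Local Notation C := R[i].
Local Notation Re := (@complex.Re R).
Local Notation Im := (@complex.Im R).
Implicit Types (z w : C) (x y : R).

(** The norm of [R[i]] takes its values in [R[i]]; estimates are made with this real
    version of it. *)
Definition cn (z : C) : R := Re `|z|.

Lemma cnE z : `|z| = (cn z)%:C.
Proof. by rewrite /cn normc_def. Qed.

Lemma cn_def z : cn z = Num.sqrt (Re z ^+ 2 + Im z ^+ 2).
Proof. by rewrite /cn normc_def. Qed.

Lemma rcD x y : (x + y)%:C = x%:C + y%:C. Proof. exact: rmorphD. Qed.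
Lemma rcN x : (- x)%:C = - x%:C. Proof. exact: rmorphN. Qed.
Lemma rcB x y : (x - y)%:C = x%:C - y%:C. Proof. exact: rmorphB. Qed.
Lemma rcM x y : (x * y)%:C = x%:C * y%:C. Proof. exact: rmorphM. Qed.
Lemma rcX x n : (x ^+ n)%:C = x%:C ^+ n. Proof. exact: rmorphXn. Qed.
Lemma rcV x : (x^-1)%:C = x%:C^-1. Proof. exact: fmorphV. Qed.
Lemma rc_nat n : (n%:R)%:C = n%:R :> C. Proof. exact: rmorph_nat. Qed.
Lemma rc_sum (I : Type) (r : seq I) (P : pred I) (F : I -> R) :
  (\sum_(i <- r | P i) F i)%:C = \sum_(i <- r | P i) (F i)%:C.
Proof. exact: rmorph_sum. Qed.

Lemma cn_ge0 z : 0 <= cn z.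
Proof. by rewrite cn_def sqrtr_ge0. Qed.

Lemma cn0 : cn 0 = 0.
Proof. by rewrite /cn normr0. Qed.

Lemma cn1 : cn 1 = 1.
Proof. by rewrite /cn normr1. Qed.

Lemma cnM z w : cn (z * w) = cn z * cn w.
Proof. by apply: complexI; rewrite -cnE normrM !cnE -rmorphM. Qed.

Lemma cnX z n : cn (z ^+ n) = cn z ^+ n.
Proof. by apply: complexI; rewrite -cnE normrX !cnE -rmorphXn. Qed.

Lemma cnN z : cn (- z) = cn z.
Proof. by rewrite /cn normrN. Qed.

Lemma cnD z w : cn (z + w) <= cn z + cn w.
Proof. by rewrite -lecR rcD -!cnE ler_normD. Qed.

Lemma cnB z w : cn (z - w) <= cn z + cn w.
Proof. by rewrite -(cnN w) cnD. Qed.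

Lemma cn_distC z w : cn (z - w) = cn (w - z).
Proof. by rewrite -cnN opprB. Qed.

Lemma cn_real x : cn x%:C = `|x|.
Proof. by rewrite cn_def /= expr0n addr0 sqrtr_sqr. Qed.

Lemma cn_i : cn 'i = 1.
Proof. by rewrite cn_def /= expr0n add0r expr1n sqrtr1. Qed.

Lemma cn_nat n : cn n%:R = n%:R.
Proof. by rewrite -(rmorph_nat (real_complex R)) cn_real ger0_norm. Qed.

Lemma cnV z : cn z^-1 = (cn z)^-1.
Proof. by apply: complexI; rewrite -cnE normfV cnE fmorphV. Qed.

Lemma cn_eq0 z : (cn z == 0) = (z == 0).
Proof. by rewrite -(inj_eq (@complexI R)) -cnE normr_eq0. Qed.

Lemma cn_sum (I : Type) (r : seq I) (P : pred I) (F : I -> C) :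
  cn (\sum_(i <- r | P i) F i) <= \sum_(i <- r | P i) cn (F i).
Proof.
elim/big_ind2 : _ => [|a b a' b' h h'|//]; first by rewrite cn0.
exact: le_trans (cnD _ _) (lerD h h').
Qed.

Lemma Re_le_cn z : `|Re z| <= cn z.
Proof. by rewrite -lecR -cnE normc_ge_Re. Qed.

Lemma Im_le_cn z : `|Im z| <= cn z.
Proof. by rewrite cn_def -sqrtr_sqr ler_wsqrtr // lerDr sqr_ge0. Qed.

Lemma cn_le z : cn z <= `|Re z| + `|Im z|.
Proof.
case: z => a b; rewrite (_ : a +i* b = a%:C + 'i * b%:C); last by simpc.
apply: le_trans (cnD _ _) _; rewrite cnM cn_i mul1r !cn_real /=.
by rewrite !mul0r !mul1r subr0 !addr0 !add0r.
Qed.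

Lemma Re_add z w : Re (z + w) = Re z + Re w. Proof. by case: z; case: w. Qed.
Lemma Im_add z w : Im (z + w) = Im z + Im w. Proof. by case: z; case: w. Qed.
Lemma Re_opp z : Re (- z) = - Re z. Proof. by case: z. Qed.
Lemma Im_opp z : Im (- z) = - Im z. Proof. by case: z. Qed.
Lemma Re_mul z w : Re (z * w) = Re z * Re w - Im z * Im w.
Proof. by case: z; case: w. Qed.
Lemma Im_mul z w : Im (z * w) = Re z * Im w + Im z * Re w.
Proof. by case: z; case: w => a b c e /=. Qed.

Lemma Re_sum (I : Type) (r : seq I) (P : pred I) (F : I -> C) :
  Re (\sum_(i <- r | P i) F i) = \sum_(i <- r | P i) Re (F i).
Proof. exact: (big_morph Re Re_add). Qed.

Lemma Im_sum (I : Type) (r : seq I) (P : pred I) (F : I -> C) :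
  Im (\sum_(i <- r | P i) F i) = \sum_(i <- r | P i) Im (F i).
Proof. exact: (big_morph Im Im_add). Qed.

Lemma Re_scale x z : Re (x%:C * z) = x * Re z.
Proof. by rewrite Re_mul /= mul0r subr0. Qed.

Lemma Im_scale x z : Im (x%:C * z) = x * Im z.
Proof. by rewrite Im_mul /= mul0r addr0. Qed.

Lemma complex_eta z : z = Re z +i* Im z. Proof. by case: z. Qed.

Lemma cexpD z w : cexp (z + w) = cexp z * cexp w.
Proof.
rewrite [RHS]complex_eta Re_mul Im_mul /cexp /= Re_add Im_add expRD cosD sinD.
by congr Complex; ring.
Qed.

Lemma cexp0 : cexp 0 = 1 :> C.
Proof. by rewrite /cexp /= expR0 cos0 sin0 mulr1 mulr0. Qed.

Lemma cn_cexp z : cn (cexp z) = expR (Re z).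
Proof.
rewrite cn_def /= !exprMn -mulrDr cos2Dsin2 mulr1 sqrtr_sqr.
by rewrite ger0_norm ?expR_ge0.
Qed.

Lemma cexp_real x : cexp x%:C = (expR x)%:C.
Proof. by rewrite /cexp /= cos0 sin0 mulr1 mulr0. Qed.

Lemma cexp_neq0 z : cexp z != 0.
Proof. by rewrite -cn_eq0 cn_cexp gt_eqF ?expR_gt0. Qed.

Lemma cexpN z : cexp (- z) = (cexp z)^-1.
Proof.
apply: (mulfI (cexp_neq0 z)).
by rewrite -cexpD subrr cexp0 divff // cexp_neq0.
Qed.

Lemma cexp_sum (I : Type) (r : seq I) (P : pred I) (F : I -> C) :
  cexp (\sum_(i <- r | P i) F i) = \prod_(i <- r | P i) cexp (F i).
Proof. exact: (big_morph _ cexpD cexp0). Qed.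

(** * Derivatives of complex functions of a real variable *)

Definition cderiv (f : R -> C) (s : R) (f' : C) : Prop :=
  is_derive s (1 : R) (Re \o f) (Re f') /\
  is_derive s (1 : R) (Im \o f) (Im f').

Lemma cderivD f g s f' g' : cderiv f s f' -> cderiv g s g' ->
  cderiv (fun r => f r + g r) s (f' + g').
Proof.
move=> [a b] [c d]; split.
  rewrite (_ : _ \o _ = (Re \o f) \+ (Re \o g)); first by rewrite Re_add; exact: is_deriveD.
  by apply/funext => r /=; rewrite Re_add.
rewrite (_ : _ \o _ = (Im \o f) \+ (Im \o g)); first by rewrite Im_add; exact: is_deriveD.
by apply/funext => r /=; rewrite Im_add.
Qed.

Lemma cderivM f g s f' g' : cderiv f s f' -> cderiv g s g' ->
  cderiv (fun r => f r * g r) s (f' * g s + f s * g').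
Proof.
move=> [a b] [c d]; split.
  rewrite (_ : _ \o _ = (Re \o f) \* (Re \o g) \- (Im \o f) \* (Im \o g)); last first.
    by apply/funext => r /=; rewrite Re_mul.
  apply: is_derive_eq.
  by rewrite Re_add !Re_mul /= /GRing.scale /=; ring.
rewrite (_ : _ \o _ = (Re \o f) \* (Im \o g) \+ (Im \o f) \* (Re \o g)); last first.
  by apply/funext => r /=; rewrite Im_mul.
apply: is_derive_eq.
by rewrite Im_add !Im_mul /= /GRing.scale /=; ring.
Qed.

Lemma cderiv_cst z s : cderiv (fun=> z) s 0.
Proof. by split; exact: is_derive_cst. Qed.

Lemma cderiv_real (f : R -> R) (s f' : R) : is_derive s (1 : R) f f' ->
  cderiv (fun r => (f r)%:C) s f'%:C.
Proof. by move=> h; split => //=; exact: is_derive_cst. Qed.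

Lemma cderivZ z f s f' : cderiv f s f' -> cderiv (fun r => z * f r) s (z * f').
Proof.
move=> h; have := cderivM (cderiv_cst z s) h; by rewrite mul0r add0r.
Qed.

Lemma cderiv_sum (I : Type) (r : seq I) (P : pred I) (F : I -> R -> C) F' s :
  (forall i, P i -> cderiv (F i) s (F' i)) ->
  cderiv (fun x => \sum_(i <- r | P i) F i x) s (\sum_(i <- r | P i) F' i).
Proof.
move=> h; elim: r => [|i r ih].
  under eq_fun do rewrite big_nil.
  by rewrite big_nil; exact: cderiv_cst.
under eq_fun do rewrite big_cons.
rewrite big_cons; case: ifPn => // Pi.
by apply: cderivD => //; exact: h.
Qed.

Lemma cderiv_cexp z s : cderiv (fun r => cexp (r%:C * z)) s (z * cexp (s%:C * z)).
Proof.
case: z => a b; split.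
  rewrite (_ : _ \o _ = (fun r => expR (r * a) * cos (r * b))); last first.
    by apply/funext => r /=; rewrite !mul0r subr0 addr0.
  apply: is_derive_eq; rewrite Re_mul /cexp /= /GRing.scale /= !mul0r !subr0 !addr0; ring.
rewrite (_ : _ \o _ = (fun r => expR (r * a) * sin (r * b))); last first.
  by apply/funext => r /=; rewrite !mul0r subr0 addr0.
apply: is_derive_eq; rewrite Im_mul /cexp /= /GRing.scale /= !mul0r !subr0 !addr0; ring.
Qed.

Lemma is_derive_exprn (n : nat) (x : R) :
  is_derive x (1 : R) (fun r : R => r ^+ n) (n%:R * x ^+ n.-1).
Proof.
apply: DeriveDef; first exact: exprn_derivable.
by rewrite exp_derive /GRing.scale /= mulr1.
Qed.

(** Mean value inequality: testing against the conjugate of the increment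
    reduces it to monotonicity of a real function. *)
Lemma cderiv_bound (f f' : R -> C) (g g' : R -> R) :
  (forall s : R, 0 <= s <= 1 -> cderiv f s (f' s)) ->
  (forall s : R, 0 <= s <= 1 -> is_derive s (1 : R) g (g' s)) ->
  (forall s : R, 0 <= s <= 1 -> cn (f' s) <= g' s) ->
  cn (f 1 - f 0) <= g 1 - g 0.
Proof.
move=> df dg le.
have [->|nz] := eqVneq (f 1 - f 0) 0.
  rewrite cn0 subr_ge0.
  apply: (@ger0_derive1_le_cc R g 0 1) => //; rewrite ?in_itv /= ?lexx ?ler01 //.
  - move=> x; rewrite in_itv /= => /andP[x0 x1].
    have x01 : 0 <= x <= 1 by rewrite !ltW.
    by have [] := dg x x01.
  - move=> x; rewrite in_itv /= => /andP[x0 x1].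
    have x01 : 0 <= x <= 1 by rewrite !ltW.
    rewrite derive1E; have [_ ->] := dg x x01.
    by apply: le_trans (le x x01); rewrite cn_ge0.
  - apply: derivable_within_continuous => x; rewrite in_itv /= => x01.
    by have [] := dg x x01.
set v := f 1 - f 0 in nz *.
pose u := v^*.
pose h r := Re (u * f r) - cn u * g r.
have dh (s : R) : 0 <= s <= 1 -> is_derive s (1 : R) h (Re (u * f' s) - cn u * g' s).
  move=> s01; have [h1 _] := cderivZ u (df s s01).
  have h2 := dg s s01.
  have -> : h = (Re \o (fun r => u * f r)) \- (cn u \*: g) by [].
  by apply: is_derive_eq.
have h10 : h 1 <= h 0.
  apply: (@ler0_derive1_le_cc R h 0 1) => //; rewrite ?in_itv /= ?lexx ?ler01 //.
  - move=> x; rewrite in_itv /= => /andP[x0 x1].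
    have x01 : 0 <= x <= 1 by rewrite !ltW.
    by have [] := dh x x01.
  - move=> x; rewrite in_itv /= => /andP[x0 x1].
    have x01 : 0 <= x <= 1 by rewrite !ltW.
    rewrite derive1E; have [_ ->] := dh x x01.
    rewrite subr_le0; apply: le_trans (ler_norm _) _.
    apply: le_trans (Re_le_cn _) _; rewrite cnM ler_wpM2l ?cn_ge0 //.
    exact: le.
  - apply: derivable_within_continuous => x; rewrite in_itv /= => x01.
    by have [] := dh x x01.
have : Re (u * v) <= cn u * (g 1 - g 0).
  have : Re (u * v) = Re (u * f 1) - Re (u * f 0).
    by rewrite /v mulrBr Re_add Re_opp.
  move: h10; rewrite /h => ? ->; lra.
have -> : u * v = (cn v ^+ 2)%:C.
  by rewrite rmorphXn /= -cnE sqr_normc mulrC.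
have -> : cn u = cn v by rewrite /cn normcJ.
by rewrite /= expr2 ler_pM2l // lt_neqAle cn_ge0 andbT eq_sym cn_eq0.
Qed.

(** The remainder of the exponential series; the factor [max 1 (expR (Re y))]
    bounds [cexp] on the segment from [0] to [y]. *)
Lemma cexp_taylor N z :
  cn (cexp z - \sum_(n < N) z ^+ n / n`!%:R)
    <= cn z ^+ N / N`!%:R * Num.max 1 (expR (Re z)).
Proof.
suff H (s : R) : 0 <= s <= 1 ->
    cn (cexp (s%:C * z) - \sum_(n < N) (s%:C * z) ^+ n / n`!%:R)
    <= s ^+ N * (cn z ^+ N / N`!%:R * Num.max 1 (expR (Re z))).
  by have := H 1; rewrite !mul1r ler01 lexx expr1n mul1r; exact.
elim: N s => [|N ih] s /andP[s0 s1].
  rewrite big_ord0 subr0 !expr0 fact0 divr1 !mul1r cn_cexp Re_scale.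
  have [zp|zn] := leP 0 (Re z).
    by rewrite le_max ler_expR ler_piMl // orbT.
  by rewrite le_max expR_le1 nmulr_lle0 ?s0.
pose K := cn z ^+ N.+1 / N`!%:R * Num.max 1 (expR (Re z)).
pose f (r : R) : C := cexp ((r * s)%:C * z) - \sum_(n < N.+1) ((r * s)%:C * z) ^+ n / n`!%:R.
pose f' (r : R) : C := (s%:C * z) * (cexp ((r * s)%:C * z) - \sum_(n < N) ((r * s)%:C * z) ^+ n / n`!%:R).
pose g (r : R) : R := r ^+ N.+1 * (s ^+ N.+1 * (K / N.+1%:R)).
pose g' (r : R) : R := r ^+ N * (s ^+ N.+1 * K).
have df r : cderiv f r (f' r).
  rewrite /f /f' mulrBr; apply: cderivD.
    have -> : (fun r => cexp ((r * s)%:C * z)) = (fun r => cexp (r%:C * (s%:C * z))).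
      by apply/funext => q; rewrite rcM mulrA.
    by have := cderiv_cexp (s%:C * z) r; rewrite rcM mulrA.
  have -> : - (s%:C * z * (\sum_(n < N) ((r * s)%:C * z) ^+ n / n`!%:R))
          = (-1) * \sum_(n < N.+1) (n%:R * r ^+ n.-1)%:C * ((s%:C * z) ^+ n / n`!%:R).
    rewrite mulN1r big_ord_recl /= mul0r mul0r add0r; congr (- _).
    rewrite mulr_sumr; apply: eq_bigr => n _; rewrite /= add0n /bump /= add1n.
    rewrite factS natrM invfM exprS [in RHS]rcM rcM.
    rewrite rc_nat rcX -[r%:C * _ * z]mulrA exprMn.
    have n0 : n.+1%:R != 0 :> C by rewrite pnatr_eq0.
    have m0 : n`!%:R != 0 :> C by rewrite pnatr_eq0 -lt0n fact_gt0.
    by field; rewrite m0 nat1r n0.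
  have -> : (fun x => - \sum_(n < N.+1) ((x * s)%:C * z) ^+ n / n`!%:R)
       = (fun x => (-1) * \sum_(n < N.+1) (x ^+ n)%:C * ((s%:C * z) ^+ n / n`!%:R)).
    apply/funext => x; rewrite mulN1r; congr (- _); apply: eq_bigr => n _.
    by rewrite rcM -[_ * _ * z]mulrA exprMn rcX mulrA.
  apply: cderivZ; apply: cderiv_sum => n _.
  rewrite [X in cderiv _ _ X]mulrC.
  have -> : (fun x : R => (x ^+ n)%:C * ((s%:C * z) ^+ n / n`!%:R)) =
       (fun x : R => ((s%:C * z) ^+ n / n`!%:R) * (x ^+ n)%:C).
    by apply/funext => x; rewrite mulrC.
  by apply: cderivZ; apply: cderiv_real; exact: is_derive_exprn.
have dg r : is_derive r (1 : R) g (g' r).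
  rewrite /g (_ : (fun _ => _) = (fun r : R => (s ^+ N.+1 * (K / N.+1%:R)) * r ^+ N.+1)).
    have := is_deriveZ (s ^+ N.+1 * (K / N.+1%:R)) (is_derive_exprn N.+1 r).
    rewrite /g' /GRing.scale /=.
    have n0 : N.+1%:R != 0 :> R by rewrite pnatr_eq0.
    by congr (is_derive _ _ _ _); field; rewrite nat1r n0.
  by apply/funext => q; rewrite mulrC.
have := cderiv_bound (fun r _ => df r) (fun r _ => dg r).
have -> : f 0 = 0.
  rewrite /f mul0r [0%:C]/(0 : C) mul0r cexp0.
  rewrite big_ord_recl /= expr0 fact0 divr1 big1 ?addr0 ?subrr //.
  by move=> i _; rewrite expr0n mul0r.
have -> : f 1 = cexp (s%:C * z) - \sum_(n < N.+1) (s%:C * z) ^+ n / n`!%:R.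
  by rewrite /f mul1r.
rewrite subr0 {1 2}/g expr1n expr0n mul0r subr0 mul1r.
move=> H; apply: le_trans (H _) _.
  move=> r /andP[r0 r1]; rewrite /f' /g' !cnM cn_real ger0_norm // .
  have rs : 0 <= r * s <= 1 by rewrite mulr_ge0 // mulr_ile1.
  apply: le_trans (ler_wpM2l _ (ih _ rs)) _; first by rewrite mulr_ge0 ?cn_ge0.
  rewrite exprMn le_eqVlt; apply/orP; left; apply/eqP.
  by rewrite /K !exprS; ring.
rewrite le_eqVlt; apply/orP; left; apply/eqP; rewrite /K factS natrM.
have n0 : N.+1%:R != 0 :> R by rewrite pnatr_eq0.
have m0 : N`!%:R != 0 :> R by rewrite pnatr_eq0 -lt0n fact_gt0.
by field; rewrite m0 nat1r n0.
Qed.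

End complex_basics.

(** * Complex integrals *)

Section cintegral_theory.
Context {R : realType} d (T : measurableType d).
Local Notation C := R[i].
Local Notation Re := (@complex.Re R).
Local Notation Im := (@complex.Im R).

Definition cmeas (f : T -> C) : Prop :=
  measurable_fun setT (Re \o f) /\ measurable_fun setT (Im \o f).

Lemma cmeas_cst z : cmeas (fun=> z).
Proof. by split; exact: measurable_cst. Qed.

Lemma cmeas_real (f : T -> R) : measurable_fun setT f -> cmeas (fun x => (f x)%:C).
Proof. by move=> mf; split => //; exact: measurable_cst. Qed.

Lemma cmeasD f g : cmeas f -> cmeas g -> cmeas (fun x => f x + g x).
Proof.
move=> [a b] [a' b']; split.
  rewrite (_ : _ \o _ = (Re \o f) \+ (Re \o g)); first exact: measurable_funD.
  by apply/funext => x /=; rewrite Re_add.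
rewrite (_ : _ \o _ = (Im \o f) \+ (Im \o g)); first exact: measurable_funD.
by apply/funext => x /=; rewrite Im_add.
Qed.

Lemma cmeasM f g : cmeas f -> cmeas g -> cmeas (fun x => f x * g x).
Proof.
move=> [a b] [a' b']; split.
  rewrite (_ : _ \o _ = (Re \o f) \* (Re \o g) \- (Im \o f) \* (Im \o g)).
    by apply: measurable_funB; exact: measurable_funM.
  by apply/funext => x /=; rewrite Re_mul.
rewrite (_ : _ \o _ = (Re \o f) \* (Im \o g) \+ (Im \o f) \* (Re \o g)).
  by apply: measurable_funD; exact: measurable_funM.
by apply/funext => x /=; rewrite Im_mul.
Qed.

Lemma cmeasZ z f : cmeas f -> cmeas (fun x => z * f x).
Proof. by move=> mf; apply: cmeasM => //; exact: cmeas_cst. Qed.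

Lemma cmeasN f : cmeas f -> cmeas (fun x => - f x).
Proof. by move/(cmeasZ (-1)); under eq_fun do rewrite mulN1r. Qed.

Lemma cmeasB f g : cmeas f -> cmeas g -> cmeas (fun x => f x - g x).
Proof. by move=> mf mg; apply: cmeasD => //; exact: cmeasN. Qed.

Lemma cmeasX f n : cmeas f -> cmeas (fun x => f x ^+ n).
Proof.
move=> mf; elim: n => [|n ih].
  by under eq_fun do rewrite expr0; exact: cmeas_cst.
by under eq_fun do rewrite exprS; exact: cmeasM.
Qed.

Lemma cmeas_cexp f : cmeas f -> cmeas (fun x => cexp (f x)).
Proof.
move=> [a b]; split; rewrite /cexp /comp /=; apply: measurable_funM.
- by apply: measurableT_comp a.
- by apply: measurableT_comp b; apply: continuous_measurable_fun => x; exact: continuous_cos.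
- by apply: measurableT_comp a.
- by apply: measurableT_comp b; apply: continuous_measurable_fun => x; exact: continuous_sin.
Qed.

Lemma measurable_cn f : cmeas f -> measurable_fun setT (cn \o f).
Proof.
move=> [a b].
rewrite (_ : _ \o _ = Num.sqrt \o ((Re \o f) \* (Re \o f) \+ (Im \o f) \* (Im \o f))).
  apply: measurableT_comp; first by apply: continuous_measurable_fun => x; exact: sqrt_continuous.
  by apply: measurable_funD; exact: measurable_funM.
by apply/funext => x /=; rewrite cn_def !expr2.
Qed.

Variable mu : {measure set T -> \bar R}.
Local Notation cI := (cintegral mu setT).

Lemma cintegrable_meas f : cintegrable mu setT f -> cmeas f.
Proof.
move=> [a b]; split; apply/measurable_EFinP; [exact: measurable_int a|exact: measurable_int b].
Qed.

Lemma integrableZR (r : R) (f : T -> R) : mu.-integrable setT (EFin \o f) ->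
  mu.-integrable setT (EFin \o (fun x => r * f x)).
Proof. by move=> fi; exact: (integrableZl measurableT r fi). Qed.

Lemma integrableDR (f g : T -> R) : mu.-integrable setT (EFin \o f) ->
  mu.-integrable setT (EFin \o g) -> mu.-integrable setT (EFin \o (fun x => f x + g x)).
Proof. by move=> fi gi; exact: (integrableD measurableT fi gi). Qed.

Lemma integrable_dom (f g : T -> R) : measurable_fun setT f ->
  (forall x, `|f x| <= g x) -> mu.-integrable setT (EFin \o g) ->
  mu.-integrable setT (EFin \o f).
Proof.
move=> mf fg ig; apply: (le_integrable _ _ _ ig) => //; first exact/measurable_EFinP.
move=> x _ /=; rewrite lee_fin; apply: le_trans (fg x) _.
exact: ler_norm.
Qed.

Lemma cintegrable_dom f (g : T -> R) : cmeas f ->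
  (forall x, cn (f x) <= g x) -> mu.-integrable setT (EFin \o g) ->
  cintegrable mu setT f.
Proof.
move=> [a b] fg ig; split; apply: integrable_dom ig => // x.
  exact: le_trans (Re_le_cn _) (fg x).
exact: le_trans (Im_le_cn _) (fg x).
Qed.

Lemma cintegrable_cn f : cintegrable mu setT f ->
  mu.-integrable setT (EFin \o (cn \o f)).
Proof.
move=> fi; have [a b] := fi.
have iRI : mu.-integrable setT (EFin \o (fun x => `|Re (f x)| + `|Im (f x)|)).
  apply: (@integrableD _ _ _ mu setT measurableT (fun x => `|(Re (f x))%:E|)%E (fun x => `|(Im (f x))%:E|)%E);
    exact: integrable_abse.
apply: integrable_dom iRI; first exact/measurable_cn/cintegrable_meas.
by move=> x; rewrite ger0_norm ?cn_ge0 // cn_le.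
Qed.

Lemma cintegrableD f g : cintegrable mu setT f -> cintegrable mu setT g ->
  cintegrable mu setT (fun x => f x + g x).
Proof.
move=> fi gi.
apply: (@cintegrable_dom _ (fun x => cn (f x) + cn (g x))).
- by apply: cmeasD; exact: cintegrable_meas.
- by move=> x; exact: cnD.
- exact: (integrableD measurableT (cintegrable_cn fi) (cintegrable_cn gi)).
Qed.

Lemma cintegrableZ z f : cintegrable mu setT f ->
  cintegrable mu setT (fun x => z * f x).
Proof.
move=> fi; apply: (@cintegrable_dom _ (fun x => cn z * cn (f x))).
- by apply: cmeasZ; exact: cintegrable_meas.
- by move=> x; rewrite cnM.
- exact: (integrableZl measurableT _ (cintegrable_cn fi)).
Qed.

Lemma cintegralD f g : cintegrable mu setT f -> cintegrable mu setT g ->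
  cI (fun x => f x + g x) = cI f + cI g.
Proof.
move=> [a b] [a' b']; rewrite /cintegral [RHS]complex_eta Re_add Im_add /=.
congr Complex; rewrite -RintegralD //; apply: eq_Rintegral => x _.
  by rewrite Re_add.
by rewrite Im_add.
Qed.

Lemma cintegralZ z f : cintegrable mu setT f ->
  cI (fun x => z * f x) = z * cI f.
Proof.
move=> [a b]; rewrite /cintegral [RHS]complex_eta Re_mul Im_mul /=.
have ia r : mu.-integrable setT (EFin \o (fun x => r * Re (f x))).
  exact: (integrableZl measurableT r a).
have ib r : mu.-integrable setT (EFin \o (fun x => r * Im (f x))).
  exact: (integrableZl measurableT r b).
congr Complex; rewrite -!RintegralZl //.
  by rewrite -RintegralB //; apply: eq_Rintegral => x _; rewrite Re_mul.
by rewrite -RintegralD //; apply: eq_Rintegral => x _; rewrite Im_mul.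
Qed.

Lemma cintegralZr z f : cintegrable mu setT f ->
  cI (fun x => f x * z) = cI f * z.
Proof. by move=> fi; under eq_fun do rewrite mulrC; rewrite cintegralZ // mulrC. Qed.

Lemma cintegrableB f g : cintegrable mu setT f -> cintegrable mu setT g ->
  cintegrable mu setT (fun x => f x - g x).
Proof.
move=> fi gi; apply: cintegrableD => //.
by under eq_fun do rewrite -mulN1r; exact: cintegrableZ.
Qed.

Lemma cintegralB f g : cintegrable mu setT f -> cintegrable mu setT g ->
  cI (fun x => f x - g x) = cI f - cI g.
Proof.
move=> fi gi; under eq_fun do rewrite -[- g _]mulN1r.
by rewrite cintegralD ?cintegralZ ?mulN1r //; exact: cintegrableZ.
Qed.

Lemma cintegral0 : cI (fun=> 0) = 0.
Proof. by rewrite /cintegral /= /Rintegral integral0. Qed.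

Lemma cintegrable0 : cintegrable mu setT (fun=> 0).
Proof. by split; exact: integrable0. Qed.

Lemma cintegrable_sum (I : Type) (s : seq I) (P : pred I) (F : I -> T -> C) :
  (forall i, P i -> cintegrable mu setT (F i)) ->
  cintegrable mu setT (fun x => \sum_(i <- s | P i) F i x).
Proof.
move=> h; elim: s => [|i s ih].
  by under eq_fun do rewrite big_nil; exact: cintegrable0.
under eq_fun do rewrite big_cons.
by have [Pi|//] := boolP (P i); apply: cintegrableD => //; exact: h.
Qed.

Lemma cintegral_sum (I : Type) (s : seq I) (P : pred I) (F : I -> T -> C) :
  (forall i, P i -> cintegrable mu setT (F i)) ->
  cI (fun x => \sum_(i <- s | P i) F i x) = \sum_(i <- s | P i) cI (F i).
Proof.
move=> h; elim: s => [|i s ih].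
  by under eq_fun do rewrite big_nil; rewrite big_nil cintegral0.
under eq_fun do rewrite big_cons.
rewrite big_cons; have [Pi|//] := boolP (P i).
rewrite cintegralD ?ih //; first exact: h.
exact: cintegrable_sum.
Qed.

Lemma cintegral_real (f : T -> R) : cI (fun x => (f x)%:C) = (\int[mu]_x f x)%:C.
Proof. by rewrite /cintegral /=; congr Complex; rewrite /Rintegral integral0. Qed.

Lemma cintegrable_real (f : T -> R) : mu.-integrable setT (EFin \o f) ->
  cintegrable mu setT (fun x => (f x)%:C).
Proof. by move=> fi; split => //; exact: integrable0. Qed.

Lemma cn_cintegral f (g : T -> R) : cmeas f ->
  (forall x, cn (f x) <= g x) -> mu.-integrable setT (EFin \o g) ->
  cn (cI f) <= \int[mu]_x g x.
Proof.
move=> mf fg ig; have fi := cintegrable_dom mf fg ig.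
have [->|nz] := eqVneq (cI f) 0.
  by rewrite cn0 Rintegral_ge0 // => x _; apply: le_trans (fg x); exact: cn_ge0.
set v := cI f in nz *.
have : Re (v^* * v) <= cn v * \int[mu]_x g x.
  rewrite -cintegralZ // /cintegral /= -RintegralZl //.
  have [h _] := cintegrableZ v^* fi.
  apply: le_Rintegral => //; first exact: (integrableZl measurableT (cn v) ig).
  move=> x _; apply: le_trans (ler_norm _) _; apply: le_trans (Re_le_cn _) _.
  by rewrite cnM /cn normcJ -/(cn _) -/(cn _) ler_wpM2l ?cn_ge0.
have -> : v^* * v = (cn v ^+ 2)%:C by rewrite rcX -cnE sqr_normc mulrC.
by rewrite /= expr2 ler_pM2l // lt_neqAle cn_ge0 andbT eq_sym cn_eq0.
Qed.

End cintegral_theory.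

Section product.
Context {R : realType} d1 d2 (T1 : measurableType d1) (T2 : measurableType d2).
Local Notation C := R[i].
Local Notation Re := (@complex.Re R).
Local Notation Im := (@complex.Im R).

Lemma cmeas_comp (f : T2 -> C) (g : T1 -> T2) : cmeas f -> measurable_fun setT g ->
  cmeas (f \o g).
Proof. by move=> [a b] mg; split; [exact: measurableT_comp a mg|exact: measurableT_comp b mg]. Qed.

Variables (m1 : {sigma_finite_measure set T1 -> \bar R})
          (m2 : {sigma_finite_measure set T2 -> \bar R}).

Lemma integrable_prod (g1 : T1 -> R) (g2 : T2 -> R) :
  (forall x, 0 <= g1 x) -> (forall x, 0 <= g2 x) ->
  m1.-integrable setT (EFin \o g1) -> m2.-integrable setT (EFin \o g2) ->
  (m1 \x m2)%E.-integrable setT (EFin \o (fun p => g1 p.1 * g2 p.2)).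
Proof.
move=> p1 p2 i1 i2.
have mg1 : measurable_fun setT g1 by apply/measurable_EFinP; exact: measurable_int i1.
have mg2 : measurable_fun setT g2 by apply/measurable_EFinP; exact: measurable_int i2.
apply/integrable12ltyP.
  apply/measurable_EFinP; apply: measurable_funM.
    exact: measurableT_comp mg1 measurable_fst.
  exact: measurableT_comp mg2 measurable_snd.
under eq_integral => x _.
  under eq_integral => y _ do rewrite /= ger0_norm ?mulr_ge0 // EFinM.
  rewrite ge0_integralZl //; last 3 first.
  - exact/measurable_EFinP.
  - by move=> y _; rewrite lee_fin.
  - by rewrite lee_fin.
  over.
rewrite ge0_integralZr //; last 3 first.
- exact/measurable_EFinP.
- by move=> y _; rewrite lee_fin.
- by apply: integral_ge0 => y _; rewrite lee_fin.
have f1 := integrable_fin_num measurableT i1.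
have f2 := integrable_fin_num measurableT i2.
rewrite -ge0_fin_numE; first exact: fin_numM.
by apply: mule_ge0; apply: integral_ge0 => y _; rewrite lee_fin.
Qed.

Section dominated.
Variables (g1 : T1 -> R) (g2 : T2 -> R).
Hypotheses (p1 : forall x, 0 <= g1 x) (p2 : forall x, 0 <= g2 x)
  (i1 : m1.-integrable setT (EFin \o g1)) (i2 : m2.-integrable setT (EFin \o g2)).

Lemma rfubini_dom (f : T1 * T2 -> R) : measurable_fun setT f ->
  (forall x y, `|f (x, y)| <= g1 x * g2 y) ->
  [/\ measurable_fun setT (fun x => \int[m2]_y f (x, y)),
      measurable_fun setT (fun y => \int[m1]_x f (x, y)),
      \int[(m1 \x m2)%E]_p f p = \int[m1]_x \int[m2]_y f (x, y) &
      \int[(m1 \x m2)%E]_p f p = \int[m2]_y \int[m1]_x f (x, y) ].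
Proof.
move=> mf fg.
have fi : (m1 \x m2)%E.-integrable setT (EFin \o f).
  apply: integrable_dom (integrable_prod p1 p2 i1 i2) => //.
  by move=> [x y]; exact: fg.
have E2 x : m2.-integrable setT (fun y => (f (x, y))%:E).
  apply: (@integrable_dom _ _ _ m2 (fun y => f (x, y)) (fun y => g1 x * g2 y)) => //.
    exact: measurableT_comp mf (pair1_measurable x).
  exact: (integrableZl measurableT (g1 x) i2).
have E1 y : m1.-integrable setT (fun x => (f (x, y))%:E).
  apply: (@integrable_dom _ _ _ m1 (fun x => f (x, y)) (fun x => g1 x * g2 y)) => //.
    exact: measurableT_comp mf (pair2_measurable y).
  exact: (integrableZr measurableT (g2 y) i1).
have F2 x : fubini_F m2 (EFin \o f) x = (\int[m2]_y f (x, y))%:E.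
  by rewrite /fubini_F /= fineK //; exact: integrable_fin_num.
have F1 y : fubini_G m1 (EFin \o f) y = (\int[m1]_x f (x, y))%:E.
  by rewrite /fubini_G /= fineK //; exact: integrable_fin_num.
split.
- apply/measurable_EFinP; have := measurable_fubini_F fi.
  by congr measurable_fun; apply/funext => x; rewrite F2.
- apply/measurable_EFinP; have := measurable_fubini_G fi.
  by congr measurable_fun; apply/funext => x; rewrite F1.
- rewrite /Rintegral -integral12_prod_meas1 //; congr fine.
  by apply: eq_integral => x _; rewrite F2.
- rewrite /Rintegral -integral21_prod_meas1 //; congr fine.
  by apply: eq_integral => x _; rewrite F1.
Qed.

(** For integrands dominated by a product, every section is integrable, so no
    exceptional null set has to be removed. *)
Lemma cfubini_dom (f : T1 * T2 -> C) : cmeas f ->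
  (forall x y, cn (f (x, y)) <= g1 x * g2 y) ->
  [/\ cmeas (fun x => cintegral m2 setT (fun y => f (x, y))),
      cmeas (fun y => cintegral m1 setT (fun x => f (x, y))),
      cintegral (m1 \x m2)%E setT f =
        cintegral m1 setT (fun x => cintegral m2 setT (fun y => f (x, y))) &
      cintegral (m1 \x m2)%E setT f =
        cintegral m2 setT (fun y => cintegral m1 setT (fun x => f (x, y)))].
Proof.
move=> [mr mi] fg.
have [r1 r2 r3 r4] := rfubini_dom mr (fun x y => le_trans (Re_le_cn _) (fg x y)).
have [s1 s2 s3 s4] := rfubini_dom mi (fun x y => le_trans (Im_le_cn _) (fg x y)).
split; try by split.
  by rewrite /cintegral /=; congr Complex.
by rewrite /cintegral /=; congr Complex.
Qed.

End dominated.
End product.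

(** * Changes of variables on the line *)

Section change_of_variables.
Context {R : realType} d1 d2 (T1 : measurableType d1) (T2 : measurableType d2).
Variables (m1 : {measure set T1 -> \bar R}) (m2 : {measure set T2 -> \bar R}).
Variable phi : T1 -> T2.
Hypotheses (mphi : measurable_fun setT phi)
  (pE : forall A, measurable A -> m1 (phi @^-1` A) = m2 A).

Let push := measure_function_pushforward__canonical__measure_function_Measure m1 mphi.

Let integral_pushE (h : T2 -> \bar R) : (\int[push]_x h x = \int[m2]_x h x)%E.
Proof. by apply: eq_measure_integral => A mA _; exact: pE. Qed.

Lemma integrable_push (h : T2 -> R) : measurable_fun setT h ->
  m1.-integrable setT (EFin \o (h \o phi)) -> m2.-integrable setT (EFin \o h).
Proof.
move=> mh ih; apply/integrableP; split; first exact/measurable_EFinP.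
have := @integrable_pushforward _ _ _ _ R phi mphi m1 setT (EFin \o h) _ _ measurableT.
rewrite preimage_setT => H.
have /integrableP[_] := H ((measurable_EFinP _ _).2 mh) ih.
by rewrite (integral_pushE (fun x => `|(EFin \o h) x|%E)).
Qed.

Lemma Rintegral_push (h : T2 -> R) : measurable_fun setT h ->
  m1.-integrable setT (EFin \o (h \o phi)) ->
  \int[m1]_x h (phi x) = \int[m2]_x h x.
Proof.
move=> mh ih; rewrite /Rintegral -integral_pushE.
have := @integral_pushforward _ _ _ _ R phi mphi m1 setT (EFin \o h) _ _ measurableT.
by rewrite preimage_setT => -> //; exact/measurable_EFinP.
Qed.

Lemma cintegral_push (f : T2 -> R[i]) : cmeas f ->
  cintegrable m1 setT (f \o phi) ->
  cintegral m1 setT (f \o phi) = cintegral m2 setT f.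
Proof.
move=> [mr mi] [ir ii]; rewrite /cintegral; congr Complex.
  exact: (@Rintegral_push (@complex.Re R \o f)).
exact: (@Rintegral_push (@complex.Im R \o f)).
Qed.

Lemma cintegrable_push (f : T2 -> R[i]) : cmeas f ->
  cintegrable m1 setT (f \o phi) -> cintegrable m2 setT f.
Proof.
move=> [mr mi] [ir ii]; split.
  exact: (@integrable_push (@complex.Re R \o f)).
exact: (@integrable_push (@complex.Im R \o f)).
Qed.

End change_of_variables.

Section lebesgue_line.
Context {R : realType}.
Local Notation C := R[i].
Local Notation mu := (@lebesgue_measure R).
Local Notation RT := (measurableTypeR R).

Lemma lebesgue_measureD (v : R) (A : set RT) : measurable A ->
  mu ((fun x : RT => x + v : RT) @^-1` A) = mu A.
Proof.
move=> mA.
have mphi : measurable_fun setT (fun x : RT => x + v : RT) by exact: measurable_funD.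
pose m := measure_function_pushforward__canonical__measure_function_Measure mu mphi.
apply/esym/(@lebesgue_measure_unique R m) => //= _ [[a b]] _ <-.
rewrite /pushforward (_ : _ @^-1` _ = `]a - v, b - v]%classic); last first.
  by apply/seteqP; split => x /=; rewrite !in_itv /= ltrBlDr lerBrDr.
rewrite /= !lebesgue_measure_itv /= !lte_fin ltrD2r.
by rewrite -!EFinB opprB addrA subrK.
Qed.

Let measurable_oppRT : measurable_fun setT (fun x : RT => - x : RT).
Proof. exact: oppr_measurable. Qed.

Lemma lebesgue_measure_opp (A : set RT) : measurable A ->
  mu ((fun x : RT => - x : RT) @^-1` A) = mu A.
Proof.
move=> mA.
pose m := measure_function_pushforward__canonical__measure_function_Measure mu measurable_oppRT.
apply/esym/(@lebesgue_measure_unique R m) => //= _ [[a b]] _ <-.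
rewrite /pushforward opp_preimage_itvbndbnd /= !lebesgue_measure_itv /=.
by rewrite !lte_fin ltrN2 opprK addrC.
Qed.

Lemma cintegral_shiftR (f : R -> C) v : cmeas (f : RT -> C) ->
  cintegrable mu setT (fun x : RT => f (x + v)) ->
  cintegral mu setT (fun x : RT => f (x + v)) = cintegral mu setT (f : RT -> C).
Proof.
move=> mf fi; apply: (@cintegral_push _ _ _ _ _ mu mu (fun x : RT => (x + v : RT))) => //.
  exact: measurable_funD.
by move=> A mA; exact: lebesgue_measureD.
Qed.

Lemma cintegral_oppR (f : R -> C) : cmeas (f : RT -> C) ->
  cintegrable mu setT (fun x : RT => f (- x)) ->
  cintegral mu setT (fun x : RT => f (- x)) = cintegral mu setT (f : RT -> C).
Proof.
move=> mf fi; apply: (@cintegral_push _ _ _ _ _ mu mu (fun x : RT => (- x : RT))) => //.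
by move=> A mA; exact: lebesgue_measure_opp.
Qed.

Lemma integrable_expR_norm (b : R) : 0 < b ->
  mu.-integrable setT (EFin \o (fun x : RT => expR (- (b * `|x|)))).
Proof.
move=> b0.
have ipdf := integrable_exponential_pdf b0.
have mpdf := measurable_exponential_pdf b.
have ipdfN : mu.-integrable setT (EFin \o (fun x : RT => exponential_pdf b (- x))).
  apply: (@integrable_push _ _ _ _ _ mu mu _ measurable_oppRT) => //.
  - by move=> A mA; exact: lebesgue_measure_opp.
  - exact: (measurableT_comp mpdf).
  - by move: ipdf; congr integrable; apply/funext => x /=; rewrite opprK.
apply: (@integrable_dom _ _ _ mu _
   (fun x : RT => b^-1 * (exponential_pdf b x + exponential_pdf b (- x)))).
- apply: measurableT_comp => //; apply: measurableT_comp => //.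
  by apply: measurable_funM => //; exact: measurableT_comp.
- move=> x; rewrite ger0_norm ?expR_ge0 //.
  have e0 y : 0 <= exponential_pdf b y by exact: (exponential_pdf_ge0 (ltW b0)).
  have [x0|x0] := leP 0 x.
    apply: (@le_trans _ _ (b^-1 * exponential_pdf b x)).
      by rewrite exponential_pdfE // /exponential_pdf /= mulrA mulVf ?gt_eqF // mul1r ger0_norm // mulNr.
    by rewrite ler_wpM2l ?invr_ge0 ?(ltW b0) // lerDl.
  apply: (@le_trans _ _ (b^-1 * exponential_pdf b (- x))).
    rewrite exponential_pdfE ?oppr_ge0 ?(ltW x0) //.
    by rewrite mulrA mulVf ?gt_eqF // mul1r ltr0_norm // mulNr.
  by rewrite ler_wpM2l ?invr_ge0 ?(ltW b0) // lerDr.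
- by apply: integrableZR; exact: (integrableDR ipdf ipdfN).
Qed.

End lebesgue_line.

(** * Lebesgue measure on Euclidean space *)

Section euclidean.
Context {R : realType}.
Local Notation C := R[i].
Local Notation RT := (measurableTypeR R).

Definition norm1 n (x : 'rV[R]_n) : R := \sum_k `|x ord0 k|.

Lemma norm1_ge0 n (x : 'rV[R]_n) : 0 <= norm1 x.
Proof. by apply: sumr_ge0 => k _. Qed.

Lemma norm1D n (x y : 'rV[R]_n) : norm1 (x + y) <= norm1 x + norm1 y.
Proof.
by rewrite /norm1 -big_split /=; apply: ler_sum => k _; rewrite mxE ler_normD.
Qed.

Lemma norm1N n (x : 'rV[R]_n) : norm1 (- x) = norm1 x.
Proof. by rewrite /norm1; apply: eq_bigr => k _; rewrite mxE normrN. Qed.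

Lemma norm1B n (x y : 'rV[R]_n) : norm1 x - norm1 y <= norm1 (x + y).
Proof.
rewrite lerBlDr -(norm1N y) -[in leLHS](addrK y x).
exact: norm1D.
Qed.

Lemma norm1Z n c (x : 'rV[R]_n) : norm1 (c *: x) = `|c| * norm1 x.
Proof. by rewrite /norm1 mulr_sumr; apply: eq_bigr => k _; rewrite mxE normrM. Qed.

Lemma coord_le_norm1 n (x : 'rV[R]_n) k : `|x ord0 k| <= norm1 x.
Proof. by rewrite /norm1 (bigD1 k) //= lerDl sumr_ge0. Qed.

Lemma dot_le_norm1 n (x y : 'rV[R]_n) : `|dot x y| <= norm1 x * norm1 y.
Proof.
rewrite /dot; apply: le_trans (ler_norm_sum _ _ _) _.
rewrite /norm1 mulr_suml; apply: ler_sum => k _.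
by rewrite normrM ler_wpM2l // coord_le_norm1.
Qed.

Lemma norm1_cons n x0 (x : 'rV[R]_n) : norm1 (cons_rV (x0, x)) = `|x0| + norm1 x.
Proof.
rewrite /norm1 big_ord_recl /= mxE unlift_none /=; congr (_ + _).
by apply: eq_bigr => k _; rewrite mxE liftK.
Qed.

Lemma dotC (K : comPzRingType) n (x y : 'rV[K]_n) : dot x y = dot y x.
Proof. by apply: eq_bigr => k _; rewrite mulrC. Qed.

Lemma dotDl (K : pzRingType) n (x y z : 'rV[K]_n) : dot (x + y) z = dot x z + dot y z.
Proof. by rewrite /dot -big_split; apply: eq_bigr => k _; rewrite mxE mulrDl. Qed.

Lemma dotDr (K : pzRingType) n (x y z : 'rV[K]_n) : dot z (x + y) = dot z x + dot z y.
Proof. by rewrite /dot -big_split; apply: eq_bigr => k _; rewrite mxE mulrDr. Qed.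

Lemma dotZl (K : pzRingType) n c (x y : 'rV[K]_n) : dot (c *: x) y = c * dot x y.
Proof. by rewrite /dot mulr_sumr; apply: eq_bigr => k _; rewrite mxE mulrA. Qed.

Lemma dotZr (K : comPzRingType) n c (x y : 'rV[K]_n) : dot x (c *: y) = c * dot x y.
Proof. by rewrite dotC dotZl dotC. Qed.

Lemma dotNl (K : pzRingType) n (x y : 'rV[K]_n) : dot (- x) y = - dot x y.
Proof. by rewrite -scaleN1r dotZl mulN1r. Qed.

Lemma dotNr (K : comPzRingType) n (x y : 'rV[K]_n) : dot x (- y) = - dot x y.
Proof. by rewrite dotC dotNl dotC. Qed.

Lemma dot0l (K : pzRingType) n (x : 'rV[K]_n) : dot 0 x = 0.
Proof. by rewrite -(scale0r (0 : 'rV_n)) dotZl mul0r. Qed.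

Lemma dot_cvec n (x y : 'rV[R]_n) : dot (cvec x) (cvec y) = (dot x y)%:C.
Proof. by rewrite /dot rc_sum; apply: eq_bigr => k _; rewrite !mxE -rcM. Qed.

Lemma dot_cons n x0 (x : 'rV[R]_n) y0 (y : 'rV[R]_n) :
  dot (cons_rV (x0, x)) (cons_rV (y0, y)) = x0 * y0 + dot x y.
Proof.
rewrite /dot big_ord_recl /= !mxE !unlift_none /=; congr (_ + _).
by apply: eq_bigr => k _; rewrite !mxE !liftK.
Qed.

Lemma cons_rVP n (x : 'rV[R]_n.+1) : exists x0 x', x = cons_rV (x0, x').
Proof.
exists (x ord0 ord0), (\row_j x ord0 (lift ord0 j)); apply/rowP => k.
by rewrite mxE; case: (unliftP ord0 k) => [j ->|->] //=; rewrite mxE.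
Qed.

Lemma cons_rVD n x0 y0 (x y : 'rV[R]_n) :
  cons_rV (x0, x) + cons_rV (y0, y) = cons_rV (x0 + y0, x + y).
Proof. by apply/rowP => k; rewrite !mxE /=; case: unlift => [j|] //=; rewrite mxE. Qed.

Lemma cons_rVN n x0 (x : 'rV[R]_n) : - cons_rV (x0, x) = cons_rV (- x0, - x).
Proof. by apply/rowP => k; rewrite !mxE /=; case: unlift => [j|] //=; rewrite mxE. Qed.

Lemma measurable_norm1 n : measurable_fun setT (@norm1 n).
Proof.
apply: measurable_sum => k; apply: measurableT_comp => //.
exact: measurable_coord.
Qed.

Lemma measurable_rVD n (v : 'rV[R]_n) : measurable_fun setT (fun x : 'rV[R]_n => x + v).
Proof.
apply: measurable_fun_rV => i; under eq_fun do rewrite mxE.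
by apply: measurable_funD => //; exact: measurable_coord.
Qed.

Lemma measurable_rVN n : measurable_fun setT (fun x : 'rV[R]_n => - x).
Proof.
apply: measurable_fun_rV => i; under eq_fun do rewrite mxE.
by apply: measurableT_comp => //; exact: measurable_coord.
Qed.

Lemma measurable_dot n d (T : measurableType d) (f g : T -> 'rV[R]_n) :
  measurable_fun setT f -> measurable_fun setT g ->
  measurable_fun setT (fun x => dot (f x) (g x)).
Proof.
move=> mf mg; apply: measurable_sum => k; apply: measurable_funM.
  exact: (measurableT_comp (@measurable_coord _ _ k) mf).
exact: (measurableT_comp (@measurable_coord _ _ k) mg).
Qed.

(** Exponential decay: stable under affine changes of variables and a product
    over the coordinates, so that all uses of Fubini's theorem are dominated. *)
Definition edecay n (f : 'rV[R]_n -> C) : Prop :=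
  exists A b : R, [/\ 0 <= A, 0 < b & forall x, cn (f x) <= A * expR (- (b * norm1 x))].

Lemma integrable_expR_norm1 n (b : R) : 0 < b ->
  (lebesgue_rV n).-integrable setT (EFin \o (fun x => expR (- (b * norm1 x)))).
Proof.
move=> b0; elim: n => [|n ih].
  have H : (\d_(0 : 'rV[R]_0)).-integrable setT (EFin \o cst (1 : R)).
    exact: finite_measure_integrable_cst.
  apply: (@integrable_dom _ _ _ (lebesgue_rV 0) _ (cst 1)) H.
  - by apply: measurableT_comp => //; apply: measurableT_comp => //; apply: measurable_funM => //; exact: measurable_norm1.
  - by move=> x; rewrite ger0_norm ?expR_ge0 // expR_le1 oppr_le0 mulr_ge0 ?(ltW b0) // norm1_ge0.
apply: (@integrable_push _ _ _ _ _ (@lebesgue_measure R \x lebesgue_rV n)%E _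
   (@cons_rV R n) (@measurable_cons_rV R n)) => //.
  by apply: measurableT_comp => //; apply: measurableT_comp => //; apply: measurable_funM => //; exact: measurable_norm1.
have := integrable_prod (fun x => expR_ge0 _) (fun x => expR_ge0 _)
   (integrable_expR_norm b0) ih.
congr integrable; apply/funext => -[x0 x] /=.
by rewrite norm1_cons -expRD mulrDr opprD.
Qed.

Lemma edecay_integrable n (f : 'rV[R]_n -> C) : cmeas f -> edecay f ->
  cintegrable (lebesgue_rV n) setT f.
Proof.
move=> mf [A [b [A0 b0 fb]]].
apply: cintegrable_dom mf fb _.
exact: (integrableZl measurableT A (integrable_expR_norm1 n b0)).
Qed.

Lemma cmeas_cons n (f : 'rV[R]_n.+1 -> C) : cmeas f -> cmeas (f \o @cons_rV R n).
Proof. by move=> mf; exact: (cmeas_comp mf (@measurable_cons_rV R n)). Qed.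

(** [lebesgue_rV n.+1] is by definition the image of a product measure, so that
    Fubini's theorem splits off the first coordinate; this is how every statement
    on [lebesgue_rV] is reduced to the line by induction on the dimension. *)
Lemma cintegral_lebesgueS n (f : 'rV[R]_n.+1 -> C) : cmeas f -> edecay f ->
  [/\ cmeas (fun x0 : RT => cintegral (lebesgue_rV n) setT (fun x => f (cons_rV (x0, x)))),
   cmeas (fun x => cintegral lebesgue_measure setT (fun x0 : RT => f (cons_rV (x0, x)))),
   cintegral (lebesgue_rV n.+1) setT f =
     cintegral lebesgue_measure setT (fun x0 : RT =>
       cintegral (lebesgue_rV n) setT (fun x => f (cons_rV (x0, x)))) &
   cintegral (lebesgue_rV n.+1) setT f =
     cintegral (lebesgue_rV n) setT (fun x =>
       cintegral lebesgue_measure setT (fun x0 : RT => f (cons_rV (x0, x))))].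
Proof.
move=> mf [A [b [A0 b0 fb]]].
have mfc := cmeas_cons mf.
have bd (x : RT) y : cn ((f \o @cons_rV R n) (x, y)) <= (A * expR (- (b * `|x|))) * expR (- (b * norm1 y)).
  by apply: le_trans (fb _) _; rewrite norm1_cons -mulrA -expRD mulrDr opprD.
have [h1 h2 h3 h4] := cfubini_dom
   (fun x : RT => mulr_ge0 A0 (expR_ge0 (- (b * `|x : R|)))) (fun x => expR_ge0 _)
   (integrableZl measurableT A (integrable_expR_norm b0)) (integrable_expR_norm1 n b0) mfc bd.
have push : cintegral (lebesgue_rV n.+1) setT f =
     cintegral (@lebesgue_measure R \x lebesgue_rV n)%E setT (f \o @cons_rV R n).
  have [mr mi] := mf.
  have [ir ii] : cintegrable (@lebesgue_measure R \x lebesgue_rV n)%E setT (f \o @cons_rV R n).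
    apply: (cintegrable_dom mfc (fun p => bd p.1 p.2)); last first.
      apply: (integrable_prod (fun x : RT => mulr_ge0 A0 (expR_ge0 (- (b * `|x : R|)))) (fun x => expR_ge0 _)
   (integrableZl measurableT A (integrable_expR_norm b0)) (integrable_expR_norm1 n b0)).
  exact/esym/(cintegral_push (@measurable_cons_rV R n)).
by split; [exact: h1|exact: h2|rewrite push h3|rewrite push h4].
Qed.

Lemma edecay_shift n (f : 'rV[R]_n -> C) v : edecay f -> edecay (fun x => f (x + v)).
Proof.
move=> [A [b [A0 b0 fb]]]; exists (A * expR (b * norm1 v)), b; split => //.
  by rewrite mulr_ge0 ?expR_ge0.
move=> x; apply: le_trans (fb _) _; rewrite -mulrA -expRD ler_wpM2l // ler_expR.
have := norm1B x v; nra.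
Qed.

Lemma edecay_opp n (f : 'rV[R]_n -> C) : edecay f -> edecay (fun x => f (- x)).
Proof.
by move=> [A [b [A0 b0 fb]]]; exists A, b; split => // x; rewrite -(norm1N x).
Qed.

Lemma edecay_section n (f : 'rV[R]_n.+1 -> C) x0 : edecay f ->
  edecay (fun x => f (cons_rV (x0, x))).
Proof.
move=> [A [b [A0 b0 fb]]]; exists A, b; split => // x.
apply: le_trans (fb _) _; rewrite norm1_cons ler_wpM2l // ler_expR.
by rewrite lerN2 ler_wpM2l ?(ltW b0) // lerDr.
Qed.

Lemma cmeas_section n (f : 'rV[R]_n.+1 -> C) x0 : cmeas f ->
  cmeas (fun x => f (cons_rV (x0, x))).
Proof.
move=> /cmeas_cons mf.
exact: (cmeas_comp mf (pair1_measurable x0)).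
Qed.

Lemma cintegrable_section n (f : 'rV[R]_n.+1 -> C) : cmeas f -> edecay f ->
  cintegrable lebesgue_measure setT (fun x0 : RT =>
     cintegral (lebesgue_rV n) setT (fun x => f (cons_rV (x0, x)))).
Proof.
move=> mf ef; have [m1 _ _ _] := cintegral_lebesgueS mf ef.
have [A [b [A0 b0 fb]]] := ef.
pose K := \int[lebesgue_rV n]_x (expR (- (b * norm1 x))).
apply: (@cintegrable_dom _ _ _ _ _ (fun x0 : RT => A * K * expR (- (b * `|x0|)))) => //; last first.
  exact: (integrableZl measurableT (A * K) (integrable_expR_norm b0)).
move=> x0; have iE := integrable_expR_norm1 n b0.
apply: le_trans (@cn_cintegral _ _ _ _ _ (fun x => A * expR (- (b * `|x0|)) * expR (- (b * norm1 x))) _ _ _) _.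
- exact: cmeas_section.
- move=> x; apply: le_trans (fb _) _.
  by rewrite norm1_cons -mulrA -expRD mulrDr opprD.
- exact: (integrableZl measurableT _ iE).
by rewrite RintegralZl // -/K mulrAC.
Qed.

Lemma cintegral_shift n (f : 'rV[R]_n -> C) (v : 'rV[R]_n) : cmeas f -> edecay f ->
  cintegral (lebesgue_rV n) setT (fun x => f (x + v)) = cintegral (lebesgue_rV n) setT f.
Proof.
elim: n f v => [|n ih] f v mf ef.
  by congr cintegral; apply/funext => x; congr f; exact: etrans (thinmx0 _) (esym (thinmx0 _)).
have mfv : cmeas (fun x : 'rV[R]_n.+1 => f (x + v)) by exact: (cmeas_comp mf (measurable_rVD v)).
have [_ _ -> _] := cintegral_lebesgueS mfv (edecay_shift v ef).
have [m1 _ -> _] := cintegral_lebesgueS mf ef.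
have [v0 [w ->]] := cons_rVP v.
have efv := edecay_shift (cons_rV (v0, 0)) ef.
have mf0 := cmeas_comp mf (measurable_rVD (cons_rV (v0, 0))).
pose G (x0 : R) := cintegral (lebesgue_rV n) setT (fun x => f (cons_rV (x0, x))).
have EG (x0 : RT) : cintegral (lebesgue_rV n) setT (fun x => f (cons_rV (x0, x) + cons_rV (v0, 0))) = G (x0 + v0).
  by rewrite /G; congr cintegral; apply/funext => x; rewrite cons_rVD addr0.
have I : cintegrable lebesgue_measure setT (fun x0 : RT => G (x0 + v0)).
  by have := cintegrable_section mf0 efv; congr cintegrable; apply/funext => x0; exact: EG.
have S := @cintegral_shiftR R G v0 m1 I.
transitivity (cintegral (@lebesgue_measure R) setT (fun x0 : RT => G (x0 + v0))); last exact: S.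
congr cintegral; apply/funext => x0.
under eq_fun do rewrite cons_rVD.
exact: (ih (fun x => f (cons_rV (x0 + v0, x))) w (cmeas_section _ mf) (edecay_section _ ef)).
Qed.

Lemma cintegral_opp n (f : 'rV[R]_n -> C) : cmeas f -> edecay f ->
  cintegral (lebesgue_rV n) setT (fun x => f (- x)) = cintegral (lebesgue_rV n) setT f.
Proof.
elim: n f => [|n ih] f mf ef.
  by congr cintegral; apply/funext => x; congr f; exact: etrans (thinmx0 _) (esym (thinmx0 _)).
have mfv : cmeas (fun x : 'rV[R]_n.+1 => f (- x)) by exact: (cmeas_comp mf (@measurable_rVN n.+1)).
have [_ _ -> _] := cintegral_lebesgueS mfv (edecay_opp ef).
have [m1 _ -> _] := cintegral_lebesgueS mf ef.
have E (x0 : RT) : cintegral (lebesgue_rV n) setT (fun x => f (- cons_rV (x0, x))) =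
   cintegral (lebesgue_rV n) setT (fun x => f (cons_rV (- x0, x))).
  under eq_fun do rewrite cons_rVN.
  exact: (ih (fun x => f (cons_rV (- x0, x))) (cmeas_section _ mf) (edecay_section _ ef)).
have I := cintegrable_section mfv (edecay_opp ef).
pose G (x0 : R) := cintegral (lebesgue_rV n) setT (fun x => f (cons_rV (x0, x))).
have I' : cintegrable lebesgue_measure setT (fun x0 : RT => G (- x0)).
  by move: I; congr cintegrable; apply/funext => x0; exact: E.
transitivity (cintegral (@lebesgue_measure R) setT (fun x0 : RT => G (- x0))).
  by congr cintegral; apply/funext => x0; exact: E.
exact: (@cintegral_oppR R G m1 I').
Qed.

Lemma cintegral_rV0 (f : 'rV[R]_0 -> C) : cmeas f -> cintegral (lebesgue_rV 0) setT f = f 0.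
Proof.
move=> [mr mi]; rewrite /cintegral [RHS]complex_eta /Rintegral /=.
by rewrite !integral_dirac ?diracT ?mul1e //; exact/measurable_EFinP.
Qed.

End euclidean.

(** * Complex derivatives with quadratic remainder *)

Section quadratic_differentiability.
Context {R : realType}.
Local Notation C := R[i].
Local Notation Re := (@complex.Re R).
Local Notation Im := (@complex.Im R).
Implicit Types (z w : C).

(** Complex differentiability with a quadratic remainder. It is what dominated
    differentiation under the integral sign yields, and it is stable under
    products and composition by elementary estimates. *)
Definition qderiv (f : C -> C) z (f' : C) : Prop := exists K e : R, [/\ 0 <= K, 0 < e &
  forall h, cn h < e -> cn (f (z + h) - f z - h * f') <= K * cn h ^+ 2].

Lemma qderiv_cst c z : qderiv (fun=> c) z 0.
Proof.
exists 0, 1; split => // h _.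
by rewrite subrr sub0r mulr0 oppr0 cn0 mul0r.
Qed.

Lemma qderiv_id z : qderiv id z 1.
Proof.
exists 0, 1; split => // h _.
by rewrite mulr1 [z + h]addrC addrK subrr cn0 mul0r.
Qed.

Lemma qderivD f g z f' g' : qderiv f z f' -> qderiv g z g' ->
  qderiv (fun x => f x + g x) z (f' + g').
Proof.
move=> [K [e [K0 e0 H]]] [L [e1 [L0 e10 H1]]].
exists (K + L), (Num.min e e1); split; [exact: addr_ge0|by rewrite lt_min e0|].
move=> h; rewrite lt_min => /andP[he he1].
rewrite (_ : _ - _ = (f (z + h) - f z - h * f') + (g (z + h) - g z - h * g')); last by ring.
by apply: le_trans (cnD _ _) _; rewrite mulrDl lerD ?H ?H1.
Qed.

Lemma qderiv_bound f z f' : qderiv f z f' -> exists K e : R, [/\ 0 <= K, 0 < e &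
  forall h, cn h < e -> cn (f (z + h) - f z) <= K * cn h].
Proof.
move=> [K [e [K0 e0 H]]].
exists (K * e + cn f'), e; split => //.
  by rewrite addr_ge0 ?cn_ge0 ?mulr_ge0 ?(ltW e0).
move=> h he.
rewrite (_ : f (z + h) - f z = (f (z + h) - f z - h * f') + h * f'); last by ring.
apply: le_trans (cnD _ _) _; rewrite mulrDl cnM [cn h * _]mulrC lerD2r.
apply: le_trans (H h he) _; rewrite expr2 mulrA ler_wpM2r ?cn_ge0 //.
by rewrite ler_wpM2l // ltW.
Qed.

Lemma qderivM f g z f' g' : qderiv f z f' -> qderiv g z g' ->
  qderiv (fun x => f x * g x) z (f' * g z + f z * g').
Proof.
move=> df dg; have [K2 [e2 [K20 e20 H2]]] := qderiv_bound df.
have [K3 [e3 [K30 e30 H3]]] := qderiv_bound dg.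
case: df => [K [e [K0 e0 H]]]; case: dg => [L [e1 [L0 e10 H1]]].
exists (K2 * K3 + K * cn (g z) + cn (f z) * L), (Num.min (Num.min e e1) (Num.min e2 e3)); split.
- by rewrite !addr_ge0 ?mulr_ge0 ?cn_ge0.
- by rewrite !lt_min e0 e10 e20 e30.
move=> h; rewrite !lt_min => /andP[/andP[he he1] /andP[he2 he3]].
rewrite (_ : _ - _ = (f (z + h) - f z) * (g (z + h) - g z)
   + (f (z + h) - f z - h * f') * g z + f z * (g (z + h) - g z - h * g')); last by ring.
apply: le_trans (cnD _ _) _; rewrite [leRHS]mulrDl; apply: lerD; last first.
  by rewrite cnM -mulrA ler_wpM2l ?cn_ge0 ?H1.
apply: le_trans (cnD _ _) _; rewrite [leRHS]mulrDl; apply: lerD.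
  rewrite cnM expr2 mulrACA; apply: ler_pM; rewrite ?cn_ge0 ?H2 ?H3 //.
by rewrite cnM mulrAC ler_wpM2r ?cn_ge0 ?H.
Qed.

Lemma qderivZ c f z f' : qderiv f z f' -> qderiv (fun x => c * f x) z (c * f').
Proof.
by move=> h; have := qderivM (qderiv_cst c z) h; rewrite mul0r add0r.
Qed.

Lemma qderiv_comp f g z f' g' : qderiv f z f' -> qderiv g (f z) g' ->
  qderiv (fun x => g (f x)) z (g' * f').
Proof.
move=> df; have [K2 [e2 [K20 e20 H2]]] := qderiv_bound df.
case: df => [K [e [K0 e0 H]]]; move=> [L [e1 [L0 e10 H1]]].
pose e3 := e1 / (K2 + 1).
have e30 : 0 < e3 by rewrite divr_gt0 // ltr_wpDl.
exists (L * K2 ^+ 2 + cn g' * K), (Num.min e (Num.min e2 e3)); split.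
- by rewrite addr_ge0 ?mulr_ge0 ?cn_ge0 ?exprn_ge0.
- by rewrite !lt_min e0 e20 e30.
move=> h; rewrite !lt_min => /and3P[he he2 he3].
pose k := f (z + h) - f z.
have hk : cn k <= K2 * cn h by exact: H2.
have k1 : cn k < e1.
  apply: le_lt_trans hk _; apply: (@le_lt_trans _ _ ((K2 + 1) * cn h)).
    by rewrite ler_wpM2r ?cn_ge0 // lerDl.
  by rewrite mulrC -ltr_pdivlMr // ltr_wpDl.
rewrite (_ : _ - _ = (g (f z + k) - g (f z) - k * g') + g' * (k - h * f')); last first.
  by rewrite /k addrCA subrr addr0; ring.
apply: le_trans (cnD _ _) _; rewrite [leRHS]mulrDl; apply: lerD.
  apply: le_trans (H1 _ k1) _; rewrite -mulrA -exprMn ler_wpM2l //.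
  by rewrite lerXn2r ?nnegrE ?mulr_ge0 ?cn_ge0.
by rewrite cnM -mulrA ler_wpM2l ?cn_ge0 ?H.
Qed.

Lemma qderivV z : z != 0 -> qderiv (fun x => x^-1) z (- z^-2).
Proof.
move=> z0; have c0 : 0 < cn z by rewrite lt_neqAle cn_ge0 andbT eq_sym cn_eq0.
exists (2 / cn z ^+ 3), (cn z / 2); split.
- by rewrite divr_ge0 ?exprn_ge0 ?cn_ge0.
- by rewrite divr_gt0.
move=> h he.
have zh : cn z / 2 <= cn (z + h).
  have := cnB (z + h) h; rewrite addrK; lra.
have zh0 : z + h != 0 by rewrite -cn_eq0 gt_eqF // (lt_le_trans _ zh) // divr_gt0.
rewrite (_ : _ - _ = h ^+ 2 * (z ^- 2 * (z + h)^-1)); last by field; rewrite z0 zh0.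
have b0 : 0 < cn (z + h) by rewrite (lt_le_trans _ zh) // divr_gt0.
have b1 : (cn (z + h))^-1 <= 2 / cn z.
  by rewrite -[leLHS]mul1r ler_pdivrMr // mulrAC ler_pdivlMr // mul1r; lra.
rewrite [cn (h ^+ 2 * _)]cnM [cn (_ / _)]cnM !cnV !cnX mulrC; apply: ler_wpM2r; first by rewrite exprn_ge0 ?cn_ge0.
rewrite (_ : 2 / cn z ^+ 3 = cn z ^- 2 * (2 / cn z)); last first.
  by field; rewrite gt_eqF.
by apply: ler_wpM2l b1; rewrite invr_ge0 exprn_ge0 ?cn_ge0.
Qed.

Lemma cexp_taylor2 z : cn (cexp z - 1 - z) <= cn z ^+ 2 * expR (cn z).
Proof.
have := cexp_taylor 2 z.
rewrite big_ord_recl big_ord1 /= expr0 fact0 divr1 expr1 divr1 opprD addrA.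
move/le_trans; apply; rewrite -mulrA ler_wpM2l ?exprn_ge0 ?cn_ge0 //.
rewrite mulrC ler_pdivrMr ?ltr0n //; apply: le_trans (_ : expR (cn z) * 1 <= _).
  rewrite mulr1 ge_max; apply/andP; split.
    by rewrite -expR0 ler_expR cn_ge0.
  by rewrite ler_expR; apply: le_trans (ler_norm _) (Re_le_cn _).
by rewrite ler_wpM2l ?expR_ge0 // ler1n.
Qed.

Lemma qderiv_cexp z : qderiv (@cexp R) z (cexp z).
Proof.
exists (cn (cexp z) * expR 1), 1; split => //.
  by rewrite mulr_ge0 ?cn_ge0 ?expR_ge0.
move=> h h1; rewrite cexpD.
rewrite (_ : _ - _ = cexp z * (cexp h - 1 - h)); last by ring.
rewrite cnM -mulrA ler_wpM2l ?cn_ge0 //; apply: le_trans (cexp_taylor2 h) _.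
by rewrite mulrC ler_wpM2r ?exprn_ge0 ?cn_ge0 // ler_expR ltW.
Qed.

(** A quadratic remainder is stronger than differentiability; all derivatives in
    time are obtained this way. *)
Lemma quad_is_derive (f : R -> R) (s f' K e : R) : 0 < e ->
  (forall h, `|h| < e -> `|f (s + h) - f s - h * f'| <= K * h ^+ 2) ->
  is_derive s (1 : R) f f'.
Proof.
move=> e0 H.
have cv : h^-1 *: ((f \o shift s) (h *: (1 : R)) - f s) @[h --> 0^'] --> f'.
  apply/cvgrPdist_le => eps eps0; near=> h.
  have h0 : h != 0 by near: h; exact: nbhs_dnbhs_neq.
  have he : `|h| < e.
    by near: h; apply: dnbhs0_lt.
  have hK : `|h| < eps / (`|K| + 1).
    by near: h; apply: dnbhs0_lt; rewrite divr_gt0 // ltr_wpDl.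
  rewrite /shift /= scaler1 [h + s]addrC.
  rewrite distrC (_ : _ - f' = h^-1 * (f (s + h) - f s - h * f')); last first.
    by rewrite /GRing.scale /= !mulrBr [h^-1 * (h * _)]mulrA mulVf // mul1r.
  rewrite normrM normfV mulrC ler_pdivrMr ?normr_gt0 //.
  apply: le_trans (H _ he) _.
  apply: (@le_trans _ _ ((`|K| + 1) * (`|h| * `|h|))).
    rewrite -normrM -expr2 ger0_norm ?sqr_ge0 // ler_wpM2r ?sqr_ge0 //.
    by apply: le_trans (ler_norm _) _; rewrite lerDl.
  rewrite mulrA ler_wpM2r //.
  by rewrite mulrC -ler_pdivlMr ?ltW // ltr_wpDl.
apply: DeriveDef; first by apply/cvg_ex; exists f'.
by apply/cvg_lim => //.
Unshelve. all: by end_near. Qed.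

(** Restriction of a complex derivative to a real line, which gives access to the
    mean value inequality. *)
Lemma qderiv_line f z v s f' : qderiv f (z + s%:C * v) f' ->
  cderiv (fun r : R => f (z + r%:C * v)) s (v * f').
Proof.
move=> [K [e [K0 e0 H]]].
pose e' := e / (cn v + 1).
have v1 : 0 < cn v + 1 by rewrite ltr_wpDl ?cn_ge0.
have e'0 : 0 < e' by rewrite divr_gt0.
have B (h : R) : `|h| < e' ->
   cn (f (z + (s + h)%:C * v) - f (z + s%:C * v) - h%:C * (v * f')) <= K * cn v ^+ 2 * h ^+ 2.
  move=> he.
  have hv : cn (h%:C * v) < e.
    rewrite cnM cn_real; apply: (@le_lt_trans _ _ (`|h| * (cn v + 1))).
      by rewrite ler_wpM2l // lerDl.
    by rewrite -ltr_pdivlMr.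
  have := H _ hv; rewrite rcD mulrDl addrA -mulrA => /le_trans; apply.
  by rewrite cnM cn_real exprMn -normrX ger0_norm ?sqr_ge0 // [h ^+ 2 * _]mulrC mulrA.
split; apply: (quad_is_derive e'0) => h he /=; apply: le_trans (B h he).
  apply: le_trans (Re_le_cn _); rewrite !Re_add !Re_opp Re_scale.
  exact: lexx.
by apply: le_trans (Im_le_cn _); rewrite !Im_add !Im_opp Im_scale.
Qed.

Lemma cderiv_uniq (f : R -> C) (s : R) a b : cderiv f s a -> cderiv f s b -> a = b.
Proof.
move=> [[_ h1] [_ h2]] [[_ h3] [_ h4]].
by rewrite [a]complex_eta [b]complex_eta -h1 -h2 -h3 -h4.
Qed.

Lemma qderiv_uniq f z a b : qderiv f z a -> qderiv f z b -> a = b.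
Proof.
have E : z = z + (0 : R)%:C * 1 by rewrite mul0r addr0.
rewrite {1 2}E => /qderiv_line h1 /qderiv_line h2.
by have := cderiv_uniq h1 h2; rewrite !mul1r.
Qed.

(** Mean value inequality along the segment from [z] to [w]. *)
Lemma qderiv0_cst f z w :
  (forall s : R, 0 <= s <= 1 -> qderiv f (z + s%:C * (w - z)) 0) -> f z = f w.
Proof.
move=> H; apply/esym/eqP; rewrite -subr_eq0 -cn_eq0 eq_le cn_ge0 andbT.
have := @cderiv_bound R (fun r => f (z + r%:C * (w - z))) (fun=> 0) (fun=> 0) (fun=> 0).
rewrite subrr [0%:C]/(0 : C) [1%:C]/(1 : C) mul1r mul0r addr0 [z + _]addrC subrK.
apply.
- by move=> s s01; rewrite -(mulr0 (w - z)); apply: qderiv_line; exact: H.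
- by move=> s _; rewrite cn0.
Qed.

(** Differentiation under the integral sign: a quadratic remainder bounded by
    [cn h ^+ 2 * G] is integrated as it is, without any limit of integrals. *)
Lemma qderiv_integral d (T : measurableType d) (mu : {measure set T -> \bar R})
    (p : C -> T -> C) (q : T -> C) (G : T -> R) z (e : R) : 0 < e ->
  (forall h, cn h < e -> cintegrable mu setT (p (z + h))) ->
  cintegrable mu setT q -> mu.-integrable setT (EFin \o G) ->
  (forall h x, cn h < e -> cn (p (z + h) x - p z x - h * q x) <= cn h ^+ 2 * G x) ->
  qderiv (fun w => cintegral mu setT (p w)) z (cintegral mu setT q).
Proof.
move=> e0 ip iq iG H.
have ip0 : cintegrable mu setT (p z).
  by have := ip 0; rewrite addr0 cn0; apply.
exists `|\int[mu]_x G x|, e; split => // h he.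
have i1 : cintegrable mu setT (fun x => p (z + h) x - p z x).
  by apply: cintegrableB => //; exact: ip.
have i2 := cintegrableZ h iq.
rewrite -cintegralZ // -cintegralB //; last exact: ip.
rewrite -cintegralB //.
apply: le_trans (_ : \int[mu]_x (cn h ^+ 2 * G x) <= _).
  apply: cn_cintegral; last exact: integrableZR.
    by apply: (@cintegrable_meas _ _ _ mu); exact: cintegrableB.
  by move=> x; exact: H.
rewrite RintegralZl // mulrC ler_wpM2r ?exprn_ge0 ?cn_ge0 //.
exact: ler_norm.
Qed.

End quadratic_differentiability.

(** * Gaussian integrals on the line *)

Section gaussian_line.
Context {R : realType}.
Local Notation C := R[i].
Local Notation Re := (@complex.Re R).
Local Notation Im := (@complex.Im R).
Local Notation mu := (@lebesgue_measure R).
Local Notation RT := (measurableTypeR R).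
Implicit Types (zeta w : C).

(** [x ^+ n / n`!] is one of the nonnegative terms of the exponential series. *)
Lemma expn_le_expR n (x : R) : 0 <= x -> x ^+ n <= n`!%:R * expR x.
Proof.
move=> x0; case: n => [|n].
  by rewrite expr0 mul1r -expR0 ler_expR.
have f0 : 0 < n.+1`!%:R :> R by rewrite ltr0n fact_gt0.
rewrite mulrC -ler_pdivrMr //.
by apply: le_trans (expR_ge1Dxn n x0); rewrite lerDr.
Qed.

Definition gz zeta w (x : R) : C := cexp (- zeta * (x ^+ 2)%:C + w * x%:C).

Lemma cn_gz zeta w x : cn (gz zeta w x) = expR (- (Re zeta * x ^+ 2) + Re w * x).
Proof.
by rewrite cn_cexp Re_add !Re_mul /= !mulr0 !subr0 Re_opp mulNr.
Qed.

Lemma cmeas_gz zeta w : cmeas (gz zeta w : RT -> C).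
Proof.
apply: cmeas_cexp; apply: cmeasD; apply: cmeasZ; apply: cmeas_real => //.
Qed.

(** The quadratic term of the exponent absorbs every power and every exponential of
    the absolute value of [x], so that a single exponential dominates the integrand. *)
Lemma gz_dom k zeta w (b : R) : 0 < Re zeta -> exists A : R, 0 <= A /\
  forall x : R, `|x| ^+ k * expR (b * `|x|) * cn (gz zeta w x) <= A * expR (- (1 * `|x|)).
Proof.
move=> z0; pose B := b + 2 + `|Re w|.
exists (k`!%:R * expR (B ^+ 2 / (4 * Re zeta))); split.
  by rewrite mulr_ge0 ?expR_ge0.
move=> x; rewrite cn_gz -mulrA -expRD.
apply: (@le_trans _ _ (k`!%:R * (expR `|x| * expR (b * `|x| + (- (Re zeta * x ^+ 2) + Re w * x))))).
  by rewrite mulrA ler_wpM2r ?expR_ge0 // expn_le_expR.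
rewrite -mulrA -!expRD ler_wpM2l // ler_expR.
have -> : x ^+ 2 = `|x| ^+ 2 by rewrite -normrX ger0_norm ?sqr_ge0.
have h1 : Re w * x <= `|Re w| * `|x| by rewrite -normrM ler_norm.
suff : B * `|x| - Re zeta * `|x| ^+ 2 <= B ^+ 2 / (4 * Re zeta) by rewrite /B; lra.
have z4 : 0 < 4 * Re zeta by rewrite mulr_gt0.
rewrite ler_pdivlMr //.
have := sqr_ge0 (2 * Re zeta * `|x| - B); nra.
Qed.

Definition gz_int k zeta w : C := cintegral mu setT (fun x : RT => (x ^+ k)%:C * gz zeta w x).

Lemma cmeas_gzk k zeta w : cmeas (fun x : RT => (x ^+ k)%:C * gz zeta w x).
Proof.
apply: cmeasM; last exact: cmeas_gz.
by apply: cmeas_real; exact: measurable_funX.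
Qed.

Lemma integrable_gz_dom k zeta w (b : R) : 0 < Re zeta ->
  mu.-integrable setT (EFin \o (fun x : RT => `|x| ^+ k * expR (b * `|x|) * cn (gz zeta w x))).
Proof.
move=> z0; have [A [A0 H]] := gz_dom k w b z0.
apply: (@integrable_dom _ _ _ mu _ (fun x : RT => A * expR (- (1 * `|x : R|)))).
- apply: measurable_funM; last exact: (measurable_cn (cmeas_gz zeta w)).
  have mn : measurable_fun setT (fun x : RT => `|x : R|) by exact: measurableT_comp.
  apply: measurable_funM; first exact: (measurable_funX k mn).
  by apply: measurableT_comp => //; exact: measurable_funM.
- move=> x; rewrite ger0_norm //.
  by rewrite !mulr_ge0 ?expR_ge0 ?cn_ge0 ?exprn_ge0.
- exact/integrableZR/integrable_expR_norm.
Qed.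

Lemma cintegrable_gz k zeta w : 0 < Re zeta ->
  cintegrable mu setT (fun x : RT => (x ^+ k)%:C * gz zeta w x).
Proof.
move=> z0; apply: cintegrable_dom (integrable_gz_dom k w 0 z0); first exact: cmeas_gzk.
by move=> x; rewrite cnM cn_real normrX mul0r expR0 mulr1.
Qed.

Lemma qderiv_gz k zeta w : 0 < Re zeta ->
  qderiv (gz_int k zeta) w (gz_int k.+1 zeta w).
Proof.
move=> z0; apply: (@qderiv_integral _ _ _ mu
    (fun v (x : RT) => (x ^+ k)%:C * gz zeta v x)
    (fun x : RT => (x ^+ k.+1)%:C * gz zeta w x)
    (fun x : RT => `|x| ^+ k.+2 * expR (1 * `|x|) * cn (gz zeta w x)) _ 1) => //.
- by move=> h _; exact: cintegrable_gz.
- exact: cintegrable_gz.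
- exact: integrable_gz_dom.
move=> h x h1.
have -> : gz zeta (w + h) x = gz zeta w x * cexp (h * x%:C).
  by rewrite /gz -cexpD; congr cexp; ring.
rewrite (_ : _ - _ = (x ^+ k)%:C * gz zeta w x * (cexp (h * x%:C) - 1 - h * x%:C)); last first.
  by rewrite exprS rcM; ring.
rewrite !cnM cn_real; apply: le_trans (ler_wpM2l _ (cexp_taylor2 _)) _.
  by rewrite mulr_ge0 ?cn_ge0.
rewrite cnM cn_real normrX -[k.+2]/(2 + k)%N exprD exprMn mul1r.
have H : expR (cn h * `|x|) <= expR `|x| by rewrite ler_expR ler_piMl // ltW.
have := ler_wpM2l (_ : 0 <= `|x| ^+ k * cn (gz zeta w x) * (cn h ^+ 2 * `|x| ^+ 2)) H.
rewrite !mulr_ge0 ?cn_ge0 ?exprn_ge0 ?cn_ge0 // => /(_ isT).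
rewrite [_ ^+ k * _ * (_ * expR _)]mulrA => /le_trans; apply.
by rewrite le_eqVlt; apply/orP; left; apply/eqP; ring.
Qed.

Lemma gz_shift zeta w (h x : R) :
  gz zeta w (x + h) = cexp (- zeta * (h ^+ 2)%:C + w * h%:C) * gz zeta (w - 2 * zeta * h%:C) x.
Proof.
rewrite /gz -cexpD; congr cexp.
by rewrite !rcX rcD; move: (x%:C) (h%:C) => X H; ring.
Qed.

(** Translating the variable by [h] multiplies [gz] by a constant and changes its
    linear term; Lebesgue measure is invariant. *)
Lemma gz_int_shift zeta w (h : R) : 0 < Re zeta ->
  cexp (- zeta * (h ^+ 2)%:C + w * h%:C) * gz_int 0 zeta (w - 2 * zeta * h%:C) = gz_int 0 zeta w.
Proof.
move=> z0.
have E (x : RT) : ((x + h) ^+ 0)%:C * gz zeta w (x + h) =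
   cexp (- zeta * (h ^+ 2)%:C + w * h%:C) * ((x ^+ 0)%:C * gz zeta (w - 2 * zeta * h%:C) x).
  by rewrite !expr0 mulrCA gz_shift.
have I := cintegrable_gz 0 (w - 2 * zeta * h%:C) z0.
have I' : cintegrable mu setT (fun x : RT => ((x + h) ^+ 0)%:C * gz zeta w (x + h)).
  have := cintegrableZ (cexp (- zeta * (h ^+ 2)%:C + w * h%:C)) I.
  by congr cintegrable; apply/funext => x; rewrite E.
rewrite /gz_int -cintegralZ //.
transitivity (cintegral mu setT (fun x : RT => ((x + h) ^+ 0)%:C * gz zeta w (x + h))).
  by congr cintegral; apply/funext => x; rewrite E.
exact: (@cintegral_shiftR R (fun x : R => (x ^+ 0)%:C * gz zeta w x) h (cmeas_gzk 0 zeta w) I').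
Qed.

(** The derivative at [h = 0] of the identity [gz_int_shift], which replaces an
    integration by parts. *)
Lemma gz_int1 zeta w : 0 < Re zeta -> 2 * zeta * gz_int 1 zeta w = w * gz_int 0 zeta w.
Proof.
move=> z0.
pose F (h : C) := cexp (- zeta * h ^+ 2 + w * h) * gz_int 0 zeta (w - 2 * zeta * h).
have d1 : qderiv (fun h => - zeta * h ^+ 2 + w * h) 0 w.
  have := qderivD (qderivZ (- zeta) (qderivM (qderiv_id 0) (qderiv_id 0))) (qderivZ w (qderiv_id 0)).
  by rewrite mulr0 mul0r addr0 mulr0 add0r mulr1.
have d2 : qderiv (fun h => w - 2 * zeta * h) 0 (- (2 * zeta)).
  have := qderivD (qderiv_cst w 0) (qderivZ (- (2 * zeta)) (qderiv_id 0)).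
  rewrite add0r mulr1; congr qderiv; apply/funext => h /=; by rewrite mulNr.
have e1 : - zeta * (0 : C) ^+ 2 + w * 0 = 0 by rewrite expr0n /= !mulr0 addr0.
have e2 : w - 2 * zeta * 0 = w by rewrite mulr0 subr0.
have dF : qderiv F 0 (w * gz_int 0 zeta w - 2 * zeta * gz_int 1 zeta w).
  have c1 : qderiv (fun h => cexp (- zeta * h ^+ 2 + w * h)) 0 w.
    have := qderiv_comp d1 (qderiv_cexp _); rewrite e1 cexp0 mul1r; exact.
  have c2 : qderiv (fun h => gz_int 0 zeta (w - 2 * zeta * h)) 0 (gz_int 1 zeta w * (- (2 * zeta))).
    by apply: qderiv_comp d2 _; rewrite e2; exact: qderiv_gz.
  have := qderivM c1 c2; rewrite e1 e2 cexp0 mul1r; congr qderiv; ring.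
have dF' : qderiv F (0 + (0 : R)%:C * 1) (w * gz_int 0 zeta w - 2 * zeta * gz_int 1 zeta w).
  by rewrite mulr1 addr0.
have FE : (fun r : R => F (0 + r%:C * 1)) = fun=> gz_int 0 zeta w.
  by apply/funext => r; rewrite add0r mulr1 /F -rcX gz_int_shift.
have := qderiv_line dF'; rewrite FE => /cderiv_uniq /(_ (cderiv_cst _ _)).
by rewrite mul1r => /eqP; rewrite subr_eq0 eq_sym => /eqP.
Qed.

(** By [gz_int1] the integral solves the differential equation
    [F' = w / (2 * zeta) * F] in the parameter [w]. *)
Lemma gz_intE zeta w : 0 < Re zeta ->
  gz_int 0 zeta w = gz_int 0 zeta 0 * cexp (w ^+ 2 / (4 * zeta)).
Proof.
move=> z0; have zn : zeta != 0 by apply: contraTneq z0 => ->; rewrite ltxx.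
pose F v := gz_int 0 zeta v * cexp (- v ^+ 2 / (4 * zeta)).
have dF v : qderiv F v 0.
  have d1 : qderiv (fun v => - v ^+ 2 / (4 * zeta)) v (- v / (2 * zeta)).
    have := qderivZ (- (4 * zeta)^-1) (qderivM (qderiv_id v) (qderiv_id v)).
    rewrite (_ : - _ * _ = - v / (2 * zeta)); last by field.
    by congr qderiv; apply/funext => u /=; rewrite mulrC expr2 mulrN mulNr.
  have := qderivM (qderiv_gz 0 v z0) (qderiv_comp d1 (qderiv_cexp _)).
  rewrite (_ : _ + _ = cexp (- v ^+ 2 / (4 * zeta)) / (2 * zeta) * (2 * zeta * gz_int 1 zeta v - v * gz_int 0 zeta v)).
    by rewrite gz_int1 // subrr mulr0.
  by field.
have : F w = F 0 by apply: qderiv0_cst => s _; exact: dF.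
rewrite /F expr0n /= oppr0 mul0r cexp0 mulr1 => <-.
rewrite -mulrA -cexpD mulNr addNr cexp0 mulr1 //.
Qed.

(** The derivative at [w = 0] of the identity [gz_int1]. *)
Lemma gz_int2 zeta : 0 < Re zeta -> 2 * zeta * gz_int 2 zeta 0 = gz_int 0 zeta 0.
Proof.
move=> z0.
have d1 := qderivZ (2 * zeta) (qderiv_gz 1 0 z0).
have d2 := qderivM (qderiv_id 0) (qderiv_gz 0 0 z0).
have E : (fun x => 2 * zeta * gz_int 1 zeta x) = (fun x => id x * gz_int 0 zeta x).
  by apply/funext => x /=; rewrite gz_int1.
by move: d1; rewrite E => /qderiv_uniq /(_ d2); rewrite mul1r mul0r addr0.
Qed.

Lemma gz_taylor zeta (h : C) (e x : R) : cn h < e ->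
  cn ((x ^+ 0)%:C * gz (zeta + h) 0 x - (x ^+ 0)%:C * gz zeta 0 x
     - h * (-1 * ((x ^+ 2)%:C * gz zeta 0 x)))
  <= cn h ^+ 2 * (`|x| ^+ 4 * expR (0 * `|x|) * cn (gz (zeta - e%:C) 0 x)).
Proof.
move=> he.
have -> : gz (zeta + h) 0 x = gz zeta 0 x * cexp (- h * (x ^+ 2)%:C).
  by rewrite /gz -cexpD; congr cexp; ring.
rewrite (_ : _ - _ = gz zeta 0 x * (cexp (- h * (x ^+ 2)%:C) - 1 - (- h * (x ^+ 2)%:C))); last first.
  by rewrite expr0 [1%:C]/(1 : C); ring.
rewrite cnM; apply: le_trans (ler_wpM2l (cn_ge0 _) (cexp_taylor2 _)) _.
rewrite cnM cnN cn_real ger0_norm ?sqr_ge0 // exprMn -exprM !cn_gz /=.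
rewrite !mul0r expR0 mulr1 !addr0 -normrX ger0_norm ?exprn_even_ge0 //.
rewrite -mulrA mulrCA; apply: ler_wpM2l; first by rewrite exprn_ge0 ?cn_ge0.
rewrite mulrCA; apply: ler_wpM2l; first by rewrite exprn_even_ge0.
rewrite -expRD ler_expR Re_add Re_opp /=; have := sqr_ge0 x; nra.
Qed.

Lemma Re_inv4 zeta : 0 < Re zeta -> 0 < Re (4 * zeta)^-1.
Proof.
move=> z0; have -> : (4 * zeta)^-1 = (4^-1 : R)%:C * zeta^-1.
  by rewrite invfM rcV rc_nat.
rewrite Re_scale pmulr_rgt0 //.
by case: zeta z0 => a b /= a0; rewrite divr_gt0 // ltr_wpDr ?sqr_ge0 // exprn_gt0.
Qed.

(** The total mass of the standard normal density. *)
Lemma gz_int_half : gz_int 0 (1 / 2) 0 = (Num.sqrt (2 * pi))%:C.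
Proof.
have s1 : (1 : R) != 0 by [].
pose c := Num.sqrt (2 * pi) : R.
have c0 : 0 < c by rewrite sqrtr_gt0 mulr_gt0 ?pi_gt0.
have E (x : R) : (x ^+ 0)%:C * gz (1 / 2) 0 x = (c * normal_pdf 0 1 x)%:C.
  rewrite expr0 mul1r normal_pdfE // /normal_peak /normal_fun subr0 expr1n mul1r.
  rewrite -[pi *+ 2]mulr_natl mulrA divff ?gt_eqF // mul1r.
  rewrite !mul1r -cexp_real /gz mul0r addr0; congr cexp.
  by rewrite !rcM rcV rcN rc_nat mulNr [X in - X]mulrC rcX expr2 mulNr.
rewrite /gz_int; under eq_fun do rewrite E.
rewrite cintegral_real; congr (_%:C).
rewrite RintegralZl //; last exact: integrable_normal_pdf.
by rewrite /Rintegral integral_normal_pdf /= mulr1.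
Qed.

Lemma qderiv_gz_zeta zeta : 0 < Re zeta ->
  qderiv (fun z => gz_int 0 z 0) zeta (- gz_int 2 zeta 0).
Proof.
move=> z0; pose e := Re zeta / 2.
have e0 : 0 < e by rewrite divr_gt0.
have ze : 0 < Re (zeta - e%:C) by rewrite Re_add Re_opp /= /e; lra.
have -> : - gz_int 2 zeta 0 = cintegral mu setT (fun x : RT => -1 * ((x ^+ 2)%:C * gz zeta 0 x)).
  by rewrite cintegralZ ?mulN1r //; exact: cintegrable_gz.
apply: (@qderiv_integral _ _ _ mu (fun z (x : RT) => (x ^+ 0)%:C * gz z 0 x) _
    (fun x : RT => `|x| ^+ 4 * expR (0 * `|x|) * cn (gz (zeta - e%:C) 0 x)) _ e) => //.
- move=> h he; apply: cintegrable_gz; rewrite Re_add.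
  by have := le_lt_trans (Re_le_cn h) he; rewrite ltr_norml /e => /andP[]; lra.
- exact/cintegrableZ/cintegrable_gz.
- exact: integrable_gz_dom.
move=> h x he; exact: gz_taylor.
Qed.

(** The constants of a Gaussian and of its Fourier transform. Choosing the square
    root of [pi / zeta] is avoided: by [gz_int2] the product does not depend on
    [zeta] in the half-plane, and at [zeta = 1 / 2] both factors are
    [sqrt (2 * pi)]. *)
Lemma gz_const_product zeta : 0 < Re zeta ->
  gz_int 0 zeta 0 * gz_int 0 (4 * zeta)^-1 0 = (2 * pi)%:C.
Proof.
move=> z0.
pose P z := gz_int 0 z 0 * gz_int 0 (4 * z)^-1 0.
have dP z : 0 < Re z -> qderiv P z 0.
  move=> p0; have zn : z != 0 by apply: contraTneq p0 => ->; rewrite ltxx.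
  have p4 : 0 < Re (4 * z)^-1 by exact: Re_inv4.
  have d1 := qderiv_gz_zeta p0.
  have d2 : qderiv (fun x => (4 * x)^-1) z (- (4 * z ^+ 2)^-1).
    have z4 : 4 * z != 0 by rewrite mulf_neq0.
    have := qderiv_comp (qderivZ 4 (qderiv_id z)) (qderivV z4).
    by congr qderiv; field.
  have := qderivM d1 (qderiv_comp d2 (qderiv_gz_zeta p4)).
  congr qderiv.
  have := gz_int2 p0; have := gz_int2 p4.
  set a := gz_int 2 _ _; set b := gz_int 0 _ _; set a' := gz_int 2 _ _; set b' := gz_int 0 _ _.
  by move=> <- <-; field.
have := @qderiv0_cst _ P zeta (1 / 2).
rewrite /P => ->.
  have h12 : 0 < Re (1 / 2) :> R.
    by rewrite (_ : 1 / 2 = (1 / 2 : R)%:C) /= ?divr_gt0 // rcM rcV rc_nat.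
  rewrite (_ : (4 * (1 / 2))^-1 = 1 / 2); last by field.
  have -> : gz_int 0 (1 / 2) 0 = (Num.sqrt (2 * pi))%:C by exact: gz_int_half.
  by rewrite -rcM -expr2 sqr_sqrtr // mulr_ge0 ?pi_ge0.
move=> s /andP[s0 s1]; apply: dP.
rewrite (_ : 1 / 2 = (1 / 2 : R)%:C); last by rewrite rcM rcV rc_nat.
rewrite Re_add Re_scale Re_add Re_opp /=; nra.
Qed.

End gaussian_line.

(** * Completing the square *)

Section quadratic_forms.
Context {R : realType}.
Local Notation C := R[i].

Lemma quad_formE n (D : 'M[R]_n) x : dot x (x *m D^T) = quad_form D x.
Proof.
rewrite /dot /quad_form; apply: eq_bigr => k _; rewrite mxE mulr_sumr.
by apply: eq_bigr => j _; rewrite mxE; ring.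
Qed.

Definition head n (x : 'rV[R]_n.+1) : R := x ord0 ord0.
Definition tail n (x : 'rV[R]_n.+1) : 'rV[R]_n := \row_j x ord0 (lift ord0 j).

Lemma head_cons n x0 (x : 'rV[R]_n) : head (cons_rV (x0, x)) = x0.
Proof. by rewrite /head mxE unlift_none. Qed.

Lemma tail_cons n x0 (x : 'rV[R]_n) : tail (cons_rV (x0, x)) = x.
Proof. by apply/rowP => k; rewrite !mxE liftK. Qed.

Lemma cons_head_tail n (x : 'rV[R]_n.+1) : cons_rV (head x, tail x) = x.
Proof.
by have [x0 [x' ->]] := cons_rVP x; rewrite head_cons tail_cons.
Qed.

Lemma measurable_head n : measurable_fun setT (@head n : _ -> measurableTypeR R).
Proof. exact: measurable_coord. Qed.

Lemma quad_form_cons n (S : 'M[R]_n.+1) (S1 : 'M[R]_n) (s : 'rV[R]_n) x0 x :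
  S^T = S -> (forall i j, S1 i j = S (lift ord0 i) (lift ord0 j)) ->
  (forall j, s ord0 j = S ord0 (lift ord0 j)) ->
  quad_form S (cons_rV (x0, x)) = S ord0 ord0 * x0 ^+ 2 + 2 * x0 * dot s x + quad_form S1 x.
Proof.
move=> Ssym S1E sE; rewrite /quad_form big_ord_recl big_ord_recl.
rewrite !mxE unlift_none /=.
have E k : cons_rV (x0, x) ord0 (lift ord0 k) = x ord0 k by rewrite mxE liftK.
have -> : \sum_(i < n) S ord0 (lift ord0 i) * x0 * cons_rV (x0, x) ord0 (lift ord0 i) = x0 * dot s x.
  by rewrite /dot mulr_sumr; apply: eq_bigr => k _; rewrite E sE; ring.
have -> : \sum_(i < n) \sum_X2 S (lift ord0 i) X2 * cons_rV (x0, x) ord0 (lift ord0 i) * cons_rV (x0, x) ord0 X2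
    = x0 * dot s x + \sum_(i < n) \sum_(j < n) S1 i j * x ord0 i * x ord0 j.
  rewrite /dot mulr_sumr -big_split /=; apply: eq_bigr => i _.
  rewrite big_ord_recl !E !mxE unlift_none /= -{1}Ssym mxE -sE; congr (_ + _); first by ring.
  by apply: eq_bigr => j _; rewrite E S1E.
ring.
Qed.

(** With [c] the first diagonal entry, [b] is the rest of the first row divided by
    [c] and [S'] is the Schur complement. If [c = 0], semidefiniteness forces the
    first row to vanish. *)
Lemma quad_form_schur n (S : 'M[R]_n.+1) : S^T = S -> (forall x, 0 <= quad_form S x) ->
  exists c (b : 'rV[R]_n) (S' : 'M[R]_n), [/\ 0 <= c, S'^T = S',
    forall x, 0 <= quad_form S' x,
    forall x0 x, quad_form S (cons_rV (x0, x)) = c * (x0 + dot b x) ^+ 2 + quad_form S' x &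
    (forall x, x != 0 -> 0 < quad_form S x) ->
      0 < c /\ forall x, x != 0 -> 0 < quad_form S' x].
Proof.
move=> Ssym Spsd.
pose c := S ord0 ord0; pose s : 'rV[R]_n := \row_j S ord0 (lift ord0 j).
pose S1 : 'M[R]_n := \matrix_(i, j) S (lift ord0 i) (lift ord0 j).
have QE x0 x : quad_form S (cons_rV (x0, x)) = c * x0 ^+ 2 + 2 * x0 * dot s x + quad_form S1 x.
  by apply: quad_form_cons => // [i j|j]; rewrite mxE.
have q0 m (M : 'M[R]_m) : quad_form M 0 = 0.
  by rewrite /quad_form big1 // => i _; rewrite big1 // => j _; rewrite !mxE mulr0.
have dot0 m (v : 'rV[R]_m) : dot v 0 = 0 by rewrite dotC dot0l.
have c0 : 0 <= c.
  have := Spsd (cons_rV (1, 0)); rewrite QE dot0 q0; lra.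
have S1sym : S1^T = S1 by apply/matrixP => i j; rewrite !mxE -{1}Ssym mxE.
have cons0 (x0 : R) (x : 'rV[R]_n) : x != 0 -> cons_rV (x0, x) != 0.
  by apply: contra_neq => /(congr1 (@tail n)); rewrite tail_cons => ->; apply/rowP => k; rewrite !mxE.
have [cp|cn0] := ltP 0 c.
- pose b := c^-1 *: s.
  pose S' := S1 - c *: (b^T *m b).
  have bb x : quad_form (c *: (b^T *m b)) x = c * dot b x ^+ 2.
    rewrite /quad_form /dot expr2 mulr_suml mulr_sumr; apply: eq_bigr => i _.
    rewrite !mulr_sumr; apply: eq_bigr => j _.
    by rewrite !mxE big_ord1 !mxE; ring.
  have S'E x : quad_form S' x = quad_form S1 x - c * dot b x ^+ 2.
    rewrite -bb /quad_form -sumrB; apply: eq_bigr => i _; rewrite -sumrB.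
    apply: eq_bigr => j _; have -> : S' i j = S1 i j - (c *: (b^T *m b)) i j by rewrite !mxE.
    by rewrite !mulrBl.
  have QS' x0 x : quad_form S (cons_rV (x0, x)) = c * (x0 + dot b x) ^+ 2 + quad_form S' x.
    rewrite QE S'E; have -> : dot s x = c * dot b x.
      by rewrite /b dotZl mulrA divff ?mul1r // gt_eqF.
    ring.
  have S'0 x : quad_form S' x = quad_form S (cons_rV (- dot b x, x)).
    by rewrite QS' addNr expr0n mulr0 add0r.
  exists c, b, S'; split => //.
  + rewrite /S' linearB /= S1sym; congr (_ - _).
    by rewrite linearZ /= trmx_mul trmxK.
  + by move=> x; rewrite S'0.
  + by move=> pd; split => // x x0; rewrite S'0; apply: pd; exact: cons0.
- have cE : c = 0 by apply/eqP; rewrite eq_le cn0 c0.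
  have s0 x : dot s x = 0.
    apply/eqP; apply: contraT => nz.
    pose q := quad_form S1 x.
    have q1 := Spsd (cons_rV (- (q + 1) / (2 * dot s x), x)).
    move: q1; rewrite QE cE mul0r add0r -/q.
    rewrite (_ : 2 * _ * _ = - (q + 1)); last by field.
    lra.
  exists 0, 0, S1; split => //.
  + move=> x; have := Spsd (cons_rV (0, x)).
    by rewrite QE s0 !mulr0 expr0n mulr0 !add0r.
  + by move=> x0 x; rewrite QE s0 cE !mul0r mulr0 !add0r.
  + move=> /(_ (cons_rV (1, 0))); rewrite QE dot0 q0 cE !mulr0 mul0r !addr0 ltxx => H.
    have : false; last by [].
    apply: H; apply/eqP => /(congr1 (@head n)); rewrite head_cons /head mxE => /eqP.
    by rewrite oner_eq0.
Qed.

End quadratic_forms.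

(** * Fourier inversion for complex Gaussians *)

Section gaussian_inversion.
Context {R : realType}.
Local Notation C := R[i].
Local Notation Re := (@complex.Re R).
Local Notation RT := (measurableTypeR R).

Lemma cn_cexp_i (r : R) : cn (cexp ('i * r%:C)) = 1.
Proof. by rewrite cn_cexp /= !mul0r mulr0 subr0 expR0. Qed.

Lemma cn_cexp_Ni (r : R) : cn (cexp (- 'i * r%:C)) = 1.
Proof. by rewrite mulNr cexpN cnV cn_cexp_i invr1. Qed.

Lemma edecay_le n (f g : 'rV[R]_n -> C) : edecay f ->
  (forall x, cn (g x) <= cn (f x)) -> edecay g.
Proof.
by move=> [A [b [A0 b0 H]]] gf; exists A, b; split => // x; apply: le_trans (gf x) (H x).
Qed.

Lemma measurable_quad_form n (S : 'M[R]_n) : measurable_fun setT (quad_form S).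
Proof.
apply: measurable_sum => i; apply: measurable_sum => j.
apply: measurable_funM; last exact: measurable_coord.
by apply: measurable_funM => //; exact: measurable_coord.
Qed.

Lemma cmeas_wave n (c : C) (v : 'rV[R]_n) : cmeas (fun x : 'rV[R]_n => cexp (c * (dot v x)%:C)).
Proof.
apply: cmeas_cexp; apply: cmeasZ; apply: cmeas_real; exact: measurable_dot.
Qed.

Lemma gz_decay zeta w (b : R) : 0 < Re zeta -> exists A : R, 0 <= A /\
  forall x : R, cn (gz zeta w x) <= A * expR (- (b * `|x|)).
Proof.
move=> z0; have [A [A0 H]] := gz_dom 0 w (b - 1) z0.
exists A; split => // x; have := H x; rewrite expr0 mul1r => {}H.
have E : 0 < expR ((b - 1) * `|x|) by exact: expR_gt0.
rewrite -(ler_pM2l E); apply: le_trans H _.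
by rewrite mulrCA -expRD ler_wpM2l // ler_expR; lra.
Qed.

Definition gaussian n (zeta : C) (S : 'M[R]_n) (x : 'rV[R]_n) : C :=
  cexp (- zeta * (quad_form S x)%:C).

Lemma cmeas_gaussian n zeta (S : 'M[R]_n) : cmeas (gaussian zeta S).
Proof.
apply: cmeas_cexp; apply: cmeasZ; apply: cmeas_real; exact: measurable_quad_form.
Qed.

Lemma fourierE n (f : 'rV[R]_n -> C) xi : fourier f xi =
  cintegral (lebesgue_rV n) setT (fun x => f x * cexp ('i * (dot xi x)%:C)).
Proof. by []. Qed.

Lemma cintegrable_fourier n (f : 'rV[R]_n -> C) c xi : cmeas f -> edecay f ->
  (forall r : R, cn (cexp (c * r%:C)) = 1) ->
  [/\ cmeas (fun x => f x * cexp (c * (dot xi x)%:C)),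
      edecay (fun x => f x * cexp (c * (dot xi x)%:C)) &
   cintegrable (lebesgue_rV n) setT (fun x => f x * cexp (c * (dot xi x)%:C))].
Proof.
move=> mf ef c1.
have m : cmeas (fun x => f x * cexp (c * (dot xi x)%:C)).
  by apply: cmeasM => //; exact: cmeas_wave.
have e : edecay (fun x => f x * cexp (c * (dot xi x)%:C)).
  by apply: edecay_le ef _ => x; rewrite cnM c1 mulr1.
by split => //; exact: edecay_integrable.
Qed.

(** The shear that diagonalizes the quadratic form acts on the frequencies by the
    transposed inverse. *)
Lemma waveE n (b x xi : 'rV[R]_n) (x0 xi0 : R) :
  cexp ('i * (dot (cons_rV (xi0, xi)) (cons_rV (x0, x)))%:C) =
  cexp ('i * (dot (xi - xi0 *: b) x)%:C) * cexp ('i * xi0%:C * (x0 + dot b x)%:C).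
Proof.
rewrite -cexpD -mulrA -rcM -mulrDr -rcD; congr (cexp ('i * _%:C)).
by rewrite dot_cons dotDl dotNl dotZl; ring.
Qed.

Lemma waveE' n (b x xi : 'rV[R]_n) (x0 xi0 : R) :
  cexp (- 'i * (dot (cons_rV (x0, x)) (cons_rV (xi0, xi)))%:C) =
  cexp (- 'i * (x0 + dot b x)%:C * xi0%:C) * cexp (- 'i * (dot x (xi - xi0 *: b))%:C).
Proof.
rewrite -cexpD -mulrA -rcM -mulrDr -rcD; congr (cexp (- 'i * _%:C)).
by rewrite dot_cons dotDr dotNr dotZr (dotC x b); ring.
Qed.

(** Complex Gaussians satisfy Fourier inversion, by induction on the dimension:
    completing the square in the first coordinate turns the transform into that
    of a Gaussian on the line times a sheared Gaussian in the other coordinates. *)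
Lemma gaussian_fourier n zeta (S : 'M[R]_n) : 0 < Re zeta -> S^T = S ->
  (forall x, x != 0 -> 0 < quad_form S x) ->
  [/\ edecay (gaussian zeta S), cmeas (fourier (gaussian zeta S)),
      edecay (fourier (gaussian zeta S)) &
      forall x, cintegral (lebesgue_rV n) setT
        (fun xi => fourier (gaussian zeta S) xi * cexp (- 'i * (dot xi x)%:C))
        = ((2 * pi) ^+ n)%:C * gaussian zeta S x].
Proof.
move=> z0; elim: n S => [|n ih] S Ssym Spd.
  have E1 : gaussian zeta S = fun=> 1.
    by apply/funext => x; rewrite /gaussian /quad_form big_ord0 mulr0 cexp0.
  have E2 : fourier (gaussian zeta S) = fun=> 1.
    apply/funext => xi; rewrite E1 /fourier cintegral_rV0.
      by rewrite /dot big_ord0 mulr0 cexp0 mulr1.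
    by apply: cmeasM; [exact: cmeas_cst|exact: cmeas_wave].
  have e1 : edecay ((fun=> 1) : 'rV[R]_0 -> C).
    exists 1, 1; split => // x; rewrite /norm1 big_ord0 mulr0 oppr0 expR0 mulr1.
    by rewrite cn1.
  split; rewrite ?E2 ?E1 //; first exact: cmeas_cst.
  move=> x; rewrite cintegral_rV0.
    by rewrite /dot big_ord0 mulr0 cexp0 expr0 !mulr1.
  apply: cmeasZ; apply: cmeas_cexp; apply: cmeasZ; apply: cmeas_real.
  by apply: measurable_dot.
have Spsd x : 0 <= quad_form S x.
  have [->|/Spd/ltW //] := eqVneq x 0.
  by rewrite /quad_form big1 // => i _; rewrite big1 // => j _; rewrite !mxE mulr0.
have [c [b [S' [_ S'sym S'psd SE H]]]] := quad_form_schur Ssym Spsd.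
have [c0 S'pd] := H Spd => {H}.
have [eg mF eF inv] := ih S' S'sym S'pd => {ih}.
pose z' := zeta * c%:C.
have z'0 : 0 < Re z' by rewrite /z' mulrC Re_scale mulr_gt0.
have z'n : z' != 0 by apply: contraTneq z'0 => ->; rewrite ltxx.
pose y' := (4 * z')^-1.
have y'0 : 0 < Re y' by exact: Re_inv4.
have gE x0 x : gaussian zeta S (cons_rV (x0, x)) = gz z' 0 (x0 + dot b x) * gaussian zeta S' x.
  rewrite /gaussian /gz -cexpD SE rcD rcM mul0r addr0 /z'; congr cexp; ring.
have bb : 0 < 1 + norm1 b by rewrite ltr_pwDl // norm1_ge0.
have eG : edecay (gaussian zeta S).
  have [A [B [A0 B0 HA]]] := eg.
  pose B' := B / (2 * (1 + norm1 b)).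
  have B'0 : 0 < B' by rewrite divr_gt0 // mulr_gt0.
  have B'E : 2 * B' + 2 * (norm1 b * B') = B by rewrite /B'; field; rewrite gt_eqF.
  have [A1 [A10 HA1]] := gz_decay 0 B' z'0.
  exists (A1 * A), B'; split => //; first exact: mulr_ge0.
  move=> x; have [x0 [x' ->]] := cons_rVP x.
  rewrite gE cnM norm1_cons; apply: le_trans (ler_pM (cn_ge0 _) (cn_ge0 _) (HA1 _) (HA _)) _.
  rewrite mulrACA -expRD ler_wpM2l ?mulr_ge0 // ler_expR.
  have h1 : `|x0| <= `|x0 + dot b x'| + norm1 b * norm1 x'.
    have := ler_normB (x0 + dot b x') (dot b x'); rewrite addrK => h.
    by apply: le_trans h _; rewrite lerD2l dot_le_norm1.
  have h2 := norm1_ge0 x'; have h3 := norm1_ge0 b.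
  have h4 : B' * `|x0| <= B' * (`|x0 + dot b x'| + norm1 b * norm1 x') by rewrite ler_wpM2l // ltW.
  have h5 : 0 <= B' * norm1 x' by rewrite mulr_ge0 // ltW.
  have h6 : 0 <= norm1 b * B' * norm1 x' by apply: mulr_ge0 => //; apply: mulr_ge0 => //; exact: ltW.
  have h7 : B * norm1 x' = 2 * B' * norm1 x' + 2 * (norm1 b * B') * norm1 x' by rewrite -mulrDl B'E.
  lra.
have mG := cmeas_gaussian zeta S.
have FE xi0 xi : fourier (gaussian zeta S) (cons_rV (xi0, xi)) =
   gz_int 0 z' 0 * gz y' 0 xi0 * fourier (gaussian zeta S') (xi - xi0 *: b).
  have [m1 e1 i1] := cintegrable_fourier (cons_rV (xi0, xi)) mG eG cn_cexp_i.
  rewrite fourierE; have [_ _ _ ->] := cintegral_lebesgueS m1 e1.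
  have [m2 e2 i2] := cintegrable_fourier (xi - xi0 *: b) (cmeas_gaussian zeta S') eg cn_cexp_i.
  rewrite fourierE -cintegralZ //; congr cintegral; apply/funext => x.
  have I1 := cintegrable_gz 0 ('i * xi0%:C) z'0.
  pose u := gaussian zeta S' x * cexp ('i * (dot (xi - xi0 *: b) x)%:C).
  have E (x0 : R) : gaussian zeta S (cons_rV (x0, x)) *
      cexp ('i * (dot (cons_rV (xi0, xi)) (cons_rV (x0, x)))%:C) =
     u * (((x0 + dot b x) ^+ 0)%:C * gz z' ('i * xi0%:C) (x0 + dot b x)).
    rewrite gE expr0 mul1r /u.
    have -> : gz z' ('i * xi0%:C) (x0 + dot b x) =
       gz z' 0 (x0 + dot b x) * cexp ('i * xi0%:C * (x0 + dot b x)%:C).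
      by rewrite /gz -cexpD mul0r addr0.
    rewrite (waveE b); move: (gz _ _ _) (gaussian _ _ _) (cexp _) (cexp _) => p q r s; ring.
  under eq_fun do rewrite E.
  pose h (y : R) := u * ((y ^+ 0)%:C * gz z' ('i * xi0%:C) y).
  have mh : cmeas (h : RT -> C) by apply: cmeasZ; exact: cmeas_gzk.
  have ih' : cintegrable lebesgue_measure setT (fun y : RT => h (y + dot b x)).
    apply: (@cintegrable_push _ _ _ _ _ lebesgue_measure lebesgue_measure (fun y : RT => y - dot b x : RT)).
    - exact: measurable_funB.
    - by move=> A mA; exact: lebesgue_measureD.
    - exact: (cmeas_comp mh (measurable_funD _ _)).
    - have := cintegrableZ u I1; congr cintegrable; apply/funext => y.
      by rewrite /h /= subrK.
  transitivity (cintegral lebesgue_measure setT (h : RT -> C)).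
    exact: (@cintegral_shiftR R h (dot b x) mh ih').
  rewrite /h cintegralZ // -/(gz_int 0 z' ('i * xi0%:C)) gz_intE // mulrC; congr (_ * _ * _).
  rewrite /gz mul0r addr0; congr cexp.
  rewrite exprMn sqr_i rcX /y'; move: (xi0%:C) => p; field.
  by rewrite z'n.
have mFS : cmeas (fourier (gaussian zeta S)).
  have -> : fourier (gaussian zeta S) = fun xi : 'rV[R]_n.+1 =>
     gz_int 0 z' 0 * gz y' 0 (head xi) * fourier (gaussian zeta S') (tail xi - head xi *: b).
    by apply/funext => xi; rewrite -{1}(cons_head_tail xi) FE.
  apply: cmeasM.
    by apply: cmeasZ; exact: (cmeas_comp (cmeas_gz y' 0) (@measurable_head R n)).
  apply: (cmeas_comp mF); apply: measurable_fun_rV => i.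
  under eq_fun do rewrite !mxE.
  apply: measurable_funB; first exact: measurable_coord.
  by apply: measurable_funM => //; exact: measurable_coord.
have eFS : edecay (fourier (gaussian zeta S)).
  have [A [B [A0 B0 HA]]] := eF.
  have [A1 [A10 HA1]] := gz_decay 0 (B * (1 + norm1 b)) y'0.
  exists (cn (gz_int 0 z' 0) * A1 * A), B; split => //; first by rewrite !mulr_ge0 ?cn_ge0.
  move=> x; have [x0 [x' ->]] := cons_rVP x.
  rewrite FE 2!cnM norm1_cons -!mulrA ler_wpM2l ?cn_ge0 //.
  apply: le_trans (ler_pM (cn_ge0 _) (cn_ge0 _) (HA1 _) (HA _)) _.
  rewrite [leRHS]mulrA mulrACA -expRD ler_wpM2l ?mulr_ge0 // ler_expR.
  have h1 : norm1 x' <= norm1 (x' - x0 *: b) + `|x0| * norm1 b.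
    by rewrite -norm1Z -[in leLHS](subrK (x0 *: b) x') norm1D.
  have h2 : B * norm1 x' <= B * (norm1 (x' - x0 *: b) + `|x0| * norm1 b) by rewrite ler_wpM2l // ltW.
  lra.
split => // x; have [x0 [x' ->]] := cons_rVP x.
have [m1 e1 i1] := cintegrable_fourier (cons_rV (x0, x')) mFS eFS cn_cexp_Ni.
under eq_fun do rewrite dotC.
have [_ _ -> _] := cintegral_lebesgueS m1 e1.
have [m2 e2 i2] := cintegrable_fourier x' mF eF cn_cexp_Ni.
pose w := - 'i * (x0 + dot b x')%:C.
have E (xi0 : RT) : cintegral (lebesgue_rV n) setT (fun xi =>
    fourier (gaussian zeta S) (cons_rV (xi0, xi)) * cexp (- 'i * (dot (cons_rV (x0, x')) (cons_rV (xi0, xi)))%:C)) =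
    gz_int 0 z' 0 * (((2 * pi) ^+ n)%:C * gaussian zeta S' x') * ((xi0 ^+ 0)%:C * gz y' w xi0).
  pose v := gz_int 0 z' 0 * gz y' w xi0.
  pose k eta := v * (fourier (gaussian zeta S') eta * cexp (- 'i * (dot x' eta)%:C)).
  have mk : cmeas k by apply: cmeasZ.
  have ek : edecay k.
    have [A [B [A0 B0 HA]]] := e2; exists (cn v * A), B; split => //.
      by rewrite mulr_ge0 ?cn_ge0.
    by move=> y; rewrite cnM -mulrA ler_wpM2l ?cn_ge0 ?HA.
  transitivity (cintegral (lebesgue_rV n) setT (fun xi => k (xi + (- (xi0 *: b))))).
    congr cintegral; apply/funext => xi; rewrite FE /k /v.
    have -> : gz y' w xi0 = gz y' 0 xi0 * cexp (w * xi0%:C) by rewrite /gz -cexpD mul0r addr0.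
    rewrite -!mulrA; congr (_ * (_ * _)).
    rewrite /w (waveE' b) -[- 'i * _ * _]mulrA; move: (fourier _ _) (cexp _) (cexp _) => p q r; ring.
  rewrite (cintegral_shift _ mk ek) cintegralZ //.
  under eq_fun do rewrite dotC.
  by rewrite inv /v expr0 mul1r; ring.
under eq_fun do rewrite E.
rewrite cintegralZ; last exact: cintegrable_gz.
rewrite -/(gz_int 0 y' w) [gz_int 0 y' w]gz_intE // gE.
have -> : gz z' 0 (x0 + dot b x') = cexp (w ^+ 2 / (4 * y')).
  rewrite /gz mul0r addr0; congr cexp; rewrite /w exprMn sqrrN sqr_i rcX /y'.
  by move: ((x0 + dot b x')%:C) => p; field.
have := gz_const_product z'0; rewrite -/y' => K.
rewrite (exprS (2 * pi)) [in RHS]rcM -K.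
move: (gz_int _ _ _) (gz_int _ _ _) (cexp _) (gaussian _ _ _) (_%:C) => p q r s u; ring.
Qed.

End gaussian_inversion.

(** * Moment generating functions *)

Section density.
Context d (T : measurableType d) {R : realType}.
Variables (nu : {finite_measure set T -> \bar R})
  (mu : {sigma_finite_measure set T -> \bar R}) (p : T -> R).
Hypotheses (p0 : forall x, 0 <= p x) (ip : mu.-integrable setT (EFin \o p))
  (nuE : forall A, measurable A -> nu A = (\int[mu]_(x in A) (p x)%:E)%E).

Let mp : measurable_fun setT p.
Proof. by apply/measurable_EFinP; exact: measurable_int ip. Qed.

Let dom : nu `<< mu.
Proof.
apply/null_content_dominatesP => A mA muA; rewrite nuE //.
by apply: null_set_integral => //; apply/measurable_funTS/measurable_EFinP.
Qed.

Lemma ge0_integral_density (f : T -> \bar R) : (forall x, 0 <= f x)%E ->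
  measurable_fun setT f -> (\int[nu]_x f x = \int[mu]_x (f x * (p x)%:E))%E.
Proof.
move=> f0 mf; rewrite -(Radon_Nikodym_SigmaFinite.change_of_variables dom f0) //.
have mg := measurable_int mu (Radon_Nikodym_SigmaFinite.f_integrable dom).
apply: ae_eq_integral => //.
- exact: emeasurable_funM.
- by apply: emeasurable_funM => //; exact/measurable_EFinP.
- apply: ae_eqe_mul2l; apply: integral_ae_eq => //.
  + exact: (Radon_Nikodym_SigmaFinite.f_integrable dom).
  + exact/measurable_EFinP.
  + by move=> A _ mA; rewrite -Radon_Nikodym_SigmaFinite.f_integral // nuE.
Qed.

Lemma integrable_density (f : T -> R) : measurable_fun setT f ->
  mu.-integrable setT (EFin \o (fun x => f x * p x)) -> nu.-integrable setT (EFin \o f).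
Proof.
move=> mf /integrableP[_ fi]; apply/integrableP; split; first exact/measurable_EFinP.
rewrite ge0_integral_density //; last first.
  by apply: measurableT_comp => //; exact/measurable_EFinP.
move: fi; congr (_ < _)%E; apply: eq_integral => x _ /=.
by rewrite normrM (ger0_norm (p0 x)).
Qed.

Lemma Rintegral_density (f : T -> R) : measurable_fun setT f ->
  mu.-integrable setT (EFin \o (fun x => f x * p x)) ->
  \int[nu]_x f x = \int[mu]_x (f x * p x).
Proof.
move=> mf fi; rewrite /Rintegral; congr fine.
rewrite [LHS]integralE [RHS]integralE; congr (_ - _)%E.
- rewrite ge0_integral_density //; last first.
    by apply: measurable_funepos; exact/measurable_EFinP.
  apply: eq_integral => x _; rewrite !funeposE -!EFin_max -EFinM; congr EFin.
  by rewrite maxr_pMl // mul0r.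
- rewrite ge0_integral_density //; last first.
    by apply: measurable_funeneg; exact/measurable_EFinP.
  apply: eq_integral => x _; rewrite !funenegE -!EFinN -!EFin_max -EFinM; congr EFin.
  by rewrite maxr_pMl // mul0r mulNr.
Qed.

Lemma cintegral_density (f : T -> R[i]) : cmeas f ->
  cintegrable mu setT (fun x => (p x)%:C * f x) ->
  cintegral nu setT f = cintegral mu setT (fun x => (p x)%:C * f x).
Proof.
move=> [mr mi] [ir ii].
have ER : (fun x => complex.Re ((p x)%:C * f x)) = (fun x => complex.Re (f x) * p x).
  by apply/funext => x; rewrite Re_scale mulrC.
have EI : (fun x => complex.Im ((p x)%:C * f x)) = (fun x => complex.Im (f x) * p x).
  by apply/funext => x; rewrite Im_scale mulrC.
rewrite /cintegral; congr Complex.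
  rewrite ER; apply: (@Rintegral_density (@complex.Re R \o f)) => //.
  by move: ir; congr integrable; apply/funext => x /=; rewrite (congr1 (fun g => g x) ER).
rewrite EI; apply: (@Rintegral_density (@complex.Im R \o f)) => //.
by move: ii; congr integrable; apply/funext => x /=; rewrite (congr1 (fun g => g x) EI).
Qed.

End density.

Section laws.
Context {R : realType} {n : nat}.
Local Notation C := R[i].
Local Notation vec := 'rV[R]_n.
Local Notation Re := (@complex.Re R).
Local Notation Im := (@complex.Im R).
Local Notation RT := (measurableTypeR R).
Implicit Types (M : 'rV[C]_n -> C) (mu : probability vec R).

Definition expmoments mu : Prop :=
  forall v : vec, mu.-integrable setT (EFin \o (fun x => expR (dot v x))).

(** The exponential of a complex linear form, whose expectations are the values of
    moment generating functions and, at imaginary [w], of characteristic functions. *)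
Definition lexp (w : 'rV[C]_n) (x : vec) : C := cexp (dot w (cvec x)).

Definition has_mgf mu M : Prop := expmoments mu /\
  forall w, cintegral mu setT (lexp w) = M w.

(** Laws enter only through this predicate: sums of independent variables become
    products of functions, and all exponential moments being finite makes every
    integral below dominated. *)
Definition is_mgf M : Prop := exists mu, has_mgf mu M.

Definition re_vec (w : 'rV[C]_n) : vec := \row_k Re (w ord0 k).
Definition im_vec (w : 'rV[C]_n) : vec := \row_k Im (w ord0 k).

Lemma Re_dot w x : Re (dot w (cvec x)) = dot (re_vec w) x.
Proof.
rewrite /dot Re_sum; apply: eq_bigr => k _.
by rewrite !mxE Re_mul /= mulr0 subr0.
Qed.

Lemma Im_dot w x : Im (dot w (cvec x)) = dot (im_vec w) x.
Proof.
rewrite /dot Im_sum; apply: eq_bigr => k _.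
by rewrite !mxE Im_mul /= mulr0 add0r.
Qed.

Lemma cn_lexp w x : cn (lexp w x) = expR (dot (re_vec w) x).
Proof. by rewrite cn_cexp Re_dot. Qed.

Lemma measurable_dotl (v : vec) : measurable_fun setT (fun x : vec => dot v x).
Proof. exact: measurable_dot. Qed.

Lemma measurable_expR_dot (v : vec) : measurable_fun setT (fun x : vec => expR (dot v x)).
Proof. by apply: measurableT_comp => //; exact: measurable_dotl. Qed.

Lemma cmeas_lexp w : cmeas (lexp w).
Proof.
apply: cmeas_cexp; split.
  rewrite (_ : _ \o _ = dot (re_vec w)); first exact: measurable_dotl.
  by apply/funext => x /=; rewrite Re_dot.
rewrite (_ : _ \o _ = dot (im_vec w)); first exact: measurable_dotl.
by apply/funext => x /=; rewrite Im_dot.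
Qed.

Lemma cvecD (x y : vec) : cvec (x + y) = cvec x + cvec y.
Proof. by apply/rowP => k; rewrite !mxE rcD. Qed.

Lemma cvecZ (c : R) (x : vec) : cvec (c *: x) = c%:C *: cvec x.
Proof. by apply/rowP => k; rewrite !mxE rcM. Qed.

Lemma cvecN (x : vec) : cvec (- x) = - cvec x.
Proof. by apply/rowP => k; rewrite !mxE rcN. Qed.

Lemma lexpD w x y : lexp w (x + y) = lexp w x * lexp w y.
Proof. by rewrite /lexp cvecD dotDr cexpD. Qed.

Lemma expmoments_cintegrable mu w : expmoments mu -> cintegrable mu setT (lexp w).
Proof.
move=> em; apply: cintegrable_dom (em (re_vec w)); first exact: cmeas_lexp.
by move=> x; rewrite cn_lexp.
Qed.

Lemma is_mgf_push d (T : measurableType d) (P : probability T R) (X : T -> vec) M :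
  measurable_fun setT X ->
  (forall v, P.-integrable setT (EFin \o (fun x => expR (dot v (X x))))) ->
  (forall w, cintegral P setT (fun x => lexp w (X x)) = M w) -> is_mgf M.
Proof.
move=> mX iX HM.
pose mX' := isMeasurableFun.Build _ _ _ _ _ mX.
pose X' : {mfun T >-> vec} := HB.pack X mX'.
exists (distribution P X'); split.
  move=> v; apply: (@integrable_push _ _ _ _ _ P _ X mX) => //.
    exact: measurable_expR_dot.
  exact: iX.
move=> w; rewrite -HM; apply/esym/(@cintegral_push _ _ _ _ _ P _ X mX) => //; first exact: cmeas_lexp.
apply: cintegrable_dom (iX (re_vec w)); last by move=> x /=; rewrite cn_lexp.
exact: (cmeas_comp (cmeas_lexp w) mX).
Qed.

Lemma is_mgf_cst (b : vec) : is_mgf (fun w => lexp w b).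
Proof.
have H (f : bool -> \bar R) : (\int[\d_true]_x f x = f true)%E.
  by rewrite integral_dirac // diracT mul1e.
apply: (@is_mgf_push _ bool (dirac true) (fun=> b)) => //.
- move=> v; apply/integrableP; split=> //.
  by rewrite H ltry.
- by move=> w; rewrite [RHS]complex_eta /cintegral /Rintegral !H.
Qed.

(** The law of a sum of two independent variables. *)
Lemma is_mgfM M1 M2 : is_mgf M1 -> is_mgf M2 -> is_mgf (fun w => M1 w * M2 w).
Proof.
move=> [m1 [i1 H1]] [m2 [i2 H2]].
have mS : measurable_fun setT (fun p : vec * vec => p.1 + p.2).
  apply: measurable_fun_rV => k; under eq_fun do rewrite mxE.
  apply: measurable_funD.
    exact: (measurableT_comp (@measurable_coord _ _ k) measurable_fst).
  exact: (measurableT_comp (@measurable_coord _ _ k) measurable_snd).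
apply: (@is_mgf_push _ _ (m1 \x m2)%E (fun p : vec * vec => p.1 + p.2)) => //.
- move=> v; have := integrable_prod (fun x => expR_ge0 (dot v x)) (fun x => expR_ge0 _) (i1 v) (i2 v).
  by congr integrable; apply/funext => p /=; rewrite dotDr expRD.
- move=> w.
  have ml := cmeas_comp (cmeas_lexp w) mS.
  have bd x y : cn ((lexp w \o (fun p : vec * vec => p.1 + p.2)) (x, y)) <= expR (dot (re_vec w) x) * expR (dot (re_vec w) y).
    by rewrite /= cn_lexp dotDr expRD.
  have [_ _ -> _] := cfubini_dom (fun x => expR_ge0 (dot (re_vec w) x)) (fun x => expR_ge0 _)
     (i1 (re_vec w)) (i2 (re_vec w)) ml bd.
  under eq_fun => x.
    under eq_fun do rewrite /= lexpD.
    rewrite (cintegralZ _ (expmoments_cintegrable w i2)) H2.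
    over.
  by rewrite cintegralZr ?H1 //; exact: expmoments_cintegrable.
Qed.

(** The law of a standard normal variable times the vector [b]. *)
Lemma is_mgf_gauss (b : vec) : is_mgf (fun w => cexp (dot w (cvec b) ^+ 2 / 2)).
Proof.
have mX : measurable_fun setT (fun x : RT => (x : R) *: b).
  apply: measurable_fun_rV => k; under eq_fun do rewrite mxE.
  by apply: measurable_funM.
pose p (x : RT) : R := normal_pdf 0 1 x.
have s1 : (1 : R) != 0 by [].
pose k := (Num.sqrt (2 * pi) : R)^-1.
have k0 : 0 <= k by rewrite invr_ge0 sqrtr_ge0.
have half : 0 < complex.Re (1 / 2 : C).
  by rewrite mul1r -(rc_nat 2) -rcV /= invr_gt0.
have pE (w : C) (x : R) : (p x)%:C * cexp (w * x%:C) = k%:C * ((x ^+ 0)%:C * gz (1 / 2) w x).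
  rewrite expr0 [1%:C]/(1 : C) !mul1r /p normal_pdfE // /normal_peak /normal_fun subr0 expr1n !mul1r.
  rewrite -[pi *+ 2]mulr_natl -/k rcM -mulrA; congr (_ * _).
  rewrite -cexp_real /gz cexpD; congr (_ * _); congr cexp.
  by rewrite rcM rcV rcN rc_nat mulrC mulNr mulrN.
have nE (A : set RT) : measurable A -> normal_prob 0 1 A = (\int[lebesgue_measure]_(x in A) (p x)%:E)%E by [].
have p0 x : 0 <= p x by exact: normal_pdf_ge0.
have ip : (@lebesgue_measure R).-integrable setT (EFin \o p) by exact: integrable_normal_pdf.
have I (w : C) : cintegrable (@lebesgue_measure R) setT (fun x : RT => (p x)%:C * cexp (w * (x : R)%:C)).
  have := cintegrableZ k%:C (cintegrable_gz 0 w half).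
  by congr cintegrable; apply/funext => x; rewrite pE.
have mE (w : C) : cmeas (fun x : RT => cexp (w * (x : R)%:C)).
  by apply: cmeas_cexp; apply: cmeasZ; exact: cmeas_real.
apply: (@is_mgf_push _ _ (normal_prob 0 1) (fun x : RT => (x : R) *: b)) => //.
- move=> v; apply: (integrable_density p0 ip nE).
    exact: (measurableT_comp (measurable_expR_dot v) mX).
  have := cintegrable_cn (I (dot v b)%:C).
  congr integrable; apply/funext => x /=.
  rewrite cnM cn_real ger0_norm // cn_cexp -rcM /= dotZr.
  by congr EFin; rewrite mulrC [x * _]mulrC.
- move=> w.
  transitivity (cintegral (normal_prob 0 1) setT (fun x : RT => cexp (dot w (cvec b) * (x : R)%:C))).
    by congr cintegral; apply/funext => x; rewrite /lexp cvecZ dotZr mulrC.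
  rewrite (cintegral_density p0 ip nE (mE _) (I _)).
  under eq_fun do rewrite pE.
  rewrite cintegralZ; last exact: cintegrable_gz.
  rewrite -/(gz_int 0 (1 / 2) _) gz_intE // gz_int_half /k mulrA -rcM mulVf; last first.
    by rewrite gt_eqF // sqrtr_gt0 mulr_gt0 ?pi_gt0.
  by rewrite [1%:C]/(1 : C) [LHS]mul1r; congr cexp; field.
Qed.

End laws.

(** * Compound Poisson laws *)

Section poisson_mixture.
Context {R : realType} {n : nat}.
Local Notation C := R[i].
Local Notation vec := 'rV[R]_n.
Local Notation Re := (@complex.Re R).
Local Notation Im := (@complex.Im R).
Implicit Types (M : 'rV[C]_n -> C).

Lemma eq_cvg_seq (u v : nat -> R) (l : R) : u =1 v -> u @ \oo --> l -> v @ \oo --> l.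
Proof. by move/funext ->. Qed.

Lemma cvg_mull (u : nat -> R) (c l : R) : u @ \oo --> l -> c * u k @[k --> \oo] --> c * l.
Proof. by move=> ul; apply: cvgM => //; exact: cvg_cst. Qed.

Lemma cvg_addR (u v : nat -> R) (l l' : R) : u @ \oo --> l -> v @ \oo --> l' ->
  u k + v k @[k --> \oo] --> l + l'.
Proof. exact: cvgD. Qed.

Lemma cvg_expn_fact (x : R) : x ^+ k / k`!%:R @[k --> \oo] --> (0 : R).
Proof. exact: (cvg_series_cvg_0 (is_cvg_series_exp_coeff x)). Qed.

Lemma cvg_expR_series (x : R) : \sum_(k < N) x ^+ k / k`!%:R @[N --> \oo] --> expR x.
Proof.
have := is_cvg_series_exp_coeff x; rewrite /expR.
by apply: eq_cvg_seq => N; rewrite /series /= big_mkord.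
Qed.

Lemma squeeze_dist (u v : nat -> R) (l : R) : (forall k, `|u k - l| <= v k) ->
  v @ \oo --> (0 : R) -> u @ \oo --> l.
Proof.
move=> uv v0; apply/cvgrPdist_le => e e0.
move/cvgrPdist_le : v0 => /(_ e e0); apply: filterS => k /=.
rewrite sub0r normrN distrC => h; apply: le_trans (uv k) _.
exact: le_trans (ler_norm _) h.
Qed.

Lemma cvg_cexp_series (z : C) :
  Re (\sum_(k < N) z ^+ k / k`!%:R) @[N --> \oo] --> Re (cexp z) /\
  Im (\sum_(k < N) z ^+ k / k`!%:R) @[N --> \oo] --> Im (cexp z).
Proof.
pose v N := cn z ^+ N / N`!%:R * Num.max 1 (expR (Re z)).
have v0 : v @ \oo --> (0 : R).
  have := cvg_mull (c := Num.max 1 (expR (Re z))) (@cvg_expn_fact (cn z)).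
  by rewrite mulr0; apply: eq_cvg_seq => N; rewrite mulrC.
split; apply: squeeze_dist v0 => N.
  rewrite -Re_opp -Re_add; apply: le_trans (Re_le_cn _) _.
  by rewrite cn_distC; exact: cexp_taylor.
rewrite -Im_opp -Im_add; apply: le_trans (Im_le_cn _) _.
by rewrite cn_distC; exact: cexp_taylor.
Qed.

Lemma nneseries_EFin (u : nat -> R) (l : R) :
  \sum_(k < N) u k @[N --> \oo] --> l -> (\sum_(0 <= k <oo) (u k)%:E)%E = l%:E.
Proof.
move=> ul; apply/cvg_lim => //.
rewrite (_ : (fun _ => _) = (fun N => (\sum_(k < N) u k)%:E)).
  by apply/fine_cvgP; split; first exact: nearW.
by apply/funext => N; rewrite sumEFin big_mkord.
Qed.

Section mixture.
Variables (mu_ : nat -> probability vec R) (p : nat -> {nonneg R}).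
Let m := mseries (fun k => mscale (p k) (mu_ k)) 0.

Lemma mixture_ge0 (h : vec -> R) (e : nat -> R) (L : R) :
  measurable_fun setT h -> (forall x, 0 <= h x) ->
  (forall k, (mu_ k).-integrable setT (EFin \o h)) ->
  (forall k, \int[mu_ k]_x h x = e k) ->
  \sum_(k < N) (p k)%:num * e k @[N --> \oo] --> L ->
  m.-integrable setT (EFin \o h) /\ \int[m]_x h x = L.
Proof.
move=> mh h0 ih he hL.
have E : (\int[m]_x (h x)%:E)%E = L%:E.
  rewrite ge0_integral_measure_series //; last 2 first.
  - by move=> x _; rewrite lee_fin.
  - exact/measurable_EFinP.
  transitivity (\sum_(0 <= k <oo) ((p k)%:num * e k)%:E)%E; last exact: nneseries_EFin.
  apply: eq_eseriesr => k _.
  rewrite ge0_integral_mscale //; last 2 first.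
  - exact/measurable_EFinP.
  - by move=> x _; rewrite lee_fin.
  rewrite EFinM -he /Rintegral fineK //.
  exact: (integrable_fin_num measurableT (ih k)).
split; last by rewrite /Rintegral E.
apply/integrableP; split; first exact/measurable_EFinP.
under eq_integral => x _ do rewrite /= ger0_norm //.
by rewrite E ltry.
Qed.

Lemma mixture_dom (f h : vec -> R) (e e' : nat -> R) (L L' : R) :
  measurable_fun setT h -> measurable_fun setT f -> (forall x, `|f x| <= h x) ->
  (forall k, (mu_ k).-integrable setT (EFin \o h)) ->
  (forall k, \int[mu_ k]_x h x = e k) ->
  (forall k, \int[mu_ k]_x f x = e' k) ->
  \sum_(k < N) (p k)%:num * e k @[N --> \oo] --> L ->
  \sum_(k < N) (p k)%:num * e' k @[N --> \oo] --> L' ->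
  \int[m]_x f x = L'.
Proof.
move=> mh mf fh ih he fe hL fL.
have h0 x : 0 <= h x by exact: le_trans (fh x).
have fi k : (mu_ k).-integrable setT (EFin \o f) by exact: integrable_dom (ih k).
have [im Em] := mixture_ge0 mh h0 ih he hL.
have fh0 x : 0 <= f x + h x by have := fh x; rewrite ler_norml => /andP[]; lra.
have he' k : \int[mu_ k]_x (f x + h x) = e' k + e k by have := RintegralD measurableT (fi k) (ih k); rewrite he fe.
have hL' : \sum_(k < N) (p k)%:num * (e' k + e k) @[N --> \oo] --> L' + L.
  have := cvg_addR fL hL; apply: eq_cvg_seq => N /=.
  by rewrite -big_split; apply: eq_bigr => k _ /=; rewrite mulrDr.
have [_ E2] := mixture_ge0 (measurable_funD mf mh) fh0 (fun k => integrableDR (fi k) (ih k)) he' hL'.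
have ifm : m.-integrable setT (EFin \o f) by exact: integrable_dom im.
have := RintegralD measurableT ifm im.
by rewrite E2 Em => /addIr.
Qed.

End mixture.

Lemma is_mgfX M k : is_mgf M -> is_mgf (fun w => M w ^+ k).
Proof.
move=> hM; elim: k => [|k ih].
  have c0 : cvec (0 : vec) = 0 by apply/rowP => i; rewrite !mxE.
  have := @is_mgf_cst R n 0; congr is_mgf; apply/funext => w.
  by rewrite /lexp c0 dotC dot0l cexp0.
have := is_mgfM hM ih; congr is_mgf; apply/funext => w; by rewrite exprS.
Qed.

(** A sum of independent copies whose number has the Poisson law of parameter [c],
    that is, the mixture of the convolution powers with Poisson weights. *)
Lemma is_mgf_poisson M (c : R) : 0 <= c -> is_mgf M ->
  is_mgf (fun w => cexp (c%:C * (M w - 1))).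
Proof.
move=> c0 hM.
have [mu_ Hmu] := choice (fun k => is_mgfX k hM).
pose q k : R := expR (- c) * (c ^+ k / k`!%:R).
have q0 k : 0 <= q k by rewrite mulr_ge0 ?expR_ge0 // divr_ge0 ?exprn_ge0.
pose p k : {nonneg R} := NngNum (q0 k).
pose m := mseries (fun k => mscale (p k) (mu_ k)) 0.
have cvq (x : R) : \sum_(k < N) (p k)%:num * x ^+ k @[N --> \oo] --> expR (- c) * expR (c * x).
  have := cvg_mull (c := expR (- c)) (@cvg_expR_series (c * x)).
  apply: eq_cvg_seq => N /=; rewrite mulr_sumr.
  by apply: eq_bigr => k _; rewrite /q exprMn; ring.
have cvcq (z : C) : let S N := \sum_(k < N) (p k)%:num%:C * z ^+ k in
    Re (S N) @[N --> \oo] --> Re (cexp (c%:C * (z - 1))) /\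
    Im (S N) @[N --> \oo] --> Im (cexp (c%:C * (z - 1))).
  have SE N : \sum_(k < N) (p k)%:num%:C * z ^+ k = (expR (- c))%:C * \sum_(k < N) (c%:C * z) ^+ k / k`!%:R.
    rewrite mulr_sumr; apply: eq_bigr => k _.
    by rewrite /= /q !rcM rcV rc_nat rcX exprMn; ring.
  have E : cexp (c%:C * (z - 1)) = (expR (- c))%:C * cexp (c%:C * z).
    by rewrite -cexp_real -cexpD rcN mulrBr mulr1 addrC.
  have [h1 h2] := @cvg_cexp_series (c%:C * z).
  rewrite E Re_scale Im_scale; split.
    by have := cvg_mull (c := expR (- c)) h1; apply: eq_cvg_seq => N; rewrite SE Re_scale.
  by have := cvg_mull (c := expR (- c)) h2; apply: eq_cvg_seq => N; rewrite SE Im_scale.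
have mT : m setT = 1%E.
  have -> : m setT = (\sum_(k <oo) (q k)%:E)%E.
    apply: eq_eseriesr => k _.
    transitivity ((q k)%:E * mu_ k setT)%E; first by [].
    by rewrite probability_setT mule1.
  apply: nneseries_EFin; have := cvq 1; rewrite mulr1 -expRD addNr expR0.
  by apply: eq_cvg_seq => N; apply: eq_bigr => k _; rewrite expr1n mulr1.
pose mP := Measure_isProbability.Build _ _ R m mT.
pose P : probability vec R := HB.pack m mP.
have em k v : (mu_ k).-integrable setT (EFin \o (fun x => expR (dot v x))) by have [h _] := Hmu k; exact: h.
have er k v : \int[mu_ k]_x expR (dot v x) = Re (M (cvec v)) ^+ k.
  have H (j : nat) : (\int[mu_ j]_x expR (dot v x))%:C = M (cvec v) ^+ j.
    have [_ <-] := Hmu j; rewrite -cintegral_real; congr cintegral; apply/funext => x.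
    by rewrite /lexp dot_cvec cexp_real.
  have M1 : M (cvec v) = (Re (M (cvec v)))%:C by have := H 1; rewrite expr1 => <-.
  by apply: (@complexI R); rewrite H rcX -M1.
exists P; split.
  move=> v; have [] // := @mixture_ge0 mu_ p (fun x => expR (dot v x)) _ _ (measurable_expR_dot v)
     (fun x => expR_ge0 _) (fun k => em k v) (fun k => er k v) (cvq _).
move=> w; have [m1 m2] := cmeas_lexp w.
have [c1 c2] := cvcq (M w).
have cM k : cintegral (mu_ k) setT (lexp w) = M w ^+ k by have [_ h] := Hmu k.
rewrite [RHS]complex_eta /cintegral; congr Complex.
- apply: (@mixture_dom mu_ p (Re \o lexp w) (fun x => expR (dot (re_vec w) x)) _ (fun k => Re (M w ^+ k)) _ _
    (measurable_expR_dot _) m1 _ (fun k => em k _) (fun k => er k _) _ (cvq _)).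
  + by move=> x; rewrite -cn_lexp; exact: Re_le_cn.
  + by move=> k; rewrite -cM.
  + move: c1; apply: eq_cvg_seq => N; rewrite Re_sum; apply: eq_bigr => k _.
    by rewrite Re_scale.
- apply: (@mixture_dom mu_ p (Im \o lexp w) (fun x => expR (dot (re_vec w) x)) _ (fun k => Im (M w ^+ k)) _ _
    (measurable_expR_dot _) m2 _ (fun k => em k _) (fun k => er k _) _ (cvq _)).
  + by move=> x; rewrite -cn_lexp; exact: Im_le_cn.
  + by move=> k; rewrite -cM.
  + move: c2; apply: eq_cvg_seq => N; rewrite Im_sum; apply: eq_bigr => k _.
    by rewrite Im_scale.
Qed.

Lemma is_mgf_prod (I : Type) (s : seq I) (F : I -> 'rV[C]_n -> C) :
  (forall i, is_mgf (F i)) -> is_mgf (fun w => \prod_(i <- s) F i w).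
Proof.
move=> hF; elim: s => [|i s ih].
  have := is_mgfX 0 (is_mgf_cst (0 : vec)).
  by congr is_mgf; apply/funext => w; rewrite big_nil expr0.
by have := is_mgfM (hF i) ih; congr is_mgf; apply/funext => w; rewrite big_cons.
Qed.

End poisson_mixture.

(** * Measures of compact support *)

Section compact_support.
Context {R : realType} {n : nat}.
Local Notation C := R[i].
Local Notation vec := 'rV[R]_n.
Variable r : probability vec R.

Let cell (p : 'rV[rat]_n * nat) : set vec :=
  [set x | norm1 (x - \row_k ratr (p.1 ord0 k)) < p.2.+1%:R^-1].

Let measurable_cell p : measurable (cell p).
Proof.
have m : measurable_fun setT (fun x : vec => norm1 (x - \row_k ratr (p.1 ord0 k))).
  exact: (measurableT_comp (@measurable_norm1 R n) (measurable_rVD _)).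
rewrite (_ : cell p = (fun x : vec => norm1 (x - \row_k ratr (p.1 ord0 k))) @^-1` `]-oo, p.2.+1%:R^-1[%classic).
  by rewrite -[X in measurable X]setTI; exact: m.
by apply/seteqP; split => x /=; rewrite in_itv.
Qed.

Let open_cell (U : set vec) x : open U -> U x -> exists p, cell p x /\ cell p `<=` U.
Proof.
move=> oU Ux.
have /nbhs_ballP[e /= e0 eU] : nbhs x U by exact: open_nbhs_nbhs.
have [k ke] : exists k : nat, k.+1%:R^-1 < e / 2.
  have e20 : 0 < e / 2 by rewrite divr_gt0.
  by have [k] := ltr_add_invr e20; rewrite add0r; exists k.
pose dl : R := k.+1%:R^-1 / n.+1%:R.
have dl0 : 0 < dl by rewrite divr_gt0 // invr_gt0.
have Q i : exists q : rat, `|x ord0 i - ratr q| < dl.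
  have xx : x ord0 i - dl < x ord0 i + dl by lra.
  have [q] := rat_in_itvoo xx.
  by rewrite in_itv /= => /andP[h1 h2]; exists q; rewrite ltr_norml; apply/andP; split; lra.
have [q Hq] := choice Q.
exists (\row_i q i, k); split.
  rewrite /cell /= /norm1.
  apply: (@le_lt_trans _ _ (\sum_(i < n) dl)).
    by apply: ler_sum => i _; rewrite !mxE ltW.
  rewrite sumr_const card_ord -[_ *+ _]mulr_natr /dl mulrAC -mulrA.
  rewrite gtr_pMr ?invr_gt0 // ltr_pdivrMr // mul1r ltr_nat //.
move=> y; rewrite /cell /= => hy; apply: eU; split => // i j.
rewrite ord1 /ball /=.
have h1 := coord_le_norm1 (y - \row_k ratr ((\row_i q i) ord0 k)) j.
have h2 := Hq j; move: h1; rewrite !mxE => h1.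
have dlk : dl <= k.+1%:R^-1.
  by rewrite /dl ler_piMr ?invr_ge0 // invf_le1 // ler1n.
rewrite (_ : x ord0 j - y ord0 j = (x ord0 j - ratr (q j)) - (y ord0 j - ratr (q j))); last by ring.
apply: le_lt_trans (ler_normB _ _) _; apply: le_lt_trans (lerD (ltW h2) h1) _.
by rewrite [ltRHS]splitr ltrD // ?(le_lt_trans dlk ke) // (lt_trans hy ke).
Qed.

(** The Borel sets are generated by the coordinates; an open set is the countable
    union of the cells with rational centre and radius that it contains. *)
Lemma measurable_open_rV (U : set vec) : open U -> measurable U.
Proof.
move=> oU; rewrite (_ : U = \bigcup_p (if `[< cell p `<=` U >] then cell p else set0)).
  apply: countable_bigcupT_measurable; first exact: countableP.
  by move=> p; case: ifP => _ //; exact: measurable_cell.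
apply/seteqP; split => [x Ux|x [p _]].
  have [p [px pU]] := open_cell oU Ux.
  by exists p => //; rewrite ifT //; exact/asboolP.
by case: ifP => // /asboolP pU px; exact: pU.
Qed.

Let null_cells := \bigcup_p (if r (cell p) == 0%E then cell p else set0).

Let null_cells0 : r.-negligible null_cells.
Proof.
rewrite /null_cells.
pose F (k : nat) := if @unpickle ('rV[rat]_n * nat)%type k is Some p then
   (if r (cell p) == 0%E then cell p else set0) else set0.
apply: (@negligibleS _ _ _ _ (\bigcup_k F k)).
  by move=> x [p _ px]; exists (pickle p) => //; rewrite /F pickleK.
apply: negligible_bigcup => k; rewrite /F; case: unpickle => [p|]; last exact: negligible_set0.
case: ifPn => [/eqP rp|_]; last exact: negligible_set0.
by exists (cell p); split.
Qed.

(** The complement of the support is covered by the cells of measure zero, of which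
    there are countably many. *)
Lemma compact_supp_bounded : compact (supp r) ->
  exists K : R, r [set x | K < norm1 x] = 0%E.
Proof.
move=> /compact_bounded [M [_ HM]].
pose K := (`|M| + 1) * n%:R.
exists K; apply: measure_negligible.
  rewrite (_ : [set x | _] = (@norm1 R n) @^-1` `]K, +oo[%classic).
    by rewrite -[X in measurable X]setTI; exact: measurable_norm1.
  by apply/seteqP; split => x /=; rewrite in_itv /= andbT.
apply: negligibleS null_cells0 => x /= Kx.
have : ~ supp r x.
  move=> sx; have := HM (`|M| + 1) _ _ sx.
  have MM : M < `|M| + 1 by rewrite (le_lt_trans (ler_norm M)) // ltrDl.
  move=> /(_ MM) xM; move: Kx; apply/negP; rewrite -leNgt /K mulr_natr.
  rewrite -[n in _ *+ n]card_ord -sumr_const; apply: ler_sum => i _.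
  apply: le_trans xM; rewrite /Num.norm /= mx_normrE.
  exact: (le_bigmax _ (fun ij : 'I_1 * 'I_n => `|x ij.1 ij.2|) (ord0, i)).
move=> /existsNP[U] /not_implyP[oU] /not_implyP[Ux] /negP; rewrite negbK => /eqP rU.
have [p [px pU]] := open_cell oU Ux.
exists p => //; rewrite ifT // eq_le measure_ge0 andbT -rU.
by apply: le_measure => //; rewrite inE; [exact: measurable_cell|exact: measurable_open_rV].
Qed.

Lemma integrable_compact_supp (f : vec -> R) (B K : R) :
  r [set x | K < norm1 x] = 0%E -> measurable_fun setT f ->
  (forall x, norm1 x <= K -> `|f x| <= B) -> r.-integrable setT (EFin \o f).
Proof.
move=> r0 mf fB.
have mZ : measurable [set x : vec | K < norm1 x].
  rewrite (_ : [set x | _] = (@norm1 R n) @^-1` `]K, +oo[%classic).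
    by rewrite -[X in measurable X]setTI; exact: measurable_norm1.
  by apply/seteqP; split => x /=; rewrite in_itv /= andbT.
apply/integrableP; split; first exact/measurable_EFinP.
rewrite (ge0_negligible_integral mZ) //; last first.
  by apply: measurableT_comp => //; exact/measurable_EFinP.
apply: (@le_lt_trans _ _ (\int[r]_(x in [set: vec] `\` [set x : vec | (K < norm1 x)%R]) (`|B|)%:E)%E).
  apply: ge0_le_integral => //.
  - exact: measurableD.
  - by apply: measurableT_comp => //; apply/measurable_EFinP/measurable_funTS.
  - by move=> x [_ /negP]; rewrite -leNgt /= lee_fin => /fB h; apply: le_trans h (ler_norm _).
rewrite integral_cst //; last exact: measurableD.
by apply: lte_mul_pinfty => //; rewrite (le_lt_trans (probability_le1 _ _)) ?ltry //; exact: measurableD.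
Qed.

(** Bounded jumps have all exponential moments. *)
Lemma is_mgf_opp : compact (supp r) ->
  is_mgf (fun w : 'rV[C]_n => cintegral r setT (fun x => lexp w (- x))).
Proof.
move=> /compact_supp_bounded [K rK].
apply: (@is_mgf_push R n _ _ r (fun x => - x)) => //; first exact: measurable_rVN.
move=> v; apply: (@integrable_compact_supp _ (expR (norm1 v * K)) K) => //.
  exact: (measurableT_comp (measurable_expR_dot v) (@measurable_rVN R n)).
move=> x xK; rewrite ger0_norm ?expR_ge0 // ler_expR.
apply: le_trans (ler_norm _) _; apply: le_trans (dot_le_norm1 _ _) _.
by rewrite norm1N ler_wpM2l // norm1_ge0.
Qed.

End compact_support.

(** * Positive semidefinite forms as sums of squares *)

Section psd_squares.
Context {R : realType}.
Local Notation C := R[i].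
Local Notation Re := (@complex.Re R).
Local Notation Im := (@complex.Im R).

(** Completing the square one coordinate after the other. *)
Lemma psd_sum_squares n (S : 'M[R]_n) : S^T = S -> (forall x, 0 <= quad_form S x) ->
  exists bs : seq 'rV[R]_n, forall x, quad_form S x = \sum_(b <- bs) dot b x ^+ 2.
Proof.
elim: n S => [|n ih] S Ssym Spsd.
  by exists [::] => x; rewrite /quad_form big_ord0 big_nil.
have [c [b [S' [c0 S'sym S'psd SE _]]]] := quad_form_schur Ssym Spsd.
have [bs Hbs] := ih S' S'sym S'psd.
exists (Num.sqrt c *: cons_rV (1, b) :: [seq cons_rV (0, b') | b' <- bs]) => x.
have [x0 [x' ->]] := cons_rVP x.
rewrite SE big_cons dotZl exprMn sqr_sqrtr // dot_cons mul1r; congr (_ + _).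
by rewrite Hbs big_map; apply: eq_bigr => b' _; rewrite dot_cons mul0r add0r.
Qed.

Definition cquad n (S : 'M[R]_n) (w : 'rV[C]_n) : C :=
  dot w (w *m (map_mx (real_complex R) S)^T).

(** Polarization: the values at complex vectors are determined by those at real
    vectors. *)
Lemma cquadE n (S : 'M[R]_n) w : cquad S w =
  (quad_form S (re_vec w) - quad_form S (im_vec w)) +i*
  (quad_form S (re_vec w + im_vec w) - quad_form S (re_vec w) - quad_form S (im_vec w)).
Proof.
have E : cquad S w = \sum_i \sum_j (S i j)%:C * w ord0 i * w ord0 j.
  rewrite /cquad /dot; apply: eq_bigr => i _; rewrite mxE mulr_sumr.
  by apply: eq_bigr => j _; rewrite !mxE; ring.
rewrite E [LHS]complex_eta; congr Complex.
  rewrite Re_sum /quad_form -sumrB; apply: eq_bigr => i _.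
  rewrite Re_sum -sumrB; apply: eq_bigr => j _.
  by rewrite -mulrA Re_scale Re_mul !mxE; ring.
rewrite Im_sum /quad_form -!sumrB; apply: eq_bigr => i _.
rewrite Im_sum -!sumrB; apply: eq_bigr => j _.
by rewrite -mulrA Im_scale Im_mul !mxE; ring.
Qed.

Lemma sqr_dotE n (b : 'rV[R]_n) w : dot w (cvec b) ^+ 2 =
  (dot b (re_vec w) ^+ 2 - dot b (im_vec w) ^+ 2) +i*
  (dot b (re_vec w + im_vec w) ^+ 2 - dot b (re_vec w) ^+ 2 - dot b (im_vec w) ^+ 2).
Proof.
rewrite [LHS]complex_eta expr2 Re_mul Im_mul !Re_dot !Im_dot dotDr !(dotC b).
by congr Complex; ring.
Qed.

(** Only the symmetric part of [D] contributes to the form. *)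
Lemma cquad_sum_squares n (D : 'M[R]_n) : (forall x, 0 <= dot x (x *m D^T)) ->
  exists bs : seq 'rV[R]_n, forall w, cquad D w = \sum_(b <- bs) dot w (cvec b) ^+ 2.
Proof.
move=> Dpsd.
pose S : 'M[R]_n := 2^-1 *: (D + D^T).
have SE x : quad_form S x = quad_form D x.
  have -> : quad_form S x = 2^-1 * (quad_form D x + quad_form D^T x).
    rewrite /quad_form -big_split mulr_sumr; apply: eq_bigr => i _ /=.
    rewrite -big_split mulr_sumr; apply: eq_bigr => j _ /=.
    by rewrite /S !mxE; ring.
  have -> : quad_form D^T x = quad_form D x.
    rewrite /quad_form exchange_big /=; apply: eq_bigr => i _; apply: eq_bigr => j _.
    by rewrite mxE; ring.
  by field.
have Ssym : S^T = S by rewrite /S linearZ /= linearD /= trmxK addrC.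
have Spsd x : 0 <= quad_form S x by rewrite SE -quad_formE.
have [bs Hbs] := psd_sum_squares Ssym Spsd.
exists bs => w; rewrite cquadE -!SE !Hbs [RHS]complex_eta Re_sum Im_sum.
by congr Complex; rewrite -!sumrB; apply: eq_bigr => b _; rewrite sqr_dotE.
Qed.

End psd_squares.

(** * The law of the Levy process *)

Section levy.
Context {R : realType} {n : nat}.
Local Notation C := R[i].
Local Notation vec := 'rV[R]_n.
Variables (a : vec) (D : 'M[R]_n) (z : R) (r : probability vec R).
Hypotheses (D_psd : forall x : vec, 0 <= dot x (x *m D^T)) (z_ge0 : 0 <= z)
  (r_no_atom0 : r [set 0] = 0%E) (r_compact : compact (supp r)).

Definition jump_mgf (w : 'rV[C]_n) : C := cintegral r setT (fun x => lexp w (- x)).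

Lemma measurable_set0_rV : measurable [set (0 : vec)].
Proof.
rewrite (_ : [set 0] = (@norm1 R n) @^-1` [set 0]).
  by rewrite -[X in measurable X]setTI; apply: measurable_norm1.
apply/seteqP; split => x /=.
  by move=> ->; rewrite /norm1 big1 // => k _; rewrite mxE normr0.
move=> x0; apply/rowP => k; rewrite mxE; apply/eqP; rewrite -normr_le0 -x0.
exact: coord_le_norm1.
Qed.

Lemma cintegrable_jump w : cintegrable r setT (fun x => lexp w (- x)).
Proof.
have [K rK] := compact_supp_bounded r_compact.
have m : cmeas (fun x : vec => lexp w (- x)) by exact: (cmeas_comp (cmeas_lexp w) (@measurable_rVN R n)).
apply: (@cintegrable_dom _ _ _ r _ (fun x : vec => expR (dot (re_vec w) (- x))) m).
  by move=> x; rewrite cn_lexp.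
apply: (@integrable_compact_supp _ _ _ _ (expR (norm1 (re_vec w) * K)) K) => //.
  exact: (measurableT_comp (measurable_expR_dot (re_vec w)) (@measurable_rVN R n)).
move=> x xK; rewrite ger0_norm ?expR_ge0 // ler_expR.
apply: le_trans (ler_norm _) _; apply: le_trans (dot_le_norm1 _ _) _.
by rewrite norm1N ler_wpM2l // norm1_ge0.
Qed.

(** At the imaginary argument [i w] the drift and the diffusion term change sign and
    the jump integrand becomes [lexp w (- x)]; hence the law of minus the increment
    of the process below. The origin can be put back in the domain of integration
    since it carries no mass. *)
Lemma levy_charE w : levy_char a D z r w =
  - dot w (cvec a) + cquad D w + z%:C * (jump_mgf w - 1).
Proof.
rewrite /levy_char /levy_symbol dotZr mulrA -expr2 sqr_i mulN1r dotC; congr (_ + _ + _).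
  rewrite -scalemxAl dotZl dotZr mulrA -expr2 sqr_i mulN1r opprK //.
congr (_ * _).
have -> : (fun phi : vec => cexp ('i * dot (cvec phi) ('i *: w)) - 1) = (fun x => lexp w (- x) - 1).
  by apply/funext => x; rewrite /lexp cvecN dotNr dotZr mulrA -expr2 sqr_i mulN1r dotC.
have E (f : vec -> C) : cintegrable r setT f -> cintegral r [set~ 0] f = cintegral r setT f.
  move=> [fr fi]; rewrite /cintegral /Rintegral.
  rewrite [in RHS](negligible_integral measurable_set0_rV measurableT fr r_no_atom0).
  rewrite [in RHS](negligible_integral measurable_set0_rV measurableT fi r_no_atom0).
  by rewrite setTD.
have i1 : cintegrable r setT (fun _ : vec => 1 : C).
  split; exact: finite_measure_integrable_cst.
rewrite E; last by apply: cintegrableB => //; exact: cintegrable_jump.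
rewrite cintegralB //; last exact: cintegrable_jump.
congr (_ - _); rewrite (cintegral_real r (fun=> 1)) Rintegral_cst // mul1r.
by congr (_%:C); exact: (congr1 fine (@probability_setT _ _ _ r)).
Qed.

(** The Levy-Ito decomposition at a fixed time: a drift, independent normal variables
    along the vectors whose squares add up to [D], and a compound Poisson variable.
    It is the law of minus the increment over time [t]. *)
Lemma is_mgf_levy (t : R) : 0 <= t -> is_mgf (fun w => cexp (t%:C * levy_char a D z r w)).
Proof.
move=> t0.
have [bs Hbs] := cquad_sum_squares D_psd.
have h1 := is_mgf_cst (- t *: a).
have h2 := is_mgf_prod bs (fun b => is_mgf_gauss (Num.sqrt (2 * t) *: b)).
have h3 := is_mgf_poisson (mulr_ge0 t0 z_ge0) (is_mgf_opp r_compact).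
have := is_mgfM (is_mgfM h1 h2) h3; congr is_mgf; apply/funext => w.
rewrite levy_charE [in RHS]mulrDr [in RHS]mulrDr !cexpD; congr (_ * _ * _).
- by rewrite /lexp cvecZ dotZr rcN mulrN mulNr.
- rewrite -cexp_sum Hbs mulr_sumr; congr cexp; apply: eq_bigr => b _.
  rewrite cvecZ dotZr exprMn -rcX sqr_sqrtr ?mulr_ge0 // rcM rc_nat.
  by move: (dot _ _ ^+ 2) (t%:C) => p q; field.
- by rewrite rcM mulrA.
Qed.

End levy.

(** * Characteristic functions *)

Lemma integrable_one d (T : measurableType d) (R : realType) (mu : probability T R) :
  mu.-integrable setT (EFin \o (fun=> 1 : R)).
Proof. exact: finite_measure_integrable_cst. Qed.

Lemma Rintegral_one d (T : measurableType d) (R : realType) (mu : probability T R) :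
  \int[mu]_x (1 : R) = 1.
Proof.
by rewrite /Rintegral integral_cst // mul1e; exact: (congr1 fine (@probability_setT _ _ _ mu)).
Qed.

Section exponential_moments.
Context {R : realType} {n : nat}.
Local Notation C := R[i].
Local Notation vec := 'rV[R]_n.
Implicit Types (mu : probability vec R) (M : 'rV[C]_n -> C).

Lemma integrable_sumR d (T : measurableType d) (m : {measure set T -> \bar R})
    (I : Type) (s : seq I) (F : I -> T -> R) :
  (forall i, m.-integrable setT (EFin \o F i)) ->
  m.-integrable setT (EFin \o (fun x => \sum_(i <- s) F i x)).
Proof.
move=> iF; elim: s => [|i s ih].
  by rewrite (_ : _ \o _ = cst 0%E); [exact: integrable0|apply/funext => x /=; rewrite big_nil].
rewrite (_ : _ \o _ = EFin \o (fun x => F i x + \sum_(j <- s) F j x)).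
  exact: integrableDR.
by apply/funext => x /=; rewrite big_cons.
Qed.

(** The exponential of the l^1 norm is at most the sum of the exponentials of the
    linear forms with coefficients [b] and [- b]. *)
Lemma integrable_expR_pnorm1 mu (b : R) : 0 <= b -> expmoments mu ->
  mu.-integrable setT (EFin \o (fun x => expR (b * norm1 x))).
Proof.
move=> b0 em.
pose v (f : {ffun 'I_n -> bool}) : vec := \row_k (if f k then b else - b).
have I := integrable_sumR (index_enum {ffun 'I_n -> bool}) (fun f => em (v f)).
apply: integrable_dom I.
  apply: measurableT_comp => //; apply: measurable_funM => //; exact: measurable_norm1.
move=> x; rewrite ger0_norm ?expR_ge0 //.
have -> : \sum_f expR (dot (v f) x) = \prod_(k < n) \sum_(s : bool) expR ((if s then b else - b) * x ord0 k).
  rewrite bigA_distr_bigA /=; apply: eq_bigr => f _.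
  by rewrite /dot expR_sum; apply: eq_bigr => k _; rewrite mxE.
rewrite /norm1 mulr_sumr expR_sum; apply: ler_prod => k _; rewrite expR_ge0 /=.
rewrite big_bool /=; have [x0|x0] := leP 0 (x ord0 k).
  by rewrite (ger0_norm x0) lerDl expR_ge0.
by rewrite (ltr0_norm x0) mulrN mulNr lerDr expR_ge0.
Qed.

(** The plane wave in the inverse Fourier transform. *)
Definition wave (xi x : vec) : C := cexp (- 'i * (dot xi x)%:C).

Lemma cn_wave xi x : cn (wave xi x) = 1.
Proof. exact: cn_cexp_Ni. Qed.

Lemma lexp_wave (xi x : vec) : lexp (- 'i *: cvec xi) x = wave xi x.
Proof. by rewrite /lexp dotZl dot_cvec. Qed.

Lemma cmeas_wave2 : cmeas (fun p : vec * vec => wave p.1 p.2).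
Proof.
apply: cmeas_cexp; apply: cmeasZ; apply: cmeas_real.
by apply: measurable_dot; [exact: measurable_fst|exact: measurable_snd].
Qed.

Lemma waveDr xi x y : wave xi (x + y) = wave xi x * wave xi y.
Proof. by rewrite /wave -cexpD dotDr rcD mulrDr. Qed.

Lemma cmeas_wave_l x : cmeas (wave^~ x).
Proof.
apply: cmeas_cexp; apply: cmeasZ; apply: cmeas_real.
by apply: measurable_dot; [exact: measurable_id|exact: measurable_cst].
Qed.

Lemma measurable_rVDD d (T : measurableType d) (f g : T -> vec) :
  measurable_fun setT f -> measurable_fun setT g ->
  measurable_fun setT (fun x => f x + g x).
Proof.
move=> mf mg; apply: measurable_fun_rV => i.
rewrite (_ : (fun _ => _) = fun x => f x ord0 i + g x ord0 i); last by apply/funext => x; rewrite mxE.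
apply: measurable_funD.
  exact: (measurableT_comp (measurable_coord i) mf).
exact: (measurableT_comp (measurable_coord i) mg).
Qed.

Lemma cmeas_wave_shift phi : cmeas (fun p : vec * vec => wave p.1 (phi + p.2)).
Proof.
apply: cmeas_cexp; apply: cmeasZ; apply: cmeas_real.
apply: measurable_dot; first exact: measurable_fst.
by apply: measurable_rVDD; [exact: measurable_cst|exact: measurable_snd].
Qed.

Lemma cintegrable_wave mu xi : cintegrable mu setT (wave xi).
Proof.
apply: (@cintegrable_dom _ _ _ _ _ (fun=> 1)).
- exact: cmeas_wave.
- by move=> x; rewrite cn_wave.
- exact: finite_measure_integrable_cst.
Qed.

Lemma mgf_wave mu M xi : has_mgf mu M ->
  M (- 'i *: cvec xi) = cintegral mu setT (wave xi).
Proof.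
by move=> [_ <-]; congr cintegral; apply/funext => x; exact: lexp_wave.
Qed.

Lemma cn_mgf_wave M xi : is_mgf M -> cn (M (- 'i *: cvec xi)) <= 1.
Proof.
move=> [mu hM]; rewrite (mgf_wave xi hM) -[leRHS](Rintegral_one mu).
apply: cn_cintegral; last exact: integrable_one.
  exact: cmeas_wave.
by move=> x; rewrite cn_wave.
Qed.

(** Measurability of a parametric integral comes with Fubini's theorem; the damping
    factor [expR (- norm1 xi)], removed afterwards, makes Lebesgue measure in [xi]
    admissible there. *)
Lemma cmeas_mgf_wave M : is_mgf M -> cmeas (fun xi : vec => M (- 'i *: cvec xi)).
Proof.
move=> [mu hM].
pose F (p : vec * vec) := (expR (- (1 * norm1 p.1)))%:C * wave p.1 p.2.
have mF : cmeas F.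
  apply: cmeasM; last exact: cmeas_wave2.
  apply: cmeas_real; apply: measurableT_comp => //; apply: measurableT_comp => //.
  apply: measurable_funM => //; exact: (measurableT_comp (@measurable_norm1 R n) measurable_fst).
have bF x y : cn (F (x, y)) <= expR (- (1 * norm1 x)) * 1.
  by rewrite cnM cn_wave cn_real ger0_norm ?expR_ge0.
have [m1 _ _ _] := cfubini_dom (fun x => expR_ge0 _) (fun _ : vec => ler01)
  (integrable_expR_norm1 n ltr01) (integrable_one mu) mF bF.
have mE : cmeas (fun x : vec => (expR (norm1 x))%:C).
  by apply: cmeas_real; apply: measurableT_comp => //; exact: measurable_norm1.
have := cmeasM mE m1; congr cmeas; apply/funext => xi.
transitivity ((expR (norm1 xi))%:C * ((expR (- (1 * norm1 xi)))%:C * cintegral mu setT (wave xi))); last first.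
  by rewrite mulrA -rcM -expRD mul1r subrr expR0 mul1r (mgf_wave xi hM).
congr (_ * _); rewrite -cintegralZ //.
  have := expmoments_cintegrable (- 'i *: cvec xi) hM.1.
  by congr cintegrable; apply/funext => x; rewrite lexp_wave.
Qed.

End exponential_moments.

(** * The evolved Gaussian as an expectation *)

Section evolution.
Context {R : realType} {n : nat}.
Local Notation C := R[i].
Local Notation vec := 'rV[R]_n.
Local Notation Re := (@complex.Re R).
Local Notation Im := (@complex.Im R).
Variables (a : vec) (D : 'M[R]_n) (z : R) (r : probability vec R).
Hypotheses (D_psd : forall x : vec, 0 <= dot x (x *m D^T)) (z_ge0 : 0 <= z)
  (r_no_atom0 : r [set 0] = 0%E) (r_compact : compact (supp r)).
Local Notation Psi := (levy_char a D z r).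

Definition symbol (xi : vec) : C := Psi (- 'i *: cvec xi).
Definition propagator (s : R) (xi : vec) : C := cexp (s%:C * symbol xi).

(** A characteristic function has modulus at most 1. *)
Lemma cn_propagator s xi : 0 <= s -> cn (propagator s xi) <= 1.
Proof.
move=> s0; exact: (cn_mgf_wave xi (is_mgf_levy a D_psd z_ge0 r_no_atom0 r_compact s0)).
Qed.

Lemma cmeas_propagator s : 0 <= s -> cmeas (propagator s).
Proof.
move=> s0; exact: (cmeas_mgf_wave (is_mgf_levy a D_psd z_ge0 r_no_atom0 r_compact s0)).
Qed.

Lemma symbolE xi : symbol xi =
  'i * (dot xi a)%:C - (quad_form D xi)%:C + z%:C * (jump_mgf r (- 'i *: cvec xi) - 1).
Proof.
rewrite /symbol levy_charE // dotZl dot_cvec mulNr opprK; congr (_ + _ + _).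
rewrite /cquad -scalemxAl dotZl dotZr mulrA mulrNN -expr2 sqr_i mulN1r; congr (- _).
rewrite -quad_formE -dot_cvec; congr (dot _ _).
apply/rowP => k; rewrite !mxE rc_sum; apply: eq_bigr => j _.
by rewrite !mxE rcM.
Qed.

Lemma cmeas_symbol : cmeas symbol.
Proof.
rewrite (_ : symbol = fun xi => 'i * (dot xi a)%:C - (quad_form D xi)%:C + z%:C * (jump_mgf r (- 'i *: cvec xi) - 1)).
  apply: cmeasD; first apply: cmeasB.
  - by apply: cmeasZ; apply: cmeas_real; exact: measurable_dot.
  - by apply: cmeas_real; exact: measurable_quad_form.
  - apply: cmeasZ; apply: cmeasB; last exact: cmeas_cst.
    exact: (cmeas_mgf_wave (is_mgf_opp r_compact)).
by apply/funext => xi; rewrite symbolE.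
Qed.

Lemma quad_form_le (S : 'M[R]_n) : exists K : R, 0 <= K /\ forall x, `|quad_form S x| <= K * norm1 x ^+ 2.
Proof.
exists (\sum_i \sum_j `|S i j|); split.
  by apply: sumr_ge0 => i _; apply: sumr_ge0.
move=> x; rewrite /quad_form mulr_suml; apply: le_trans (ler_norm_sum _ _ _) _.
apply: ler_sum => i _; rewrite mulr_suml; apply: le_trans (ler_norm_sum _ _ _) _.
apply: ler_sum => j _; rewrite !normrM -mulrA ler_wpM2l // expr2.
by apply: ler_pM => //; exact: coord_le_norm1.
Qed.

Lemma symbol_le : exists K : R, 0 <= K /\ forall xi, cn (symbol xi) <= K * (1 + norm1 xi) ^+ 2.
Proof.
have [L [L0 HL]] := quad_form_le D.
exists (norm1 a + L + 2 * z); split.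
  by rewrite !addr_ge0 ?mulr_ge0 ?norm1_ge0.
move=> xi; rewrite symbolE; apply: le_trans (cnD _ _) _.
apply: le_trans (lerD (cnB _ _) (lexx _)) _.
have h0 := norm1_ge0 xi.
have h1 : cn ('i * (dot xi a)%:C) <= norm1 a * (1 + norm1 xi) ^+ 2.
  rewrite cnM cn_i mul1r cn_real; apply: le_trans (dot_le_norm1 _ _) _.
  by rewrite mulrC ler_wpM2l ?norm1_ge0 //; nra.
have h2 : cn (quad_form D xi)%:C <= L * (1 + norm1 xi) ^+ 2.
  by rewrite cn_real; apply: le_trans (HL xi) _; rewrite ler_wpM2l //; nra.
have h3 : cn (z%:C * (jump_mgf r (- 'i *: cvec xi) - 1)) <= 2 * z * (1 + norm1 xi) ^+ 2.
  rewrite cnM cn_real ger0_norm //.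
  have h4 := cn_mgf_wave xi (is_mgf_opp r_compact).
  have h5 : cn (jump_mgf r (- 'i *: cvec xi) - 1) <= 2.
    by apply: le_trans (cnB _ _) _; rewrite cn1; move: h4; rewrite -/(jump_mgf r _); lra.
  apply: (@le_trans _ _ (z * 2)); first by rewrite ler_wpM2l.
  by rewrite [2 * z]mulrC ler_peMr ?mulr_ge0 //; nra.
rewrite [leRHS]mulrDl [X in _ <= X + _]mulrDl; apply: lerD => //; exact: lerD.
Qed.

Section initial_datum.
Variables (lam : 'M[R]_n) (zeta : C).
Hypotheses (lam_sym : lam^T = lam)
  (lam_posdef : forall x : vec, x != 0 -> 0 < quad_form lam x) (zeta_gt0 : 0 < Re zeta).
Local Notation G := (gaussian zeta lam).

Let eG : edecay G. Proof. by have [] := gaussian_fourier zeta_gt0 lam_sym lam_posdef. Qed.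
Let mG : cmeas G. Proof. exact: cmeas_gaussian. Qed.
Let mF : cmeas (fourier G). Proof. by have [] := gaussian_fourier zeta_gt0 lam_sym lam_posdef. Qed.
Let eF : edecay (fourier G). Proof. by have [] := gaussian_fourier zeta_gt0 lam_sym lam_posdef. Qed.

Let c : C := ((2 * pi) ^- n)%:C.

Let c_inv : c * ((2 * pi) ^+ n)%:C = 1.
Proof.
rewrite /c -rcM mulVf // expf_neq0 // mulf_neq0 //; exact: lt0r_neq0 (pi_gt0 _).
Qed.

Lemma inv_fourier_gaussian x : inv_fourier (fourier G) x = G x.
Proof.
have [_ _ _ inv] := gaussian_fourier zeta_gt0 lam_sym lam_posdef.
by rewrite /inv_fourier inv mulrA c_inv mul1r.
Qed.

(** The translated and reflected Gaussian in the definition of the convolution turns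
    the inverse transform into the direct one. *)
Lemma inv_fourier_translate phi xi :
  inv_fourier (fun psi => G (phi - psi)) xi = c * (fourier G xi * wave xi phi).
Proof.
rewrite /inv_fourier; congr (_ * _).
pose k (x : vec) := G x * cexp ('i * (dot xi x)%:C).
have [mk ek ik] := cintegrable_fourier xi mG eG cn_cexp_i.
have mk' : cmeas (fun x : vec => k (x + phi)) by exact: (cmeas_comp mk (measurable_rVD phi)).
have ek' : edecay (fun x : vec => k (x + phi)) by exact: (edecay_shift phi ek).
transitivity (cintegral (lebesgue_rV n) setT (fun x => k (- x + phi) * wave xi phi)).
  congr cintegral; apply/funext => x; rewrite /k /wave addrC -mulrA -cexpD; congr (_ * cexp _).
  by rewrite dotDr dotNr dotC rcD rcN; move: (_%:C) (_%:C) => p q; ring.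
rewrite cintegralZr; last first.
  apply: edecay_integrable; last exact: (edecay_opp ek').
  exact: (cmeas_comp mk' (@measurable_rVN R n)).
congr (_ * _).
rewrite (cintegral_opp mk' ek') (cintegral_shift phi mk ek).
by [].
Qed.

Lemma Phi_inv_fourier s phi : 0 <= s ->
  Phi Psi lam zeta s phi = inv_fourier (fun xi => propagator s xi * fourier G xi) phi.
Proof.
move=> s0; rewrite /Phi /dist_convolution /nu /dist_inv_fourier /regular_distribution.
rewrite [RHS]/inv_fourier -/c.
transitivity (cintegral (lebesgue_rV n) setT (fun xi => c * (propagator s xi * fourier G xi * wave xi phi))).
  congr cintegral; apply/funext => xi; rewrite inv_fourier_translate /propagator /symbol.
  by rewrite mulrCA !mulrA.
rewrite cintegralZ // .
have mhF : cmeas (fun xi => propagator s xi * fourier G xi) by exact: cmeasM (cmeas_propagator s0) mF.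
have ehF : edecay (fun xi => propagator s xi * fourier G xi).
  apply: (edecay_le eF) => xi; rewrite cnM; apply: ler_piMl (cn_propagator xi s0); exact: cn_ge0.
have ewF : edecay (fun xi => propagator s xi * fourier G xi * wave xi phi).
  by apply: (edecay_le ehF) => xi; rewrite cnM cn_wave mulr1.
apply: (edecay_integrable _ ewF); apply: (cmeasM mhF); exact: cmeas_wave_l.
Qed.

Lemma cn_gaussian_le1 x : cn (G x) <= 1.
Proof.
rewrite cn_cexp -expR0 ler_expR.
rewrite Re_mul Re_opp /= mulr0 subr0 mulNr oppr_le0 mulr_ge0 //; first exact: ltW.
have [->|x0] := eqVneq x 0; last exact: ltW (lam_posdef x0).
by rewrite /quad_form big1 // => i _; rewrite big1 // => j _; rewrite !mxE mulr0.
Qed.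

Lemma cintegrable_gaussian_shift (mu : probability vec R) phi :
  cintegrable mu setT (fun x => G (phi + x)).
Proof.
apply: (@cintegrable_dom _ _ _ _ _ (fun=> 1)).
- apply: (cmeas_comp mG).
  by apply: measurable_rVDD; [exact: measurable_cst|exact: measurable_id].
- by move=> x; exact: cn_gaussian_le1.
- exact: finite_measure_integrable_cst.
Qed.

(** The propagator is the characteristic function of [mu], so that by Fubini's theorem
    multiplication by it averages the inverse transform over translations by [mu]. *)
Lemma Phi_expectation s phi (mu : probability vec R) : 0 <= s ->
  has_mgf mu (fun w => cexp (s%:C * Psi w)) ->
  Phi Psi lam zeta s phi = cintegral mu setT (fun x => G (phi + x)).
Proof.
move=> s0 hM; rewrite Phi_inv_fourier // /inv_fourier -/c.
have [A [b [A0 b0 HF]]] := eF.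
pose K (p : vec * vec) := fourier G p.1 * wave p.1 (phi + p.2).
have mK : cmeas K.
  apply: cmeasM; first exact: (cmeas_comp mF measurable_fst).
  exact: cmeas_wave_shift.
have bK x y : cn (K (x, y)) <= A * expR (- (b * norm1 x)) * 1.
  by rewrite cnM cn_wave !mulr1.
have gK (x : vec) : 0 <= A * expR (- (b * norm1 x)) by rewrite mulr_ge0 ?expR_ge0.
have [_ mI _ E1] := cfubini_dom gK (fun _ : vec => ler01)
  (integrableZR A (integrable_expR_norm1 n b0)) (integrable_one mu) mK bK.
have [_ _ E2 _] := cfubini_dom gK (fun _ : vec => ler01)
  (integrableZR A (integrable_expR_norm1 n b0)) (integrable_one mu) mK bK.
transitivity (c * cintegral (lebesgue_rV n) setT (fun x => cintegral mu setT (fun y => K (x, y)))).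
  congr (_ * _); congr cintegral; apply/funext => xi.
  rewrite /propagator (mgf_wave xi hM) -/(wave xi phi).
  rewrite -mulrA mulrC -cintegralZ; last exact: cintegrable_wave.
  congr cintegral; apply/funext => x.
  by rewrite /K /= -mulrA waveDr.
rewrite -E2 E1 -cintegralZ; last first.
  apply: (@cintegrable_dom _ _ _ _ _ (fun=> \int[lebesgue_rV n]_x (A * expR (- (b * norm1 x))))) => //; last exact: finite_measure_integrable_cst.
  move=> x; apply: cn_cintegral.
  - exact: (cmeasM mF (cmeas_wave_l (phi + x))).
  - by move=> xi; have := bK xi x; rewrite mulr1.
  - exact: (integrableZR A (integrable_expR_norm1 n b0)).
by congr cintegral; apply/funext => x; rewrite -(inv_fourier_gaussian (phi + x)).
Qed.

(** Fubini's theorem and translation invariance applied to [Phi_expectation]. The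
    translates of [G] are dominated because [mu] has exponential moments. *)
Lemma fourier_Phi s xi : 0 <= s ->
  fourier (Phi Psi lam zeta s) xi = propagator s xi * fourier G xi.
Proof.
move=> s0; have [mu hM] := is_mgf_levy a D_psd z_ge0 r_no_atom0 r_compact s0.
have [A [b [A0 b0 HG]]] := eG.
pose k (x : vec) := G x * cexp ('i * (dot xi x)%:C).
have [mk ek ik] := cintegrable_fourier xi mG eG cn_cexp_i.
pose K (p : vec * vec) := G (p.1 + p.2) * cexp ('i * (dot xi p.1)%:C).
have mK : cmeas K.
  apply: cmeasM.
    apply: (cmeas_comp mG).
    by apply: measurable_rVDD; [exact: measurable_fst|exact: measurable_snd].
  apply: cmeas_cexp; apply: cmeasZ; apply: cmeas_real; apply: measurable_dot; [exact: measurable_cst|exact: measurable_fst].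
have bK x y : cn (K (x, y)) <= A * expR (- (b * norm1 x)) * expR (b * norm1 y).
  rewrite cnM cn_cexp_i mulr1; apply: le_trans (HG _) _; rewrite -mulrA ler_wpM2l // -expRD ler_expR.
  have := norm1D (x + y) (- y); rewrite addrK norm1N => h.
  by have := ler_wpM2l (ltW b0) h; rewrite mulrDr; lra.
have gK (x : vec) : 0 <= A * expR (- (b * norm1 x)) by rewrite mulr_ge0 ?expR_ge0.
have [_ _ E1 E2] := cfubini_dom gK (fun y => expR_ge0 (b * norm1 y))
  (integrableZR A (integrable_expR_norm1 n b0)) (integrable_expR_pnorm1 (ltW b0) hM.1) mK bK.
transitivity (cintegral (lebesgue_rV n) setT (fun x => cintegral mu setT (fun y => K (x, y)))).
  rewrite fourierE; congr cintegral; apply/funext => x.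
  rewrite (Phi_expectation x s0 hM) -cintegralZr //.
  exact: cintegrable_gaussian_shift.
rewrite -E1 E2 /propagator (mgf_wave xi hM) -cintegralZr; last exact: cintegrable_wave.
congr cintegral; apply/funext => y.
transitivity (cintegral (lebesgue_rV n) setT (fun x => wave xi y * k (x + y))).
  congr cintegral; apply/funext => x; rewrite /K /k /= mulrCA; congr (_ * _).
  rewrite /wave -cexpD; congr cexp; rewrite dotDr rcD.
  by move: (_%:C) (_%:C) => p q; ring.
rewrite cintegralZ; last first.
  apply: edecay_integrable; last exact: edecay_shift.
  exact: (cmeas_comp mk (measurable_rVD y)).
by rewrite (cintegral_shift y mk ek).
Qed.

End initial_datum.
End evolution.

(** * The Cauchy problem *)

(** Half of the exponential decay is spent on the polynomial factor. *)
Lemma edecay_poly (R : realType) n (f : 'rV[R]_n -> R[i]) (k : nat) (K : R) (g : 'rV[R]_n -> R[i]) :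
  0 <= K -> edecay f -> (forall x, cn (g x) <= K * (1 + norm1 x) ^+ k * cn (f x)) ->
  edecay g.
Proof.
move=> K0 [A [b [A0 b0 Hf]]] Hg.
have c0 : 0 < b / 2 by rewrite divr_gt0.
exists (K * (k`!%:R * (b / 2) ^- k * expR (b / 2)) * A), (b / 2); split => //.
  by rewrite !mulr_ge0 ?expR_ge0 // invr_ge0 exprn_ge0 // ltW.
move=> x; apply: le_trans (Hg x) _.
have u0 := norm1_ge0 x.
have H1 : (1 + norm1 x) ^+ k <= k`!%:R * (b / 2) ^- k * expR (b / 2) * expR (b / 2 * norm1 x).
  have h : 0 <= b / 2 * (1 + norm1 x) by rewrite mulr_ge0 ?addr_ge0 // ltW.
  have := expn_le_expR k h; rewrite exprMn mulrDr mulr1 expRD mulrA => h'.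
  have -> : k`!%:R / (b / 2) ^+ k * expR (b / 2) * expR (b / 2 * norm1 x) =
    k`!%:R * expR (b / 2) * expR (b / 2 * norm1 x) / (b / 2) ^+ k by move: (k`!%:R) (expR (b / 2)) (expR (b / 2 * norm1 x)) ((b / 2) ^- k) => p q u v; ring.
  by rewrite ler_pdivlMr ?exprn_gt0 // mulrC.
apply: (@le_trans _ _ (K * (k`!%:R * (b / 2) ^- k * expR (b / 2) * expR (b / 2 * norm1 x)) * (A * expR (- (b * norm1 x))))).
  apply: ler_pM; rewrite ?cn_ge0 //.
    by rewrite mulr_ge0 // exprn_ge0 // addr_ge0.
  by rewrite ler_wpM2l.
have -> : expR (- (b / 2 * norm1 x)) = expR (b / 2 * norm1 x) * expR (- (b * norm1 x)).
  by rewrite -expRD; congr expR; lra.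
rewrite le_eqVlt; apply/orP; left; apply/eqP.
move: (expR (b / 2)) (expR (b / 2 * norm1 x)) (expR (- (b * norm1 x))) ((b / 2) ^- k) (k`!%:R) => p q u v w; ring.
Qed.

Lemma cexp_increment2 (R : realType) (y : R[i]) : complex.Re y <= 0 ->
  cn (cexp y - 1 - y) <= cn y ^+ 2.
Proof.
move=> y0; have := cexp_taylor 2 y.
rewrite big_ord_recr /= big_ord1 expr0 fact0 expr1 divr1 divr1 opprD addrA => h.
apply: le_trans h _; rewrite max_l; last by rewrite -expR0 ler_expR.
rewrite mulr1 ler_pdivrMr ?ltr0n // ler_peMr ?exprn_ge0 ?cn_ge0 //.
by rewrite ler1n.
Qed.

Lemma cexp_increment1 (R : realType) (y : R[i]) : complex.Re y <= 0 ->
  cn (cexp y - 1) <= cn y.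
Proof.
move=> y0; have := cexp_taylor 1 y.
rewrite big_ord1 expr0 fact0 divr1 expr1 divr1 => h.
apply: le_trans h _; rewrite max_l; last by rewrite -expR0 ler_expR.
by rewrite mulr1.
Qed.

(** The larger of the two times is expanded around the smaller one, so that only
    exponentials of modulus at most 1 occur. *)
Lemma cexp_increment (R : realType) (p : R[i]) (s t : R) : complex.Re p <= 0 -> 0 <= s -> 0 <= t ->
  cn (cexp (s%:C * p) - cexp (t%:C * p) - (s - t)%:C * (p * cexp (t%:C * p)))
    <= 2 * (s - t) ^+ 2 * cn p ^+ 2.
Proof.
move=> p0 s0 t0.
have le1 u : 0 <= u -> cn (cexp (u%:C * p)) <= 1.
  by move=> u0; rewrite cn_cexp -expR0 ler_expR Re_scale mulr_ge0_le0.
have Rn u : 0 <= u -> complex.Re (u%:C * p) <= 0 by move=> u0; rewrite Re_scale mulr_ge0_le0.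
have [ts|st] := leP t s.
  have v0 : 0 <= s - t by rewrite subr_ge0.
  have -> : s%:C * p = t%:C * p + (s - t)%:C * p by rewrite rcB; move: s%:C t%:C => u v; ring.
  rewrite cexpD.
  have := cexp_increment2 (Rn _ v0); have := le1 _ t0.
  have -> : 2 * (s - t) ^+ 2 * cn p ^+ 2 = 2 * cn ((s - t)%:C * p) ^+ 2.
    by rewrite cnM cn_real exprMn real_normK ?num_real // -mulrA.
  move: (cexp (t%:C * p)) => e; move: (_%:C) => v.
  have -> : e * cexp (v * p) - e - v * (p * e) = e * (cexp (v * p) - 1 - v * p) by move: (cexp _) => E; ring.
  move=> e1 h; rewrite cnM.
  apply: (@le_trans _ _ (1 * cn (v * p) ^+ 2)).
    by apply: ler_pM => //; exact: cn_ge0.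
  by rewrite mul1r ler_peMl ?ler1n // exprn_ge0 // cn_ge0.
have v0 : 0 <= t - s by rewrite subr_ge0 ltW.
have -> : t%:C * p = s%:C * p + (t - s)%:C * p by rewrite rcB; move: s%:C t%:C => u v; ring.
rewrite cexpD -(opprB t s) rcN.
have := cexp_increment2 (Rn _ v0); have := cexp_increment1 (Rn _ v0); have := le1 _ s0.
move: (cexp (s%:C * p)) => e; rewrite sqrrN.
have -> : e - e * cexp ((t - s)%:C * p) - - (t - s)%:C * (p * (e * cexp ((t - s)%:C * p))) =
  e * (((t - s)%:C * p) * (cexp ((t - s)%:C * p) - 1) - (cexp ((t - s)%:C * p) - 1 - (t - s)%:C * p)).
  by move: (_%:C) => v; move: (cexp _) => E; ring.
have -> : 2 * (t - s) ^+ 2 * cn p ^+ 2 = 2 * cn ((t - s)%:C * p) ^+ 2.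
  by rewrite cnM cn_real exprMn real_normK ?num_real // -mulrA.
move: (_%:C * p) => y e1 h1 h2.
rewrite cnM; apply: (@le_trans _ _ (1 * (cn y * cn y + cn y ^+ 2))); last by rewrite mul1r -expr2; lra.
apply: ler_pM => //; rewrite ?cn_ge0 //; apply: le_trans (cnB _ _) _.
apply: lerD => //; rewrite cnM; apply: ler_pM => //; exact: cn_ge0.
Qed.

Lemma cvg_at_right0 (R : realType) (f : R -> R) (l p K : R) : 0 <= p -> 0 <= K ->
  (forall s, 0 < s -> `|f s - l| <= (p + K * s) * s) -> f s @[s --> 0^'+] --> l.
Proof.
move=> p0 K0 H; apply/cvgrPdist_le => eps eps0.
have q0 : 0 < p + K + 1 by lra.
near=> s; have s0 : 0 < s by near: s; exact: nbhs_right_gt.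
have s1 : s <= 1 by near: s; exact: nbhs_right_le.
have s2 : s <= eps / (p + K + 1) by near: s; apply: nbhs_right_le; rewrite divr_gt0.
rewrite distrC; apply: le_trans (H s s0) _.
move: s2; rewrite ler_pdivlMr // => s2.
have hh : K * s <= K by rewrite ler_piMr.
rewrite mulrC; apply: le_trans s2; rewrite ler_wpM2l ?ltW //; lra.
Unshelve. all: by end_near.
Qed.

Section cauchy.
Context {R : realType} {n : nat}.
Local Notation C := R[i].
Local Notation vec := 'rV[R]_n.
Local Notation Re := (@complex.Re R).
Local Notation Im := (@complex.Im R).
Variables (a : vec) (D : 'M[R]_n) (z : R) (r : probability vec R).
Hypotheses (D_psd : forall x : vec, 0 <= dot x (x *m D^T)) (z_ge0 : 0 <= z)
  (r_no_atom0 : r [set 0] = 0%E) (r_compact : compact (supp r)).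
Local Notation Psi := (levy_char a D z r).
Local Notation symb := (symbol a D z r).
Local Notation prop := (propagator a D z r).
Variables (lam : 'M[R]_n) (zeta : C).
Hypotheses (lam_sym : lam^T = lam)
  (lam_posdef : forall x : vec, x != 0 -> 0 < quad_form lam x) (zeta_gt0 : 0 < Re zeta).
Local Notation G := (gaussian zeta lam).
Local Notation F := (fourier G).
Local Notation U := (Phi Psi lam zeta).

Let mF : cmeas F. Proof. by have [] := gaussian_fourier zeta_gt0 lam_sym lam_posdef. Qed.
Let eF : edecay F. Proof. by have [] := gaussian_fourier zeta_gt0 lam_sym lam_posdef. Qed.

Let c : C := ((2 * pi) ^- n)%:C.

Lemma Re_symbol_le0 xi : Re (symb xi) <= 0.
Proof.
have := cn_propagator a D_psd z_ge0 r_no_atom0 r_compact xi ler01.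
by rewrite /propagator cn_cexp Re_scale mul1r -expR0 ler_expR.
Qed.

(** The symbol grows at most quadratically and [F] decays exponentially. *)
Lemma integrable_symbolX k :
  (lebesgue_rV n).-integrable setT (EFin \o (fun xi => cn (symb xi) ^+ k * cn (F xi))).
Proof.
have [K [K0 HK]] := symbol_le a D z_ge0 r_no_atom0 r_compact.
have ef : edecay (fun xi => symb xi ^+ k * F xi).
  apply: (edecay_poly (K := K ^+ k) (k := 2 * k) _ eF); first exact: exprn_ge0.
  move=> xi; rewrite cnM cnX ler_wpM2r ?cn_ge0 // exprM -exprMn.
  by apply: lerXn2r => //; rewrite nnegrE ?cn_ge0 // mulr_ge0 // exprn_ge0 // addr_ge0 // norm1_ge0.
have mf : cmeas (fun xi => symb xi ^+ k * F xi).
  by apply: cmeasM mF; apply: cmeasX; exact: (cmeas_symbol a D z r_no_atom0 r_compact).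
have := cintegrable_cn (edecay_integrable mf ef).
by congr (_.-integrable _ _); apply/funext => xi /=; rewrite cnM cnX.
Qed.

(** The pointwise estimate [cexp_increment] integrated against [F]: a first order
    expansion in time, uniform up to time 0. *)
Lemma Phi_increment phi : exists K : R, 0 <= K /\ forall s t, 0 <= s -> 0 <= t ->
  cn (U s phi - U t phi - (s - t)%:C * pseudo_diff Psi (U t) phi) <= K * (s - t) ^+ 2.
Proof.
have iB := integrable_symbolX 2.
have iF := integrable_symbolX 0.
have iF1 := integrable_symbolX 1.
have mS : cmeas symb by exact: (cmeas_symbol a D z r_no_atom0 r_compact).
pose B xi := cn (symb xi) ^+ 2 * cn (F xi).
exists (cn c * (2 * \int[lebesgue_rV n]_xi B xi)); split.
  rewrite !mulr_ge0 ?cn_ge0 //; apply: Rintegral_ge0 => xi _.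
  by rewrite mulr_ge0 ?cn_ge0 // exprn_ge0 // cn_ge0.
move=> s t s0 t0.
have mp u : 0 <= u -> cmeas (fun xi => prop u xi * F xi * wave xi phi).
  move=> u0; apply: cmeasM (cmeas_wave_l phi).
  exact: cmeasM (cmeas_propagator a D_psd z_ge0 r_no_atom0 r_compact u0) mF.
have ip u : 0 <= u -> cintegrable (lebesgue_rV n) setT (fun xi => prop u xi * F xi * wave xi phi).
  move=> u0; apply: (cintegrable_dom (mp u u0) _ iF) => xi.
  rewrite expr0 mul1r cnM cn_wave mulr1 cnM; apply: ler_piMl; first exact: cn_ge0.
  exact: (cn_propagator a D_psd z_ge0 r_no_atom0 r_compact xi u0).
have mq : cmeas (fun xi => symb xi * (prop t xi * F xi) * wave xi phi).
  apply: cmeasM (cmeas_wave_l phi); apply: cmeasM mS _.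
  exact: cmeasM (cmeas_propagator a D_psd z_ge0 r_no_atom0 r_compact t0) mF.
have iq : cintegrable (lebesgue_rV n) setT (fun xi => symb xi * (prop t xi * F xi) * wave xi phi).
  apply: (cintegrable_dom mq _ iF1) => xi.
  rewrite expr1 cnM cn_wave mulr1 !cnM ler_wpM2l ?cn_ge0 //; apply: ler_piMl; first exact: cn_ge0.
  exact: (cn_propagator a D_psd z_ge0 r_no_atom0 r_compact xi t0).
have UE u : 0 <= u -> U u phi = c * cintegral (lebesgue_rV n) setT (fun xi => prop u xi * F xi * wave xi phi).
  by move=> u0; rewrite Phi_inv_fourier.
have PE : pseudo_diff Psi (U t) phi = c * cintegral (lebesgue_rV n) setT (fun xi => symb xi * (prop t xi * F xi) * wave xi phi).
  rewrite /pseudo_diff /inv_fourier; congr (_ * _); congr cintegral; apply/funext => xi.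
  by rewrite fourier_Phi.
have -> : U s phi - U t phi - (s - t)%:C * pseudo_diff Psi (U t) phi = c * cintegral (lebesgue_rV n) setT
    (fun xi => prop s xi * F xi * wave xi phi - prop t xi * F xi * wave xi phi
       - (s - t)%:C * (symb xi * (prop t xi * F xi) * wave xi phi)).
  rewrite cintegralB; [|exact: cintegrableB (ip s s0) (ip t t0)|exact: cintegrableZ].
  rewrite cintegralB; [|exact: ip|exact: ip].
  rewrite cintegralZ // PE (UE s s0) (UE t t0).
  by move: (cintegral _ _ _) (cintegral _ _ _) (cintegral _ _ _) (_%:C) => x y w v; rewrite !mulrBr [v * _]mulrCA.
rewrite cnM -mulrA ler_wpM2l ?cn_ge0 //.
rewrite mulrAC -RintegralZl //.
apply: cn_cintegral.
- apply: cmeasB; first exact: cmeasB (mp s s0) (mp t t0).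
  exact: cmeasZ mq.
- move=> xi.
  have -> : prop s xi * F xi * wave xi phi - prop t xi * F xi * wave xi phi
       - (s - t)%:C * (symb xi * (prop t xi * F xi) * wave xi phi)
     = (prop s xi - prop t xi - (s - t)%:C * (symb xi * prop t xi)) * F xi * wave xi phi.
    by move: (prop s xi) (prop t xi) (symb xi) (F xi) (wave xi phi) (_%:C) => p q u v w x; ring.
  rewrite cnM cn_wave mulr1 cnM /B [leRHS]mulrA ler_wpM2r ?cn_ge0 //.
  exact: cexp_increment (Re_symbol_le0 xi) s0 t0.
- exact: integrableZR iB.
Qed.

Lemma Phi_0 phi : U 0 phi = G phi.
Proof.
rewrite Phi_inv_fourier // -inv_fourier_gaussian //.
congr (inv_fourier _ phi); apply/funext => xi.
by rewrite /propagator mul0r cexp0 mul1r.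
Qed.

(** The expansion [Phi_increment] around [t] gives the derivative, and around 0 the
    initial value. *)
Lemma Phi_solves_cauchy : solves_cauchy Psi G U.
Proof.
split; first exact: Phi_0.
- move=> phi; have [K [K0 HK]] := Phi_increment phi.
  pose P := pseudo_diff Psi (U 0) phi.
  have H s : 0 < s -> cn (U s phi - G phi) <= (cn P + K * s) * s.
    move=> s0; have := HK s 0 (ltW s0) (lexx _); rewrite subr0 Phi_0 => h.
    have -> : U s phi - G phi = (U s phi - G phi - s%:C * P) + s%:C * P by rewrite subrK.
    apply: le_trans (cnD _ _) _; rewrite cnM cn_real gtr0_norm //.
    by move: h; rewrite -/P; nra.
  split; apply: (cvg_at_right0 (cn_ge0 P) K0) => s /H; apply: le_trans.
  + by rewrite (_ : _ - _ = Re (U s phi - G phi)) ?Re_le_cn // Re_add Re_opp.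
  + by rewrite (_ : _ - _ = Im (U s phi - G phi)) ?Im_le_cn // Im_add Im_opp.
- move=> t phi t0; have [K [K0 HK]] := Phi_increment phi.
  have H (h : R) : `|h| < t -> cn (U (t + h) phi - U t phi - h%:C * pseudo_diff Psi (U t) phi) <= K * h ^+ 2.
    rewrite ltr_norml => /andP[h1 h2].
    have th0 : 0 <= t + h by lra.
    by have := HK _ t th0 (ltW t0); rewrite (_ : t + h - t = h) //; lra.
  split; apply: (quad_is_derive t0 (K := K)) => h /H; apply: le_trans.
  + rewrite (_ : _ - _ - _ = Re (U (t + h) phi - U t phi - h%:C * pseudo_diff Psi (U t) phi)); first exact: Re_le_cn.
    by rewrite !Re_add !Re_opp Re_scale.
  + rewrite (_ : _ - _ - _ = Im (U (t + h) phi - U t phi - h%:C * pseudo_diff Psi (U t) phi)); first exact: Im_le_cn.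
    by rewrite !Im_add !Im_opp Im_scale.
Qed.

End cauchy.

(** * Moments and exponential moments *)

Section complex_limits.
Context {R : realType}.
Local Notation C := R[i].

Lemma cn_triangle (y x z : C) : cn (x - z) <= cn (x - y) + cn (y - z).
Proof. by rewrite -(subrKA y x (- z)); exact: cnD. Qed.

Lemma cvg_complex (u : nat -> C) (l : C) (v : nat -> R) :
  (forall k, cn (u k - l) <= v k) -> v @ \oo --> (0 : R) -> u @ \oo --> l.
Proof.
move=> uv v0; apply/cvgrPdist_le => e e0.
have eE : e = (complex.Re e)%:C by rewrite RRe_real // gtr0_real.
have e1 : 0 < complex.Re e by move: e0; rewrite ltcE => /andP[].
move/cvgrPdist_le : v0 => /(_ _ e1); apply: filterS => k /=.
rewrite sub0r normrN => h; rewrite cnE eE lecR cn_distC.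
exact: le_trans (uv k) (le_trans (ler_norm _) h).
Qed.

End complex_limits.

Section central_binomial.

Lemma bin2n_le k : ('C(k.*2, k) <= 4 ^ k)%N.
Proof.
have -> : (4 ^ k = (1 + 1) ^ k.*2)%N by rewrite -mul2n expnM.
rewrite expnDn (bigD1 (inord k)) //= inordK; last by rewrite ltnS -addnn leq_addr.
by rewrite !exp1n !muln1 leq_addr.
Qed.

(** The central binomial coefficient is one of the terms of [(1 + 1) ^ (2 k)]. *)
Lemma fact_double_le k : ((k.*2)`! <= 4 ^ k * (k`! * k`!))%N.
Proof.
have h : (k <= k.*2)%N by rewrite -addnn leq_addr.
rewrite -(bin_fact h) -addnn addnK leq_mul2r; apply/orP; right.
by rewrite addnn bin2n_le.
Qed.

(** The inequality [y ^ (2 k) <= (2 k)! e^y] at [y = 4 sqrt x]; the factorial of [2 k]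
    is compared with the square of that of [k], and the excess in [y] produces a
    geometric factor. *)
Lemma pow_fact2_le (R : realType) (x : R) k : 0 <= x ->
  x ^+ k / (k`!%:R ^+ 2) <= 4^-1 ^+ k * expR (4 * Num.sqrt x).
Proof.
move=> x0; have c0 : 0 <= 4 * Num.sqrt x by rewrite mulr_ge0 // sqrtr_ge0.
have h1 := expn_le_expR k.*2 c0.
have h2 : ((k.*2)`!)%:R <= 4 ^+ k * (k`!%:R * k`!%:R) :> R.
  by have := fact_double_le k; rewrite -(ler_nat R) !natrM natrX.
have h3 : x ^+ k = 16^-1 ^+ k * (4 * Num.sqrt x) ^+ k.*2.
  rewrite -addnn exprD -!exprMn; congr (_ ^+ _).
  have -> : 16^-1 * (4 * Num.sqrt x * (4 * Num.sqrt x)) = Num.sqrt x ^+ 2 by field.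
  by rewrite sqr_sqrtr.
rewrite ler_pdivrMr ?exprn_gt0 ?ltr0n ?fact_gt0 // h3.
apply: le_trans (ler_wpM2l _ h1) _; first by rewrite exprn_ge0 // invr_ge0.
apply: (@le_trans _ _ (16^-1 ^+ k * (4 ^+ k * (k`!%:R * k`!%:R) * expR (4 * Num.sqrt x)))).
  apply: ler_wpM2l; first by rewrite exprn_ge0 // invr_ge0.
  by rewrite ler_wpM2r // expR_ge0.
rewrite !mulrA -exprMn (_ : 16^-1 * 4 = 4^-1 :> R); last by field.
by rewrite [leRHS](mulrAC _ _ (k`!%:R)) [X in _ <= X * _](mulrAC _ (expR _)) [leRHS](mulrAC _ (expR _)).
Qed.

End central_binomial.

(** * Laplace transforms of nonnegative random variables *)

Section watson.
Context d (T : measurableType d) {R : realType} (mu : probability T R).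
Local Notation C := R[i].
Local Notation Re := (@complex.Re R).
Variables (Q S : T -> R).
Hypotheses (mQ : measurable_fun setT Q) (Q0 : forall x, 0 <= Q x)
  (QS : forall x, Q x <= S x ^+ 2) (S0 : forall x, 0 <= S x)
  (iS : forall b : R, 0 <= b -> mu.-integrable setT (EFin \o (fun x => expR (b * S x)))).

Lemma cintegrableZr (z : C) f : cintegrable mu setT f -> cintegrable mu setT (fun x => f x * z).
Proof.
by move/(cintegrableZ z); congr cintegrable; apply/funext => x; rewrite mulrC.
Qed.

Definition moment (k : nat) : R := \int[mu]_x (Q x ^+ k).
Definition laplace (zeta : C) : C := cintegral mu setT (fun x => cexp (- zeta * (Q x)%:C)).

Lemma powQ_le (b : R) k x : 0 < b -> b ^+ k * Q x ^+ k / (k`!%:R ^+ 2) <= 4^-1 ^+ k * expR (4 * Num.sqrt b * S x).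
Proof.
move=> b0; have b1 := ltW b0; rewrite -exprMn.
apply: le_trans (pow_fact2_le k (mulr_ge0 b1 (Q0 x))) _.
rewrite ler_wpM2l ?exprn_ge0 ?invr_ge0 // ler_expR -mulrA ler_wpM2l // sqrtrM // ler_wpM2l ?sqrtr_ge0 //.
by rewrite -(ger0_norm (S0 x)) -sqrtr_sqr ler_wsqrtr.
Qed.

Lemma integrable_powQ k : mu.-integrable setT (EFin \o (fun x => Q x ^+ k)).
Proof.
have c0 : (0 : R) <= 4 * Num.sqrt 1 by rewrite mulr_ge0 // sqrtr_ge0.
apply: integrable_dom (integrableZR (k`!%:R ^+ 2 * 4^-1 ^+ k) (iS c0)).
  exact: measurable_funX.
move=> x; rewrite ger0_norm ?exprn_ge0 //.
have := powQ_le k x ltr01; rewrite expr1n mul1r ler_pdivrMr ?exprn_gt0 ?ltr0n ?fact_gt0 //.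
by rewrite mulrC mulrA.
Qed.

Lemma moment_ge0 k : 0 <= moment k.
Proof. by apply: Rintegral_ge0 => x _; exact: exprn_ge0. Qed.

(** As [Q <= S ^+ 2] and all exponential moments of [S] are finite, this holds for
    every [b]: the moments grow more slowly than any geometric sequence times the
    squared factorial, whence the infinite radius of convergence of the Borel series. *)
Lemma moment_le (b : R) : 0 < b -> exists K : R, 0 < K /\ forall k,
  b ^+ k * moment k / (k`!%:R ^+ 2) <= 4^-1 ^+ k * K.
Proof.
move=> b0; have c0 : 0 <= 4 * Num.sqrt b by rewrite mulr_ge0 // sqrtr_ge0.
exists (\int[mu]_x expR (4 * Num.sqrt b * S x) + 1); split.
  by rewrite ltr_wpDl //; apply: Rintegral_ge0 => x _; exact: expR_ge0.
move=> k; apply: (@le_trans _ _ (4^-1 ^+ k * \int[mu]_x expR (4 * Num.sqrt b * S x))); last first.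
  by rewrite ler_wpM2l ?lerDl // exprn_ge0 // invr_ge0.
rewrite mulrAC -RintegralZl //; last exact: integrable_powQ.
rewrite -RintegralZl //; last exact: iS.
apply: le_Rintegral => //.
- exact: integrableZR (integrable_powQ k).
- exact: integrableZR (iS c0).
- by move=> x _; rewrite mulrAC; exact: powQ_le.
Qed.

Lemma cmeas_laplace zeta : cmeas (fun x => cexp (- zeta * (Q x)%:C)).
Proof. by apply: cmeas_cexp; apply: cmeasZ; apply: cmeas_real. Qed.

Lemma Re_exponent zeta x : Re (- zeta * (Q x)%:C) = - Re zeta * Q x.
Proof. by rewrite mulrC Re_scale Re_opp mulrC. Qed.

(** On the left half-plane the remainder of the exponential series is at most
    [cn y ^+ N / N`!]. *)
Lemma laplace_taylor zeta N : 0 < Re zeta ->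
  cn (laplace zeta - \sum_(m < N) ((-1) ^+ m / m`!%:R * (moment m)%:C) * zeta ^+ m)
   <= moment N / N`!%:R * cn zeta ^+ N.
Proof.
move=> z0.
have t0 : forall x, Re (- zeta * (Q x)%:C) <= 0.
  by move=> x; rewrite Re_exponent mulNr oppr_le0 mulr_ge0 // ltW.
have iE : cintegrable mu setT (fun x => cexp (- zeta * (Q x)%:C)).
  apply: (@cintegrable_dom _ _ _ _ _ (fun=> 1)); first exact: cmeas_laplace.
    by move=> x; rewrite cn_cexp -expR0 ler_expR.
  exact: finite_measure_integrable_cst.
have iP m : cintegrable mu setT (fun x => (- zeta * (Q x)%:C) ^+ m / m`!%:R).
  have := cintegrableZ ((- zeta) ^+ m / m`!%:R) (cintegrable_real (integrable_powQ m)).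
  congr cintegrable; apply/funext => x; rewrite rcX exprMn.
  by rewrite mulrAC.
have -> : \sum_(m < N) ((-1) ^+ m / m`!%:R * (moment m)%:C) * zeta ^+ m =
    cintegral mu setT (fun x => \sum_(m < N) (- zeta * (Q x)%:C) ^+ m / m`!%:R).
  rewrite cintegral_sum; last by move=> m _; exact: iP.
  apply: eq_bigr => m _; rewrite -cintegral_real.
  rewrite [LHS]mulrAC -cintegralZ; last exact: cintegrable_real (integrable_powQ m).
  congr cintegral; apply/funext => x; rewrite rcX exprMn [RHS]mulrAC; congr (_ * _).
  by rewrite [in RHS]exprNn mulrAC.
rewrite -cintegralB //; last exact: cintegrable_sum.
apply: (@le_trans _ _ (\int[mu]_x ((cn zeta ^+ N / N`!%:R) * Q x ^+ N))); last first.
  rewrite RintegralZl //; last exact: integrable_powQ.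
  by rewrite le_eqVlt; apply/orP; left; apply/eqP; rewrite /moment mulrC mulrA mulrAC.
apply: cn_cintegral.
- by apply: cmeasB; [exact: cmeas_laplace|apply: cintegrable_meas; exact: cintegrable_sum].
- move=> x; apply: le_trans (cexp_taylor N _) _.
  rewrite max_l; last by rewrite -expR0 ler_expR.
  by rewrite mulr1 cnM cnN cn_real ger0_norm // exprMn mulrAC.
- exact: integrableZR (integrable_powQ N).
Qed.

(** The exponential series around [- w0 * Q] is integrated term by term. The damping
    [expR (- Re w0 * Q)] allows for radius [Re w0 / 3]: two thirds of it bound the
    remainder with a geometric factor, the last third the growth of the exponential. *)
Lemma laplace_analytic (U : set C) : (forall w, U w -> 0 < Re w) -> analytic_on U laplace.
Proof.
move=> HU w0 /HU a0; pose e := Re w0 / 3; have e0 : 0 < e by rewrite divr_gt0.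
exists e; split => //.
pose P n x := cexp (- w0 * (Q x)%:C) * ((- (Q x)%:C) ^+ n / n`!%:R).
have mP n : cmeas (P n).
  apply: cmeasM; first exact: cmeas_laplace.
  apply: cmeasM; last exact: cmeas_cst.
  by apply: cmeasX; apply: cmeasN; exact: cmeas_real.
have iP n : cintegrable mu setT (P n).
  apply: (cintegrable_dom (mP n) _ (integrableZR (n`!%:R)^-1 (integrable_powQ n))) => x.
  rewrite /P !cnM cnX cnN cn_real cnV cn_nat ger0_norm // mulrA [leRHS]mulrC ler_pM2r ?invr_gt0 ?ltr0n ?fact_gt0 //.
  apply: ler_piMl; first exact: exprn_ge0.
  by rewrite cn_cexp -expR0 ler_expR Re_exponent mulNr oppr_le0 mulr_ge0 // ltW.
exists (fun n => cintegral mu setT (P n)) => w.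
rewrite cnE ltcR => we.
apply: (@cvg_complex _ _ _ (fun N => 2^-1 ^+ N)); last first.
  by apply: cvg_expr; rewrite ger0_norm ?invr_ge0 // invf_lt1 // ltr1n.
move=> N; rewrite cn_distC /series /= big_mkord.
have -> : \sum_(k < N) cintegral mu setT (P k) * (w - w0) ^+ k =
    cintegral mu setT (fun x => \sum_(k < N) P k x * (w - w0) ^+ k).
  rewrite cintegral_sum; last by move=> k _; exact: cintegrableZr.
  by apply: eq_bigr => k _; rewrite cintegralZr.
have iS' : cintegrable mu setT (fun x => \sum_(k < N) P k x * (w - w0) ^+ k).
  by apply: cintegrable_sum => k _; exact: cintegrableZr.
have Rw : 0 < Re w.
  have := le_lt_trans (Re_le_cn _) we; rewrite Re_add Re_opp ltr_norml /e => /andP[+ _]; lra.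
have iE : cintegrable mu setT (fun x => cexp (- w * (Q x)%:C)).
  apply: (@cintegrable_dom _ _ _ _ _ (fun=> 1)); first exact: cmeas_laplace.
    by move=> x; rewrite cn_cexp -expR0 ler_expR Re_exponent mulNr oppr_le0 mulr_ge0 // ltW.
  exact: finite_measure_integrable_cst.
rewrite /laplace -cintegralB //.
rewrite -[leRHS]mulr1 -[X in _ <= _ * X](Rintegral_one mu) -RintegralZl //; last exact: finite_measure_integrable_cst.
apply: cn_cintegral; last by apply: integrableZR; exact: finite_measure_integrable_cst.
  by apply: cmeasB; [exact: cmeas_laplace|exact: cintegrable_meas iS'].
move=> x; rewrite mulr1.
pose y := - (w - w0) * (Q x)%:C.
have -> : cexp (- w * (Q x)%:C) - \sum_(k < N) P k x * (w - w0) ^+ k =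
    cexp (- w0 * (Q x)%:C) * (cexp y - \sum_(k < N) y ^+ k / k`!%:R).
  rewrite mulrBr -cexpD; congr (_ - _).
    by congr cexp; rewrite /y; move: (_%:C) => q; ring.
  rewrite mulr_sumr; apply: eq_bigr => k _; rewrite /P -mulrA mulrAC; congr (_ * (_ / _)).
  by rewrite /y -exprMn !mulNr [in RHS]mulrC.
have q0 := Q0 x; set p := cn (w - w0) in we.
have p0 : 0 <= p by exact: cn_ge0.
have cy : cn y = p * Q x by rewrite /y cnM cnN cn_real ger0_norm.
have Ry : Re y <= p * Q x by rewrite -cy; exact: le_trans (ler_norm _) (Re_le_cn _).
have py0 : 0 <= p * Q x by rewrite mulr_ge0.
rewrite cnM cn_cexp Re_exponent.
apply: (@le_trans _ _ (expR (- Re w0 * Q x) * ((2^-1 ^+ N * expR (2 * (p * Q x))) * expR (p * Q x)))).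
  apply: ler_wpM2l; first exact: expR_ge0.
  apply: le_trans (cexp_taylor N y) _; rewrite cy.
  apply: ler_pM; rewrite ?mulr_ge0 ?exprn_ge0 ?invr_ge0 ?le_max ?ler01 //.
    have h : 0 <= 2 * (p * Q x) by rewrite mulr_ge0.
    have := expn_le_expR N h; rewrite exprMn => h'.
    rewrite ler_pdivrMr ?ltr0n ?fact_gt0 // -mulrA exprVn ler_pdivlMl ?exprn_gt0 //.
    by rewrite [leRHS]mulrC.
  by rewrite ge_max ler_expR Ry -[X in X <= _]expR0 ler_expR py0.
rewrite -mulrA mulrCA -!expRD -[leRHS]mulr1; apply: ler_wpM2l.
  by rewrite exprn_ge0 // invr_ge0.
rewrite -[leRHS]expR0 ler_expR.
have : p * Q x <= e * Q x by rewrite ler_wpM2r // ltW.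
rewrite /e; lra.
Qed.

End watson.

(** * Geometric convergence *)

Section geometric_limits.
Context {R : realType}.
Local Notation C := R[i].
Local Notation q := (4^-1 : R).

Lemma q_ge0 k : 0 <= q ^+ k. Proof. by rewrite exprn_ge0 // invr_ge0. Qed.

Lemma cvg_qX (K : R) : K * q ^+ k @[k --> \oo] --> (0 : R).
Proof.
rewrite -[X in _ --> X](mulr0 K); apply: cvg_mull.
by apply: cvg_expr; rewrite ger0_norm ?invr_ge0 // invf_lt1 // ltr1n.
Qed.

Lemma sum_qX_le r : \sum_(i < r) q ^+ i <= 2.
Proof.
suff -> : \sum_(i < r) q ^+ i = 4 / 3 * (1 - q ^+ r) by have := q_ge0 r; lra.
elim: r => [|r ih]; first by rewrite big_ord0 expr0 subrr mulr0.
by rewrite big_ord_recr /= ih exprS; lra.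
Qed.

Lemma tail_le (f : nat -> C) (K : R) N r : (forall m, cn (f m) <= q ^+ m * K) ->
  cn (\sum_(m < N + r) f m - \sum_(m < N) f m) <= 2 * K * q ^+ N.
Proof.
move=> fK; have K0 : 0 <= K by have := fK 0%N; rewrite mul1r; apply: le_trans; exact: cn_ge0.
rewrite big_split_ord /= addrAC subrr add0r; apply: le_trans (cn_sum _ _ _) _.
apply: (@le_trans _ _ (\sum_(i < r) q ^+ i * (q ^+ N * K))).
  by apply: ler_sum => i _; apply: le_trans (fK _) _; rewrite exprD mulrAC mulrC.
rewrite -mulr_suml; apply: le_trans (ler_wpM2r _ (sum_qX_le r)) _.
  by rewrite mulr_ge0 ?q_ge0.
by rewrite [q ^+ N * K]mulrC mulrA.
Qed.

Lemma geo_lim_real (u : nat -> R) (K : R) :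
  (forall N r, `|u (N + r)%N - u N| <= K * q ^+ N) ->
  cvgn u /\ forall N, `|limn u - u N| <= K * q ^+ N.
Proof.
move=> H; have cu : cvgn u.
  apply: cauchy_cvg; apply: cauchy_exP => e e0.
  have /cvgrPdist_lt/(_ e e0)[N _ HN] := cvg_qX K.
  exists (u N); exists N => // M /= NM.
  have := HN N (leqnn N); rewrite sub0r normrN => h.
  rewrite /ball /= distrC -(subnKC NM); apply: le_lt_trans (H _ _) _.
  exact: le_lt_trans (ler_norm _) h.
split => // N.
have c1 : `|u (N + r)%N - u N| @[r --> \oo] --> `|limn u - u N|.
  apply: cvg_norm; apply: cvgB; last exact: cvg_cst.
  rewrite (_ : (fun r => u (N + r)%N) = (fun r => u (r + N)%N)); last by apply/funext => r; rewrite addnC.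
  by rewrite cvg_shiftn.
rewrite -(cvg_lim _ c1) //; apply: limr_le; first by apply/cvg_ex; eexists; exact: c1.
by apply: nearW => r; exact: H.
Qed.

Lemma geo_lim (u : nat -> C) (K : R) :
  (forall N r, cn (u (N + r)%N - u N) <= K * q ^+ N) ->
  exists l, forall N, cn (l - u N) <= 2 * K * q ^+ N.
Proof.
move=> H.
have hR N r : `|complex.Re (u (N + r)%N) - complex.Re (u N)| <= K * q ^+ N.
  by rewrite -Re_opp -Re_add; exact: le_trans (Re_le_cn _) (H _ _).
have hI N r : `|complex.Im (u (N + r)%N) - complex.Im (u N)| <= K * q ^+ N.
  by rewrite -Im_opp -Im_add; exact: le_trans (Im_le_cn _) (H _ _).
have [_ HR] := geo_lim_real hR.
have [_ HI] := geo_lim_real hI.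
exists (limn (fun N => complex.Re (u N)) +i* limn (fun N => complex.Im (u N))) => N.
apply: le_trans (cn_le _) _; rewrite Re_add Im_add Re_opp Im_opp /=.
by have := HR N; have := HI N; lra.
Qed.

Lemma le_geo (x y K : R) : (forall r, x <= y + K * q ^+ r) -> x <= y.
Proof.
move=> H; have c1 : y + K * q ^+ k @[k --> \oo] --> y.
  by rewrite -[X in _ --> X]addr0; apply: cvg_addR (cvg_qX K); exact: cvg_cst.
rewrite -(cvg_lim _ c1) //; apply: limr_ge; first by apply/cvg_ex; eexists; exact: c1.
by apply: nearW => k; exact: H.
Qed.

End geometric_limits.

(** * Entire power series *)

Section binomial.

Lemma exprDn_widen (K : comPzRingType) (x y : K) m L :
  (x + y) ^+ m = \sum_(k < m.+1 + L) (x ^+ (m - k) * y ^+ k) *+ 'C(m, k).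
Proof.
rewrite big_split_ord /= [X in _ = _ + X]big1 ?addr0 ?exprDn // => i _.
by rewrite bin_small // ltnS leq_addr.
Qed.

Context {R : realType}.
Local Notation C := R[i].

Lemma cn_mulrn (z : C) k : cn (z *+ k) = cn z *+ k.
Proof. by rewrite -mulr_natr cnM cn_nat mulr_natr. Qed.

Lemma binomial_tail (x y : C) m N : cn y <= 1 ->
  cn ((x + y) ^+ m - \sum_(k < N) (x ^+ (m - k) *+ 'C(m, k)) * y ^+ k)
    <= cn y ^+ N * (cn x + 1) ^+ m.
Proof.
move=> y1; rewrite (exprDn_widen _ _ _ N) addnC big_split_ord /=.
under [X in cn (_ + _ - X)]eq_bigr do rewrite mulrnAl.
rewrite addrC addKr; apply: le_trans (cn_sum _ _ _) _.
rewrite (exprDn_widen _ _ _ N) [X in _ * X](_ : _ = \sum_(k < N + m.+1) (cn x ^+ (m - k) * 1 ^+ k) *+ 'C(m, k)); last by rewrite addnC.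
rewrite big_split_ord /= mulrDr; apply: (@le_trans _ _ (cn y ^+ N * \sum_(i < m.+1) (cn x ^+ (m - (N + i)) * 1 ^+ (N + i)) *+ 'C(m, N + i))).
  rewrite mulr_sumr; apply: ler_sum => i _.
  rewrite cn_mulrn cnM !cnX expr1n mulr1 exprD mulrCA -mulrnAr.
  apply: ler_wpM2l; first by rewrite exprn_ge0 ?cn_ge0.
  rewrite lerMn2r; apply/orP; right.
  apply: ler_piMr; first by rewrite exprn_ge0 ?cn_ge0.
  by apply: exprn_ile1; rewrite ?cn_ge0.
rewrite lerDr mulr_ge0 ?exprn_ge0 ?cn_ge0 //; apply: sumr_ge0 => i _.
by rewrite mulrn_wge0 // mulr_ge0 // exprn_ge0 // cn_ge0.
Qed.

Lemma binomial_term (x : C) m k : cn (x ^+ (m - k) *+ 'C(m, k)) <= (cn x + 1) ^+ m.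
Proof.
rewrite (exprDn_widen _ _ m k) cn_mulrn cnX.
have hk : (k < m.+1 + k)%N by rewrite addSn ltnS leq_addl.
rewrite (bigD1 (Ordinal hk)) //= expr1n mulr1 lerDl; apply: sumr_ge0 => i _.
by rewrite mulrn_wge0 // mulr_ge0 // exprn_ge0 // cn_ge0.
Qed.

End binomial.

Section entire.
Context {R : realType}.
Local Notation C := R[i].
Local Notation q := (4^-1 : R).
Variable b : nat -> R.
Hypothesis b_small : forall rho : R, 0 < rho -> exists K : R, 0 < K /\
  forall m, rho ^+ m * `|b m| <= q ^+ m * K.

Definition partial_sum (N : nat) (tau : C) : C := \sum_(m < N) (b m)%:C * tau ^+ m.

Lemma partial_sum_tail (rho : R) : 0 < rho -> exists K : R, 0 < K /\ forall tau N r, cn tau <= rho ->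
  cn (partial_sum (N + r) tau - partial_sum N tau) <= K * q ^+ N.
Proof.
move=> r0; have [K [K0 HK]] := b_small r0; exists (2 * K); split; first by rewrite mulr_gt0.
move=> tau N r tr; rewrite /partial_sum.
apply: (@tail_le R (fun m => (b m)%:C * tau ^+ m)) => m; rewrite cnM cnX cn_real.
apply: le_trans (HK m); rewrite mulrC ler_wpM2r //.
by apply: lerXn2r => //; rewrite nnegrE ?cn_ge0 // ltW.
Qed.

(** Around [t0] the series is re-expanded by the binomial formula. The partial sums
    [partial_sum M] are polynomials, whose truncated expansions [cM k M] have a
    remainder bounded by [binomial_tail] uniformly in [M]; taking [M = 2 N] lets all
    errors go to 0 together. *)
Lemma entire_sum : exists B : C -> C, (forall rho : R, 0 < rho -> exists K : R, 0 < K /\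
    forall tau N, cn tau <= rho -> cn (B tau - partial_sum N tau) <= K * q ^+ N)
  /\ analytic_on setT B.
Proof.
have ex (tau : C) : exists l : C, exists K : R, forall N, cn (l - partial_sum N tau) <= K * q ^+ N.
  have r0 : 0 < cn tau + 1 by rewrite ltr_wpDl ?cn_ge0.
  have [K [K0 HK]] := partial_sum_tail r0.
  have tr : cn tau <= cn tau + 1 by rewrite lerDl.
  have [l Hl] := @geo_lim R (partial_sum^~ tau) K (fun N r => HK tau N r tr).
  by exists l, (2 * K).
have [B HB] := choice ex.
have B_le (rho : R) : 0 < rho -> exists K : R, 0 < K /\
    forall tau N, cn tau <= rho -> cn (B tau - partial_sum N tau) <= K * q ^+ N.
  move=> r0; have [K [K0 HK]] := partial_sum_tail r0; exists K; split => // tau N tr.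
  have [K' HK'] := HB tau; apply: (@le_geo R _ _ (K' * q ^+ N)) => r.
  apply: le_trans (cn_triangle (partial_sum (N + r) tau) _ _) _; rewrite [leRHS]addrC lerD ?HK //.
  by apply: le_trans (HK' _) _; rewrite exprD mulrA.
exists B; split => // t0 _; exists 2^-1; split; first by rewrite invr_gt0.
pose rho := cn t0 + 1.
have r0 : 0 < rho by rewrite ltr_wpDl ?cn_ge0.
have [K [K0 HK]] := b_small r0.
have [K1 [K10 HK1]] := B_le _ r0.
pose cM (k M : nat) : C := \sum_(m < M) (b m)%:C * (t0 ^+ (m - k) *+ 'C(m, k)).
have cM_tail k N r : cn (cM k (N + r)%N - cM k N) <= (2 * K) * q ^+ N.
  apply: (@tail_le R (fun m => (b m)%:C * (t0 ^+ (m - k) *+ 'C(m, k)))) => m.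
  rewrite cnM cn_real; apply: le_trans (HK m); rewrite mulrC ler_wpM2r //.
  exact: binomial_term.
have [c Hc] := choice (fun k => geo_lim (cM_tail k)).
exists c => w; rewrite cnE ltcR => wt.
set eta := w - t0 in wt *.
have e0 := cn_ge0 eta.
have e1 : cn eta <= 1 by apply: le_trans (ltW wt) _; rewrite invf_le1 ?ler1n.
have wE : w = t0 + eta by rewrite /eta addrC subrK.
have wr : cn w <= rho by rewrite wE; apply: le_trans (cnD _ _) _; rewrite lerD2l.
pose L := 2 * K + K1 + 4 * K.
apply: (@cvg_complex _ _ _ (fun N => L * 2^-1 ^+ N)); last first.
  rewrite -[X in _ --> X](mulr0 L); apply: cvg_mull.
  by apply: cvg_expr; rewrite ger0_norm ?invr_ge0 // invf_lt1 // ltr1n.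
move=> N; rewrite cn_distC /series /= big_mkord.
pose M := (N + N)%N.
have q2 : q ^+ M = 4^-1 ^+ N * 4^-1 ^+ N by rewrite exprD.
have h2 : q ^+ N <= 2^-1 ^+ N.
  by apply: lerXn2r; rewrite ?nnegrE ?invr_ge0 // lef_pV2 ?posrE // ler_nat.
have hN : (N.+1)%:R * q ^+ N <= 1 :> R.
  rewrite exprVn ler_pdivrMr ?exprn_gt0 // mul1r -natrX ler_nat.
  exact: leq_trans (ltn_expl N (isT : (1 < 4)%N)) _.
have t1 : cn (B w - partial_sum M w) <= K1 * 2^-1 ^+ N.
  apply: le_trans (HK1 w M wr) _; rewrite ler_pM2l // q2.
  apply: le_trans h2; rewrite ler_piMr ?q_ge0 //.
  by apply: exprn_ile1; rewrite ?invr_ge0 // invf_le1 // ler1n.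
have t2 : cn (partial_sum M w - \sum_(k < N) cM k M * eta ^+ k) <= 2 * K * 2^-1 ^+ N.
  have -> : partial_sum M w - \sum_(k < N) cM k M * eta ^+ k =
     \sum_(m < M) (b m)%:C * ((t0 + eta) ^+ m - \sum_(k < N) (t0 ^+ (m - k) *+ 'C(m, k)) * eta ^+ k).
    rewrite /partial_sum -wE.
    under [RHS]eq_bigr do rewrite mulrBr mulr_sumr.
    rewrite sumrB exchange_big /=; congr (_ - _); apply: eq_bigr => k _.
    by rewrite /cM mulr_suml; apply: eq_bigr => m _; rewrite mulrA.
  apply: le_trans (cn_sum _ _ _) _.
  apply: (@le_trans _ _ (\sum_(m < M) q ^+ m * (K * 2^-1 ^+ N))).
    apply: ler_sum => m _; rewrite cnM cn_real.
    apply: (@le_trans _ _ (`|b m| * (cn eta ^+ N * rho ^+ m))).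
      by rewrite ler_wpM2l //; exact: binomial_tail.
    rewrite mulrCA mulrA -[leLHS]mulrA [leLHS]mulrC mulrA.
    apply: ler_pM; rewrite ?exprn_ge0 //.
    + by rewrite mulr_ge0 // exprn_ge0 // ltW.
    + by rewrite mulrC.
    + by apply: lerXn2r; rewrite ?nnegrE ?invr_ge0 // ltW.
  rewrite -mulr_suml; apply: le_trans (ler_wpM2r _ (sum_qX_le M)) _.
    by rewrite mulr_ge0 ?exprn_ge0 ?invr_ge0 // ltW.
  by rewrite mulrA.
have t3 : cn (\sum_(k < N) cM k M * eta ^+ k - \sum_(k < N) c k * eta ^+ k) <= 4 * K * 2^-1 ^+ N.
  rewrite -sumrB; apply: le_trans (cn_sum _ _ _) _.
  apply: (@le_trans _ _ (\sum_(k < N) (4 * K * (q ^+ N * q ^+ N)))).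
    apply: ler_sum => k _; rewrite -mulrBl cnM cnX cn_distC.
    have : cn (c k - cM k M) <= 4 * K * (q ^+ N * q ^+ N).
      by apply: le_trans (Hc k M) _; rewrite q2 (_ : 2 * (2 * K) = 4 * K) //; lra.
    apply: le_trans; rewrite ler_piMr ?cn_ge0 //.
    by apply: exprn_ile1.
  rewrite sumr_const card_ord -[leLHS]mulr_natr -[leLHS]mulrA ler_pM2l ?mulr_gt0 //.
  rewrite -[leLHS]mulrA; apply: le_trans h2; rewrite ler_piMr ?q_ge0 // mulrC.
  by apply: le_trans hN; rewrite ler_wpM2r ?q_ge0 // ler_nat.
apply: le_trans (cn_triangle (partial_sum M w) _ _) _.
have t23 := cn_triangle (\sum_(k < N) cM k M * eta ^+ k) (partial_sum M w) (\sum_(k < N) c k * eta ^+ k).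
apply: le_trans (lerD t1 (le_trans t23 (lerD t2 t3))) _.
by rewrite /L; lra.
Qed.

End entire.

(** * The Bessel function J_0 (2 sqrt x) *)

Section bessel.
Context {R : realType}.
Local Notation q := (4^-1 : R).

(** The coefficients of [J_0 (2 sqrt x)], the Borel transform of [exp (- x)]. *)
Definition bessel_coef (k : nat) : R := (-1) ^+ k / k`!%:R ^+ 2.
Definition bessel_sum (N : nat) (x : R) : R := \sum_(k < N) bessel_coef k * x ^+ k.

Let y_ := pseries bessel_coef.
Let p_ := pseries (pseries_diffs bessel_coef).
Let s_ := pseries (pseries_diffs (pseries_diffs bessel_coef)).

Lemma fact_neq0R k : k`!%:R != 0 :> R.
Proof. by rewrite pnatr_eq0 -lt0n fact_gt0. Qed.

Lemma normr_bessel_coef k : `|bessel_coef k| = (k`!%:R ^+ 2)^-1.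
Proof. by rewrite /bessel_coef normrM normrX normrN1 expr1n mul1r ger0_norm // invr_ge0 exprn_ge0. Qed.

(** The recurrence equivalent to the differential equation [bessel_ode]. *)
Lemma bessel_coef_ode k : k.+1%:R ^+ 2 * bessel_coef k.+1 = - bessel_coef k.
Proof.
rewrite /bessel_coef factS natrM [(-1) ^+ _]exprS; have h := fact_neq0R k.
have h1 : k.+1%:R != 0 :> R by rewrite pnatr_eq0.
by move: (k.+1%:R : R) (k`!%:R : R) ((-1) ^+ k : R) h h1 => A B K h h1; field; rewrite h h1.
Qed.

Let small (c : nat -> R) := forall k, `|c k| <= (k`!%:R ^+ 2)^-1.

Let small_bessel : small bessel_coef.
Proof. by move=> k; rewrite normr_bessel_coef. Qed.

Let small_diffs c : small c -> small (pseries_diffs c).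
Proof.
move=> sc k; rewrite /pseries_diffs normrM ger0_norm //.
apply: le_trans (ler_wpM2l _ (sc _)) _ => //; rewrite factS natrM.
have h := fact_neq0R k; have h1 : k.+1%:R != 0 :> R by rewrite pnatr_eq0.
rewrite exprMn invfM [k.+1%:R ^+ 2]expr2 invfM !mulrA mulfV // mul1r ler_piMl ?invr_ge0 ?exprn_ge0 //.
by rewrite invf_le1 ?ltr0n // ler1n.
Qed.

Let cvg_small c x : small c -> cvgn (pseries c x).
Proof.
move=> H; apply: normed_cvg.
apply: (@series_le_cvg _ _ (exp_coeff `|x|)); last exact: is_cvg_series_exp_coeff.
- by move=> k /=.
- by move=> k; rewrite /exp_coeff /= divr_ge0 // exprn_ge0.
- move=> k; rewrite /= normrM normrX mulrC /exp_coeff /= ler_wpM2l ?exprn_ge0 //.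
  apply: le_trans (H k) _; rewrite lef_pV2 ?posrE ?exprn_gt0 ?ltr0n ?fact_gt0 //.
  by rewrite expr2 -natrM ler_nat leq_pmulr ?fact_gt0.
Qed.

Let cvg_y x : cvgn (y_ x). Proof. exact: cvg_small. Qed.
Let cvg_p x : cvgn (p_ x). Proof. by apply: cvg_small; exact: small_diffs. Qed.
Let cvg_s x : cvgn (s_ x). Proof. by apply: cvg_small; do 2!apply: small_diffs. Qed.

Definition bessel (x : R) : R := limn (y_ x).
Let p (x : R) : R := limn (p_ x).
Let s (x : R) : R := limn (s_ x).

Lemma is_derive_bessel x : is_derive x (1 : R) bessel (p x).
Proof.
apply: (@pseries_snd_diffs _ _ (`|x| + 1)); [exact: cvg_y|exact: cvg_p|exact: cvg_s|].
by rewrite [ltRHS]ger0_norm ?ltrDl // addr_ge0.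
Qed.

Lemma is_derive_p x : is_derive x (1 : R) p (s x).
Proof.
apply: (@pseries_snd_diffs _ _ (`|x| + 1)); [exact: cvg_p|exact: cvg_s|by apply: cvg_small; do 3!apply: small_diffs|].
by rewrite [ltRHS]ger0_norm ?ltrDl // addr_ge0.
Qed.

Lemma bessel_ode x : x * s x + p x + bessel x = 0.
Proof.
have c1 : x * s_ x k + (p_ x k.+1 + y_ x k.+1) @[k --> \oo] --> x * s x + (p x + bessel x).
  apply: cvg_addR; first by apply: cvg_mull; exact: cvg_s.
  by apply: cvg_addR; rewrite cvg_shiftS; [exact: cvg_p|exact: cvg_y].
rewrite -addrA; apply: (cvg_unique _ c1) => //.
rewrite (_ : (fun k => _) = cst 0); first exact: cvg_cst.
apply/funext => N /=; rewrite /s_ /p_ /y_ /pseries /series /= !big_mkord mulr_sumr.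
rewrite -big_split /= [X in _ + X]big_ord_recl /= addrCA addrA.
rewrite -addrA -big_split /= big1 ?addr0.
  by rewrite !expr0 !mulr1 /pseries_diffs; have := bessel_coef_ode 0; rewrite expr1n; lra.
move=> i _; rewrite /bump /= add1n /pseries_diffs.
have : bessel_coef i.+1 = - (i.+2%:R ^+ 2 * bessel_coef i.+2) by rewrite bessel_coef_ode opprK.
move=> ->; rewrite -[i.+2%:R]natr1 exprS.
by move: (i.+1%:R) (x ^+ i) (bessel_coef _) => A B K; ring.
Qed.

Lemma bessel0 : bessel 0 = 1.
Proof.
apply/cvg_lim => //; rewrite -(cvg_shiftn 1).
rewrite (_ : (fun k => _) = cst 1); first exact: cvg_cst.
apply/funext => N; rewrite /y_ /pseries /series /= addn1 big_mkord big_ord_recl /=.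
rewrite big1 ?addr0; first by rewrite /bessel_coef expr0 fact0 expr1n divr1 mulr1.
by move=> i _; rewrite expr0n mulr0.
Qed.

(** By [bessel_ode] the energy [bessel u ^+ 2 + u * p u ^+ 2] has derivative
    [- p u ^+ 2]; it decreases from its value 1 at the origin. Bounding the series
    term by term would give growth like [exp (2 sqrt x)], too much for the
    application of Fubini's theorem in [borel_sum]. *)
Lemma bessel_le1 x : 0 <= x -> `|bessel x| <= 1.
Proof.
move=> x0; pose E (u : R) := bessel u ^+ 2 + u * p u ^+ 2.
have dE u : is_derive u (1 : R) E (- (p u ^+ 2)).
  have d1 := is_derive_bessel u; have d2 := is_derive_p u.
  have : is_derive u (1 : R) E (bessel u *: p u + bessel u *: p u + (u *: (p u *: s u + p u *: s u) + (p u ^+ 2) *: 1)).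
    have d3 := is_deriveM d1 d1; have d4 := is_deriveM d2 d2.
    have d5 := is_deriveM (is_derive_id u (1 : R)) d4.
    rewrite (_ : E = bessel * bessel + id * (p * p)); last by apply/funext => v; rewrite /E !expr2.
    by rewrite expr2; exact: is_deriveD d3 d5.
  move/is_derive_eq; apply.
  have := bessel_ode u; rewrite /GRing.scale /=.
  move: (bessel u) (p u) (s u) => A B K.
  move=> h; have -> : A = - (u * K + B) by lra.
  ring.
have E0 : E 0 = 1 by rewrite /E bessel0 expr1n mul0r addr0.
have EX : E x <= 1.
  have dv u : derivable E u 1 by case: (dE u).
  rewrite -E0; apply: (@ler0_derive1_nincr _ E 0 x) => //.
    by move=> u _; rewrite derive1E; case: (dE u) => _ ->; rewrite oppr_le0 sqr_ge0.
  by apply: derivable_within_continuous => u _.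
rewrite -[leRHS](expr1n _ 2); rewrite -ler_sqr ?nnegrE // !expr1n real_normK ?num_real //.
apply: le_trans EX.
by rewrite /E lerDl mulr_ge0 // sqr_ge0.
Qed.

Lemma bessel_remainder x N : 0 <= x ->
  `|bessel x - bessel_sum N x| <= 2 * expR (4 * Num.sqrt x) * q ^+ N.
Proof.
move=> x0; have H M r : `|y_ x (M + r)%N - y_ x M| <= 2 * expR (4 * Num.sqrt x) * q ^+ M.
  rewrite /y_ /pseries /series /= !big_mkord -cn_real rcB !rc_sum.
  apply: (@tail_le R (fun k => (bessel_coef k * x ^+ k)%:C)) => k.
  rewrite cn_real normrM normr_bessel_coef ger0_norm ?exprn_ge0 // mulrC.
  exact: pow_fact2_le.
have [_ /(_ N)] := geo_lim_real H.
by rewrite (_ : y_ x N = bessel_sum N x) // /y_ /pseries /series /= big_mkord.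
Qed.

Lemma continuous_bessel : continuous bessel.
Proof.
by move=> x; apply/differentiable_continuous/derivable1_diffP; case: (is_derive_bessel x).
Qed.

Lemma measurable_bessel : measurable_fun setT bessel.
Proof. exact: continuous_measurable_fun continuous_bessel. Qed.

End bessel.

(** * Integrals over the half-line *)

Section gamma.
Context {R : realType}.
Local Notation D := (`[(0 : R), +oo[%classic).

Let gam (k : nat) (x : R) : R := expR (- x) * (x ^+ k / k`!%:R).
Let Gam (k : nat) (x : R) : R := - \sum_(j < k.+1) gam j x.

Let gam0 k x : 0 <= x -> 0 <= gam k x.
Proof. by move=> x0; rewrite mulr_ge0 ?expR_ge0 // divr_ge0 // exprn_ge0. Qed.

Let d_exp x : is_derive x (1 : R) (fun u => expR (- u)) (- expR (- x)).
Proof.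
have := is_derive1_comp (f := expR) (g := fun u : R => - u) (x := x) (is_derive_expR _) (is_deriveN (is_derive_id x 1)).
by rewrite /GRing.scale /= mulrN1.
Qed.

Let d_gam k x : is_derive x (1 : R) (gam k.+1) (gam k x - gam k.+1 x).
Proof.
have d1 := is_deriveM (d_exp x) (is_derive_exprn k.+1 x).
have gE : gam k.+1 = (k.+1)`!%:R^-1 \*: ((fun u => expR (- u)) * (fun u => u ^+ k.+1)).
  by apply/funext => u; rewrite /gam mulrA mulrC.
have := is_deriveZ ((k.+1)`!%:R^-1 : R) d1; rewrite [X in is_derive _ _ X (_ - _)]gE.
move/is_derive_eq; apply; rewrite /GRing.scale /= /gam factS natrM.
have h := fact_neq0R (R := R) k; have h1 : k.+1%:R != 0 :> R by rewrite pnatr_eq0.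
rewrite exprS; move: (k.+1%:R : R) (k`!%:R : R) h h1 (expR _) (x ^+ k) => A B h h1 E X.
by field; rewrite h h1.
Qed.

Let d_Gam k x : is_derive x (1 : R) (Gam k) (gam k x).
Proof.
elim: k => [|k ih].
  rewrite (_ : Gam 0 = - (fun u => expR (- u))); last first.
    by apply/funext => u; rewrite /Gam big_ord1 /gam expr0 fact0 divr1 mulr1.
  have := is_deriveN (d_exp x); move/is_derive_eq; apply.
  by rewrite opprK /gam expr0 fact0 divr1 mulr1.
rewrite (_ : Gam k.+1 = Gam k - gam k.+1); last first.
  by apply/funext => u; rewrite /Gam big_ord_recr /= opprD.
by have := is_deriveB ih (d_gam k x); move/is_derive_eq; apply; rewrite subKr.
Qed.

Let Gam_cvg k : Gam k x @[x --> +oo%R] --> (0 : R).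
Proof.
have g_le j x : 0 < x -> gam j x <= j.+1%:R / x.
  move=> x0; have := expn_le_expR j.+1 (ltW x0).
  rewrite /gam expRN factS natrM exprS => h.
  rewrite ler_pdivlMr // -[leLHS]mulrA ler_pdivrMl ?expR_gt0 // mulrAC.
  rewrite ler_pdivrMr ?ltr0n ?fact_gt0 // mulrC; apply: le_trans h _.
  by rewrite mulrC mulrA.
apply/cvgrPdist_le => e e0; near=> x.
have x0 : 0 < x by near: x; exact: nbhs_pinfty_gt.
rewrite sub0r /Gam opprK ger0_norm; last by apply: sumr_ge0 => j _; exact: gam0 (ltW x0).
apply: (@le_trans _ _ (\sum_(j < k.+1) (j.+1%:R / x))); first by apply: ler_sum => j _; exact: g_le.
rewrite -mulr_suml ler_pdivrMr // mulrC -ler_pdivrMr //.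
Unshelve. all: by end_near.
Qed.

(** The primitive [Gam k] is minus the survival function of the Gamma law. *)
Lemma gamma_integral k :
  (\int[lebesgue_measure]_(x in D) (expR (- x) * (x ^+ k / k`!%:R))%:E = 1%:E)%E.
Proof.
have dG x : derivable (Gam k) x 1 by case: (d_Gam k x).
have dg x : derivable (gam k) x 1.
  case: k {dG} => [|k]; last by case: (d_gam k x).
  rewrite (_ : gam 0 = fun u => expR (- u)); first by case: (d_exp x).
  by apply/funext => u; rewrite /gam expr0 fact0 divr1 mulr1.
rewrite (@ge0_continuous_FTC2y R (gam k) (Gam k) 0 0).
- rewrite /Gam big_ord_recl /= big1 ?addr0; last first.
    by move=> i _; rewrite /gam /= expr0n mul0r mulr0.
  by rewrite -EFinD add0r opprK /gam expr0 fact0 divr1 mulr1 oppr0 expR0.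
- exact: gam0.
- by apply: derivable_within_continuous => x _; exact: dg.
- exact: Gam_cvg.
- by [].
- apply: cvg_at_right_filter; apply: differentiable_continuous; apply/derivable1_diffP; exact: dG.
- by move=> x _; rewrite derive1E; case: (d_Gam k x).
Qed.

End gamma.

Lemma norm_Rintegral_le d (T : measurableType d) (R : realType)
    (mu : {measure set T -> \bar R}) (f g : T -> R) : measurable_fun setT f ->
  (forall x, `|f x| <= g x) -> mu.-integrable setT (EFin \o g) ->
  `|\int[mu]_x f x| <= \int[mu]_x g x.
Proof.
move=> mf fg ig; rewrite -cn_real -cintegral_real.
by apply: (cn_cintegral (cmeas_real mf)) => // x; rewrite cn_real.
Qed.

Section half_line.
Context {R : realType}.
Local Notation RT := (measurableTypeR R).
Local Notation leb := (@lebesgue_measure R).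
Local Notation D := (`[(0 : R), +oo[%classic).
Local Notation q := (4^-1 : R).

(** The weight [exp (- x)] extended by 0, so that product measures are taken on the
    whole line. *)
Definition expw (x : R) : R := if 0 <= x then expR (- x) else 0.

Lemma expw_ge0 x : 0 <= expw x.
Proof. by rewrite /expw; case: ifP => // _; exact: expR_ge0. Qed.

Lemma patch_expw (g : R -> R) : (fun x => expR (- x) * g x) \_ D = (fun x => expw x * g x).
Proof.
apply/funext => x; rewrite patchE /expw mem_setE in_itv /= andbT.
by case: ifP => // _; rewrite mul0r.
Qed.

Lemma Rintegral_expw (g : R -> R) :
  \int[leb]_(x in D) (expR (- x) * g x) = \int[leb]_x (expw x * g x).
Proof. by rewrite Rintegral_mkcond patch_expw. Qed.

Lemma integrable_expw (g : R -> R) :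
  leb.-integrable D (EFin \o (fun x => expR (- x) * g x)) <->
  leb.-integrable setT (EFin \o (fun x : RT => expw x * g x)).
Proof. by rewrite integrable_mkcond // restrict_EFin patch_expw. Qed.

Lemma measurable_expw : measurable_fun setT (expw : RT -> RT).
Proof.
apply: measurable_fun_ifT => //; first exact: measurable_fun_ler.
by apply: measurableT_comp => //; exact: measurable_oppr.
Qed.

Lemma gamma_expw k : leb.-integrable setT (EFin \o (fun x : RT => expw x * (x ^+ k / k`!%:R))) /\
  \int[leb]_x (expw x * (x ^+ k / k`!%:R)) = 1.
Proof.
have I := @gamma_integral R k; split; last by rewrite -Rintegral_expw /Rintegral I.
apply/integrable_expw; apply/integrableP; split.
  apply/measurable_EFinP; apply: measurable_funTS; apply: (@measurable_funM _ RT).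
    by apply: measurableT_comp => //; exact: measurable_oppr.
  by apply: measurable_funM => //; exact: measurable_funX.
rewrite (eq_integral (fun x : RT => (expR (- x) * (x ^+ k / k`!%:R))%:E)) ?I ?ltry //.
move=> x; rewrite inE /= in_itv /= andbT => x0.
rewrite /= ger0_norm //; apply: mulr_ge0; first exact: expR_ge0.
by apply: divr_ge0 => //; exact: exprn_ge0.
Qed.

Lemma integrable_expw1 : leb.-integrable setT (EFin \o (expw : RT -> R)).
Proof.
have [+ _] := gamma_expw 0; congr integrable; apply/funext => x /=.
by rewrite expr0 fact0 divr1 mulr1.
Qed.

Lemma bessel_sum_expw (v : R) N :
  leb.-integrable setT (EFin \o (fun x : RT => expw x * bessel_sum N (x * v))) /\
  \int[leb]_x (expw x * bessel_sum N (x * v)) = \sum_(k < N) (- v) ^+ k / k`!%:R.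
Proof.
have sumE : (fun x : RT => expw x * bessel_sum N (x * v)) =
   (fun x : RT => \sum_(k < N) ((- v) ^+ k / k`!%:R) * (expw x * (x ^+ k / k`!%:R))).
  apply/funext => x; rewrite /bessel_sum mulr_sumr; apply: eq_bigr => k _.
  rewrite /bessel_coef exprMn [(- v) ^+ k]exprNn expr2 invfM.
  by move: (expw x) ((-1) ^+ k) (k`!%:R^-1) (x ^+ k) (v ^+ k) => A B F X V; ring.
rewrite sumE.
elim: N {sumE} => [|N [ih1 ih2]].
  rewrite (_ : (fun _ => _) = fun=> 0); last by apply/funext => x; rewrite big_ord0.
  split; first exact: integrable0.
  by rewrite big_ord0 /Rintegral integral0.
rewrite (_ : (fun _ => _) = fun x : RT => \sum_(k < N) ((- v) ^+ k / k`!%:R) * (expw x * (x ^+ k / k`!%:R))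
   + ((- v) ^+ N / N`!%:R) * (expw x * (x ^+ N / N`!%:R))); last first.
  by apply/funext => x; rewrite big_ord_recr.
have [g1 g2] := gamma_expw N.
have i2 := integrableZR ((- v) ^+ N / N`!%:R) g1.
split; first exact: integrableDR ih1 i2.
rewrite RintegralD // ih2 RintegralZl // g2 mulr1.
by rewrite [RHS]big_ord_recr.
Qed.

(** Termwise the integral is the exponential series of [- v]. Its partial sums are
    compared with those of [bessel]; the remainder grows like [exp (4 sqrt (x v))],
    which [exp (x / 2 + 8 v)] bounds. *)
Lemma bessel_expw (v : R) : 0 <= v -> \int[leb]_x (expw x * bessel (x * v)) = expR (- v).
Proof.
move=> v0.
have mb : measurable_fun setT (fun x : RT => expw x * bessel (x * v)).
  apply: measurable_funM; first exact: measurable_expw.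
  apply: (measurableT_comp measurable_bessel).
  by apply: measurable_funM => //; exact: measurable_id.
have ib : leb.-integrable setT (EFin \o (fun x : RT => expw x * bessel (x * v))).
  apply: integrable_dom integrable_expw1 => // x.
  rewrite normrM ger0_norm ?expw_ge0 // /expw; case: ifP => [x0|_]; last by rewrite mul0r.
  by rewrite ler_piMr ?expR_ge0 // bessel_le1 // mulr_ge0.
have h : 0 < (2^-1 : R) by rewrite invr_gt0.
pose L := 2 * expR (8 * v) * \int[leb]_x expR (- (2^-1 * `|x|)).
have c1 : \sum_(k < N) (- v) ^+ k / k`!%:R @[N --> \oo] --> \int[leb]_x (expw x * bessel (x * v)).
  apply: (@squeeze_dist _ _ (fun N => L * q ^+ N)); last exact: cvg_qX.
  move=> N; have [s1 s2] := bessel_sum_expw v N.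
  rewrite -s2 -RintegralB // /L mulrAC -RintegralZl //; last exact: integrable_expR_norm.
  apply: norm_Rintegral_le; last exact: (integrableZR (2 * expR (8 * v) * q ^+ N) (integrable_expR_norm h)).
    by apply: measurable_funB => //; apply/measurable_EFinP; exact: measurable_int s1.
  move=> x; rewrite -mulrBr normrM ger0_norm ?expw_ge0 // /expw; case: ifP => [x0|_]; last first.
    by rewrite mul0r mulr_ge0 ?expR_ge0 // mulr_ge0 ?q_ge0 // mulr_ge0 // expR_ge0.
  have xv : 0 <= x * v by rewrite mulr_ge0.
  rewrite distrC (ger0_norm x0).
  apply: le_trans (ler_wpM2l (expR_ge0 _) (bessel_remainder N xv)) _.
  rewrite mulrA [leRHS]mulrAC ler_wpM2r ?q_ge0 //.
  rewrite mulrCA -[leRHS]mulrA ler_pM2l // -!expRD ler_expR.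
  (* the geometric mean of x / 4 and 4 v is at most their arithmetic mean *)
  have : Num.sqrt (x * v) <= x / 8 + 2 * v.
    have a0 : 0 <= x / 8 + 2 * v by rewrite addr_ge0 ?divr_ge0 ?mulr_ge0.
    rewrite -[leRHS](ger0_norm a0) -sqrtr_sqr ler_wsqrtr //.
    by rewrite -subr_ge0 (_ : _ - _ = (x / 8 - 2 * v) ^+ 2) ?sqr_ge0 //; field.
  by move: (Num.sqrt _) => y; lra.
by rewrite -(cvg_lim _ c1) // (cvg_lim _ (@cvg_expR_series R (- v))).
Qed.

End half_line.

(** * Borel summation *)

Section borel.
Context d (T : measurableType d) {R : realType} (mu : probability T R).
Local Notation C := R[i].
Local Notation RT := (measurableTypeR R).
Local Notation leb := (@lebesgue_measure R).
Local Notation D := (`[(0 : R), +oo[%classic).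
Local Notation q := (4^-1 : R).
Variables (Q S : T -> R).
Hypotheses (mQ : measurable_fun setT Q) (Q0 : forall x, 0 <= Q x)
  (QS : forall x, Q x <= S x ^+ 2) (S0 : forall x, 0 <= S x)
  (iS : forall b : R, 0 <= b -> mu.-integrable setT (EFin \o (fun x => expR (b * S x)))).
Local Notation M := (moment mu Q).
Local Notation b := (fun m => bessel_coef m * M m : R).

Let b_small (rho : R) : 0 < rho -> exists K : R, 0 < K /\
  forall m, rho ^+ m * `|b m| <= q ^+ m * K.
Proof.
move=> r0; have [K [K0 HK]] := moment_le mQ Q0 QS S0 iS r0; exists K; split => // m.
rewrite normrM normr_bessel_coef (ger0_norm (moment_ge0 mu Q0 m)).
by rewrite [X in _ * X]mulrC mulrA.
Qed.

Let mbQ (tau : R) : measurable_fun setT (fun x => bessel (tau * Q x)).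
Proof. by apply: (measurableT_comp measurable_bessel); exact: measurable_funM. Qed.

(** The remainder of [bessel] at [tau * Q] grows at most like an exponential of [S],
    which is integrable. *)
Lemma expectation_bessel (tau : R) : 0 <= tau -> exists K : R, forall N,
  `|\int[mu]_x bessel (tau * Q x) - \sum_(m < N) b m * tau ^+ m| <= K * q ^+ N.
Proof.
move=> t0; have c0 : 0 <= 4 * Num.sqrt tau by rewrite mulr_ge0 // sqrtr_ge0.
exists (2 * \int[mu]_x expR (4 * Num.sqrt tau * S x)) => N.
have iQ m : mu.-integrable setT (EFin \o (fun x => bessel_coef m * tau ^+ m * Q x ^+ m)).
  exact: integrableZR (integrable_powQ mQ Q0 QS S0 iS m).
have sumE : (\sum_(m < N) b m * tau ^+ m)%:C = cintegral mu setT (fun x => (bessel_sum N (tau * Q x))%:C).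
  rewrite rc_sum.
  transitivity (cintegral mu setT (fun x => \sum_(m < N) (bessel_coef m * tau ^+ m * Q x ^+ m)%:C)).
    rewrite cintegral_sum; last by move=> m _; exact: cintegrable_real (iQ m).
    apply: eq_bigr => m _; rewrite cintegral_real RintegralZl //; last exact: (integrable_powQ mQ Q0 QS S0 iS m).
    by rewrite mulrAC.
  congr cintegral; apply/funext => x; rewrite /bessel_sum rc_sum; apply: eq_bigr => m _.
  by rewrite exprMn mulrA.
have iB : mu.-integrable setT (EFin \o (fun x => bessel (tau * Q x))).
  apply: (@integrable_dom _ _ _ _ _ (fun=> 1)) => //; last exact: finite_measure_integrable_cst.
  by move=> x; apply: bessel_le1; exact: mulr_ge0.
have iBs : mu.-integrable setT (EFin \o (fun x => bessel_sum N (tau * Q x))).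
  have := @integrable_sumR R _ _ mu _ (index_enum 'I_N) (fun (m : 'I_N) x => bessel_coef m * tau ^+ m * Q x ^+ m) (fun m => iQ m).
  congr integrable; apply/funext => x /=; congr EFin; apply: eq_bigr => m _.
  by rewrite exprMn mulrA.
have -> : \sum_(m < N) b m * tau ^+ m = \int[mu]_x bessel_sum N (tau * Q x).
  by have := congr1 (@complex.Re R) sumE; rewrite cintegral_real.
rewrite -RintegralB // mulrAC -RintegralZl //; last exact: iS.
apply: norm_Rintegral_le; last exact: integrableZR (iS c0).
  by apply: measurable_funB => //; apply/measurable_EFinP; exact: measurable_int iBs.
move=> x; apply: le_trans (bessel_remainder N (mulr_ge0 t0 (Q0 x))) _.
rewrite mulrAC ler_wpM2l ?mulr_ge0 ?q_ge0 // ler_expR -mulrA ler_wpM2l // sqrtrM // ler_wpM2l ?sqrtr_ge0 //.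
by rewrite -(ger0_norm (S0 x)) -sqrtr_sqr ler_wsqrtr.
Qed.

(** The entire function [B] of [entire_sum] is [E bessel (tau * Q)] at real
    [tau >= 0]. Since [bessel] is bounded there, Fubini's theorem applies and
    [bessel_expw] turns the integral over [tau] into [E exp (- Q)]. *)
Lemma borel_sum : exists B : C -> C,
  [/\ forall tau : C, \sum_(m < N) (b m)%:C * tau ^+ m @[N --> \oo] --> B tau,
      analytic_on setT B,
      cintegrable leb D (fun tau : R => cexp (- tau%:C) * B tau%:C) &
      laplace mu Q 1 = cintegral leb D (fun tau : R => cexp (- tau%:C) * B tau%:C)].
Proof.
have [B [B_le B_an]] := entire_sum b_small.
exists B.
have BE (tau : R) : 0 <= tau -> B tau%:C = (\int[mu]_x bessel (tau * Q x))%:C.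
  move=> t0; have [K HK] := expectation_bessel t0.
  have t1 : 0 < tau + 1 by rewrite ltr_wpDl.
  have [K' [K'0 HK']] := B_le _ t1.
  apply/eqP; rewrite -subr_eq0 -cn_eq0 eq_le cn_ge0 andbT.
  apply: (@le_geo R _ _ (K + K')) => N; rewrite add0r.
  apply: le_trans (cn_triangle (partial_sum b N tau%:C) _ _) _.
  rewrite mulrDl addrC lerD //.
    rewrite cn_distC (_ : partial_sum _ _ _ = (\sum_(m < N) b m * tau ^+ m)%:C) -?rcB ?cn_real //.
    by rewrite /partial_sum rc_sum; apply: eq_bigr => m _; rewrite [RHS]rcM rcX.
  by apply: HK'; rewrite cn_real ger0_norm // lerDl.
pose h (tau : R) := \int[mu]_x bessel (tau * Q x).
pose K (p : RT * T) := expw p.1 * bessel (p.1 * Q p.2).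
have mK : measurable_fun setT K.
  apply: measurable_funM; first exact: (measurableT_comp measurable_expw measurable_fst).
  apply: (measurableT_comp measurable_bessel); apply: measurable_funM; first exact: measurable_fst.
  exact: (measurableT_comp mQ measurable_snd).
have bK x y : `|K (x, y)| <= expw x * 1.
  rewrite /K /= normrM ger0_norm ?expw_ge0 // /expw; case: ifP => x0; last by rewrite !mul0r.
  by rewrite ler_wpM2l ?expR_ge0 // bessel_le1 // mulr_ge0.
have i1 : mu.-integrable setT (EFin \o (fun=> 1 : R)) by exact: finite_measure_integrable_cst.
have [m1 m2 E1 E2] := rfubini_dom (fun x : RT => expw_ge0 x) (fun _ : T => ler01) integrable_expw1 i1 mK bK.
have hK x : \int[mu]_y K (x, y) = expw x * h x.
  rewrite /K /= /h /expw; case: ifP => x0; last first.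
    rewrite mul0r; transitivity (\int[mu]_y (0 : R)); last by rewrite /Rintegral integral0.
    by apply: eq_Rintegral => y _; rewrite mul0r.
  rewrite RintegralZl //; apply: (@integrable_dom _ _ _ _ _ (fun=> 1)) => // y.
  by apply: bessel_le1; exact: mulr_ge0.
have FE : (fun tau : RT => expR (- tau) * h tau) \_ D = fun tau : RT => \int[mu]_y K (tau, y).
  by rewrite patch_expw; apply/funext => x; rewrite hK.
have BD (tau : R) : tau \in D -> cexp (- tau%:C) * B tau%:C = (expR (- tau) * h tau)%:C.
  rewrite mem_setE in_itv /= andbT => t0.
  by rewrite BE // -rcN cexp_real -rcM.
have Kint : leb.-integrable setT (EFin \o (fun x : RT => expw x * h x)).
  apply: integrable_dom integrable_expw1; first by move: m1; congr measurable_fun; apply/funext => x; rewrite hK.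
  move=> x; rewrite -hK; apply: le_trans (norm_Rintegral_le _ (bK x) _) _.
  - exact: measurableT_comp mK (pair1_measurable x).
  - exact: integrableZR i1.
  - by rewrite RintegralZl // Rintegral_one mulr1.
have mD : measurable (D : set RT) by exact: measurable_itv.
split => //.
- move=> tau; have r0 : 0 < cn tau + 1 by rewrite ltr_wpDl ?cn_ge0.
  have [K' [_ HK]] := B_le _ r0.
  apply: (@cvg_complex _ _ _ (fun N => K' * q ^+ N)); last exact: cvg_qX.
  by move=> N; rewrite cn_distC; apply: HK; rewrite lerDl.
- split.
    apply: (eq_integrable mD (fun tau : RT => (expR (- tau) * h tau)%:E)).
      by move=> x xD; rewrite BD.
    by apply/integrable_expw.
  apply: (eq_integrable mD (cst 0%E)); last exact: integrable0.
  by move=> x xD; rewrite BD.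
- have -> : cintegral leb D (fun tau : R => cexp (- tau%:C) * B tau%:C) = (\int[leb]_x (expw x * h x))%:C.
    rewrite /cintegral -Rintegral_expw; congr (_ +i* _).
      by apply: eq_Rintegral => x xD; rewrite BD.
    transitivity (\int[leb]_(x in D) (0 : R)); last by rewrite /Rintegral integral0.
    by apply: eq_Rintegral => x xD; rewrite BD.
  transitivity (\int[leb]_x \int[mu]_y K (x, y))%:C; last by congr (_%:C); apply: eq_Rintegral => x _; rewrite hK.
  rewrite -E1 E2 /laplace -cintegral_real; congr cintegral; apply/funext => x.
  by rewrite /K /= bessel_expw // mulN1r -rcN cexp_real.
Qed.

End borel.

(** * Iterated partial derivatives *)

Section directional.
Context {R : realType} {n : nat}.
Local Notation C := R[i].
Local Notation W := 'rV[C]_n.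
Implicit Types (f g : W -> C) (w : W) (k : 'I_n).
Local Notation basis k := (delta_mx ord0 k : W).

(** Partial derivatives are taken in the sense of [qderiv], for which the rules of
    calculus and differentiation under the integral are available; [partialE] is the
    passage to the limit of difference quotients. *)
Definition ddir k f w (v : C) : Prop := qderiv (fun h => f (w + h *: basis k)) 0 v.

Lemma partialE k f w v : ddir k f w v -> partial k f w = v.
Proof.
move=> [K [e [K0 e0 H]]].
have K1 : 0 < K + 1 by rewrite ltr_wpDl.
apply/cvg_lim => //; apply/cvgrPdist_le => eps eps0.
have eps1 : 0 < complex.Re eps by move: eps0; rewrite ltcE => /andP[].
near=> h.
have h0 : h != 0 by near: h; exact: nbhs_dnbhs_neq.
have he : `|h| < e%:C by near: h; apply: dnbhs0_lt; rewrite ltcR.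
have epsE : eps = (complex.Re eps)%:C by rewrite RRe_real // gtr0_real.
have hK : `|h| < (complex.Re eps / (K + 1))%:C.
  by near: h; apply: dnbhs0_lt; rewrite ltcR; exact: divr_gt0 eps1 K1.
move: he hK; rewrite cnE !ltcR => he hK.
have := H h he; rewrite add0r scale0r addr0 => H1.
rewrite distrC (_ : _ - v = h^-1 * (f (w + h *: basis k) - f w - h * v)); last first.
  by rewrite /shift /= [h *: _ + w]addrC /GRing.scale /= !mulrBr [h^-1 * (h * _)]mulrA mulVf // mul1r.
rewrite cnE epsE lecR cnM cnV.
have ch : 0 < cn h by rewrite lt_neqAle eq_sym cn_eq0 h0 cn_ge0.
rewrite ler_pdivrMl //; apply: le_trans H1 _.
rewrite expr2 mulrCA ler_wpM2l ?cn_ge0 //.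
move: hK; rewrite ltr_pdivlMr ?ltr_wpDl // => /ltW; apply: le_trans.
by rewrite mulrC ler_wpM2l ?cn_ge0 // lerDl.
Unshelve. all: by end_near. Qed.

(** Coinductive in nature: [f] lies in a class stable under partial derivatives, so
    that partial derivatives of all orders exist. Concrete functions come with such
    a class, for instance that of all moments for a moment generating function. *)
Definition smooth f : Prop := exists F : (W -> C) -> Prop, F f /\
  forall g, F g -> forall k, exists g', F g' /\ forall w, ddir k g w (g' w).

Lemma smooth_ddir f k w : smooth f -> ddir k f w (partial k f w).
Proof.
move=> [F [Ff HF]]; have [g' [_ H]] := HF _ Ff k.
by rewrite (partialE (H w)).
Qed.

Lemma smooth_partial f k : smooth f -> smooth (partial k f).
Proof.
move=> [F [Ff HF]]; have [g' [Fg H]] := HF _ Ff k; exists F; split => //.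
by rewrite (_ : partial k f = g') //; apply/funext => w; exact: partialE.
Qed.

Lemma smooth_foldr f J : smooth f -> smooth (foldr partial f J).
Proof. by move=> sf; elim: J => [|k J ih] //=; exact: smooth_partial. Qed.

Lemma smoothD f g : smooth f -> smooth g -> smooth (fun w => f w + g w).
Proof.
move=> [F [Ff HF]] [G [Gg HG]].
exists (fun h => exists f1 g1, [/\ F f1, G g1 & h = fun w => f1 w + g1 w]); split.
  by exists f, g.
move=> _ [f1 [g1 [Ff1 Gg1 ->]]] k.
have [f2 [Ff2 H2]] := HF _ Ff1 k; have [g2 [Gg2 H3]] := HG _ Gg1 k.
exists (fun w => f2 w + g2 w); split; first by exists f2, g2.
by move=> w; exact: qderivD (H2 w) (H3 w).
Qed.

Lemma smoothZ c f : smooth f -> smooth (fun w => c * f w).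
Proof.
move=> [F [Ff HF]].
exists (fun h => exists2 f1, F f1 & h = fun w => c * f1 w); split; first by exists f.
move=> _ [f1 Ff1 ->] k; have [f2 [Ff2 H2]] := HF _ Ff1 k.
exists (fun w => c * f2 w); split; first by exists f2.
by move=> w; exact: qderivZ (H2 w).
Qed.

Lemma foldr_partialD f g J : smooth f -> smooth g ->
  foldr partial (fun w => f w + g w) J = fun w => foldr partial f J w + foldr partial g J w.
Proof.
move=> sf sg; elim: J => [|k J ih] //=; rewrite ih; apply/funext => w.
apply: partialE; apply: qderivD; apply: smooth_ddir; exact: smooth_foldr.
Qed.

Lemma foldr_partialZ c f J : smooth f ->
  foldr partial (fun w => c * f w) J = fun w => c * foldr partial f J w.
Proof.
move=> sf; elim: J => [|k J ih] //=; rewrite ih; apply/funext => w.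
apply: partialE; apply: qderivZ; apply: smooth_ddir; exact: smooth_foldr.
Qed.

Lemma ddir_cst (c : C) k w : ddir k (fun=> c) w 0.
Proof. exact: qderiv_cst. Qed.

Lemma smooth_cst c : smooth (fun=> c).
Proof.
exists (fun f => exists c, f = fun=> c); split; first by exists c.
move=> _ [c' ->] k; exists (fun=> 0); split; first by exists 0.
by move=> w; exact: ddir_cst.
Qed.

Definition lin (l : W -> C) : Prop := forall (a : C) v w, l (a *: v + w) = a * l v + l w.

Lemma ddir_lin l k w : lin l -> ddir k l w (l (basis k)).
Proof.
move=> ll; exists 0, 1; split => // h _.
by rewrite add0r scale0r addr0 [w + _]addrC ll addrK subrr cn0 mul0r.
Qed.

Lemma smooth_lin l : lin l -> smooth l.
Proof.
move=> ll; exists (fun f => f = l \/ exists c, f = fun=> c); split; first by left.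
move=> _ [->|[c ->]] k.
  by exists (fun=> l (basis k)); split; [right; exists (l (basis k))|move=> w; exact: ddir_lin].
by exists (fun=> 0); split; [right; exists 0|move=> w; exact: ddir_cst].
Qed.

Lemma smooth_quad (B : W -> W -> C) : (forall v, lin (B v)) -> (forall v, lin (B^~ v)) ->
  smooth (fun w => B w w).
Proof.
move=> l1 l2.
exists (fun f => [\/ f = fun w => B w w, lin f | exists c, f = fun=> c]); split; first exact: Or31.
move=> f [->|lf|[c ->]] k.
- exists (fun w => B w (basis k) + B (basis k) w); split.
    by apply: Or32 => a v w; rewrite l1 l2; ring.
  move=> w; exists (cn (B (basis k) (basis k))), 1; split; rewrite ?cn_ge0 // => h _.
  rewrite add0r scale0r addr0 [w + _]addrC l1 l2 (l2 w).
  rewrite (_ : _ - _ = h ^+ 2 * B (basis k) (basis k)); last by move: (B w w) => b; ring.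
  by rewrite cnM cnX mulrC.
- by exists (fun=> f (basis k)); split; [apply: Or33; exists (f (basis k))|move=> w; exact: ddir_lin].
- by exists (fun=> 0); split; [apply: Or33; exists 0|move=> w; exact: ddir_cst].
Qed.

Lemma lin_dot (b : W) : lin (fun v => dot v b).
Proof. by move=> a v w; rewrite dotDl dotZl. Qed.

Lemma dot_basis (b : W) k : dot (basis k) b = b ord0 k.
Proof.
rewrite /dot (bigD1 k) //= !mxE !eqxx mul1r big1 ?addr0 // => i ik.
by rewrite !mxE (negbTE ik) andbF mul0r.
Qed.

Lemma foldr_partial_cst (c : C) (J : seq 'I_n) : J != [::] ->
  foldr partial (fun _ : W => c) J = fun=> 0.
Proof.
have p0 k c' : partial k (fun _ : W => c') = fun=> 0.
  by apply/funext => w; apply: partialE; exact: ddir_cst.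
elim: J => [|k J ih]; first by [].
move=> _; case: J ih => [|j J] ih; first exact: p0.
by rewrite -[LHS]/(partial k (foldr partial (fun _ : W => c) (j :: J))) ih.
Qed.

Lemma foldr_partial_dot (b : W) J k : foldr partial (fun v => dot v b) (rcons J k) =
  fun=> if J == [::] then b ord0 k else 0.
Proof.
rewrite -cats1 foldr_cat /=.
have -> : partial k (fun v => dot v b) = fun=> b ord0 k.
  by apply/funext => w; apply: partialE; rewrite -dot_basis; exact: ddir_lin (lin_dot b).
by case: eqVneq => [->|J0] //; exact: foldr_partial_cst.
Qed.

Lemma ddir_sum (I : Type) (s : seq I) (P : pred I) (F : I -> W -> C) (F' : I -> C) k w :
  (forall i, P i -> ddir k (F i) w (F' i)) ->
  ddir k (fun v => \sum_(i <- s | P i) F i v) w (\sum_(i <- s | P i) F' i).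
Proof.
move=> H; elim: s => [|i s ih].
  rewrite big_nil (_ : (fun v => _) = fun=> 0); first exact: ddir_cst.
  by apply/funext => v; rewrite big_nil.
rewrite big_cons (_ : (fun v => _) = fun v => if P i then F i v + \sum_(j <- s | P j) F j v else \sum_(j <- s | P j) F j v); last first.
  by apply/funext => v; rewrite big_cons.
by case: ifP => // Pi; apply: qderivD => //; exact: H.
Qed.

End directional.

(** * Moments as derivatives *)

Section moments.
Context {R : realType} {n : nat}.
Local Notation C := R[i].
Local Notation vec := 'rV[R]_n.
Local Notation W := 'rV[C]_n.
Variables (mu : probability vec R).
Hypothesis em : expmoments mu.

Definition monomial (J : seq 'I_n) (x : vec) : R := \prod_(k <- J) x ord0 k.
(** Moments of the exponentially tilted law; at [w = 0] they are the moments, at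
    [J = [::]] the moment generating function. *)
Definition mom (J : seq 'I_n) (w : W) : C := cintegral mu setT (fun x => (monomial J x)%:C * lexp w x).

Lemma measurable_monomial J : measurable_fun setT (monomial J).
Proof.
rewrite /monomial; elim: J => [|k J ih].
  by rewrite (_ : (fun x => _) = fun=> 1) //; apply/funext => x; rewrite big_nil.
rewrite (_ : (fun x => _) = fun x : vec => x ord0 k * \prod_(j <- J) x ord0 j); last first.
  by apply/funext => x; rewrite big_cons.
by apply: measurable_funM => //; exact: measurable_coord.
Qed.

Lemma monomial_le J x : `|monomial J x| <= norm1 x ^+ size J.
Proof.
rewrite /monomial; elim: J => [|k J ih] /=; first by rewrite big_nil normr1.
rewrite big_cons normrM exprS; apply: ler_pM => //; exact: coord_le_norm1.
Qed.

Lemma cn_lexp_le (w : W) (x : vec) : cn (lexp w x) <= expR (norm1 (re_vec w) * norm1 x).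
Proof. by rewrite cn_lexp ler_expR; exact: le_trans (ler_norm _) (dot_le_norm1 _ _). Qed.

Lemma cmeas_mom J w : cmeas (fun x => (monomial J x)%:C * lexp w x).
Proof. by apply: cmeasM (cmeas_lexp w); apply: cmeas_real; exact: measurable_monomial. Qed.

Lemma integrable_norm1X N (b : R) : 0 <= b ->
  mu.-integrable setT (EFin \o (fun x => norm1 x ^+ N * expR (b * norm1 x))).
Proof.
move=> b0; have b1 : 0 <= b + 1 by rewrite addr_ge0.
apply: integrable_dom (integrableZR (N`!%:R) (integrable_expR_pnorm1 b1 em)).
  apply: measurable_funM; first by apply: measurable_funX; exact: measurable_norm1.
  by apply: measurableT_comp => //; apply: measurable_funM => //; exact: measurable_norm1.
move=> x; have x0 := norm1_ge0 x.
rewrite ger0_norm ?mulr_ge0 ?exprn_ge0 ?expR_ge0 // mulrDl mul1r expRD mulrCA mulrC.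
by rewrite ler_wpM2l ?expR_ge0 //; exact: expn_le_expR.
Qed.

Lemma cintegrable_mom J w : cintegrable mu setT (fun x => (monomial J x)%:C * lexp w x).
Proof.
apply: (cintegrable_dom (cmeas_mom J w) _ (integrable_norm1X (size J) (norm1_ge0 (re_vec w)))) => x.
rewrite cnM cn_real; apply: ler_pM; rewrite ?cn_ge0 //; [exact: monomial_le|exact: cn_lexp_le].
Qed.

Lemma lexp_line (w : W) (k : 'I_n) (h : C) (x : vec) :
  lexp (w + h *: delta_mx ord0 k) x = lexp w x * cexp (h * (x ord0 k)%:C).
Proof.
rewrite /lexp dotDl cexpD dotZl; by rewrite dot_basis mxE.
Qed.

Lemma ddir_mom J k w : ddir k (mom J) w (mom (k :: J) w).
Proof.
pose c := norm1 (re_vec w).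
apply: (@qderiv_integral R _ _ mu (fun h x => (monomial J x)%:C * lexp (w + h *: delta_mx ord0 k) x)
  (fun x => (monomial (k :: J) x)%:C * lexp w x)
  (fun x => norm1 x ^+ (size J).+2 * expR ((c + 1) * norm1 x)) 0 1 ltr01).
- by move=> h _; exact: cintegrable_mom.
- exact: cintegrable_mom.
- by apply: integrable_norm1X; rewrite addr_ge0 // norm1_ge0.
move=> h x; rewrite add0r scale0r addr0 => h1.
rewrite lexp_line /monomial big_cons rcM -/(monomial J x).
set y := h * (x ord0 k)%:C.
have -> : (monomial J x)%:C * (lexp w x * cexp y) - (monomial J x)%:C * lexp w x
    - h * ((x ord0 k)%:C * (monomial J x)%:C * lexp w x)
  = (monomial J x)%:C * lexp w x * (cexp y - 1 - y).
  by rewrite /y; move: (_%:C) (lexp w x) (cexp _) (_%:C) => a l e b; ring.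
have x0 := norm1_ge0 x; have xk := coord_le_norm1 x k.
have cy : cn y <= norm1 x.
  rewrite /y cnM cn_real; apply: le_trans xk; rewrite ler_piMl //; exact: ltW.
rewrite !cnM cn_real.
have cy2 : cn y ^+ 2 <= cn h ^+ 2 * norm1 x ^+ 2.
  rewrite -exprMn; apply: lerXn2r; rewrite ?nnegrE ?mulr_ge0 ?cn_ge0 //.
  by rewrite /y cnM cn_real ler_wpM2l ?cn_ge0.
apply: (@le_trans _ _ (norm1 x ^+ size J * expR (c * norm1 x) * (cn h ^+ 2 * norm1 x ^+ 2 * expR (norm1 x)))).
  apply: ler_pM; rewrite ?mulr_ge0 ?cn_ge0 //.
    by apply: ler_pM; rewrite ?cn_ge0 //; [exact: monomial_le|exact: cn_lexp_le].
  apply: le_trans (cexp_taylor2 y) _; apply: ler_pM; rewrite ?exprn_ge0 ?cn_ge0 ?expR_ge0 //.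
  by rewrite ler_expR.
have -> : norm1 x ^+ (size J).+2 = norm1 x ^+ size J * norm1 x ^+ 2 by rewrite -exprD addn2.
rewrite mulrDl mul1r expRD le_eqVlt; apply/orP; left; apply/eqP.
by move: (expR _) (expR _) (norm1 x ^+ size J) => p q u; ring.
Qed.

Lemma smooth_mom J : smooth (mom J).
Proof.
exists (fun f => exists J, f = mom J); split; first by exists J.
move=> _ [L ->] k; exists (mom (k :: L)); split; first by exists (k :: L).
by move=> w; exact: ddir_mom.
Qed.

Lemma mom_perm J L : perm_eq J L -> mom J = mom L.
Proof.
move=> JL; apply/funext => w; congr cintegral; apply/funext => x.
by rewrite /monomial (perm_big _ JL).
Qed.

End moments.

(** * Moments and cumulants *)

Section leibniz.
Context {R : realType} {n : nat}.
Local Notation C := R[i].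
Local Notation vec := 'rV[R]_n.
Local Notation W := 'rV[C]_n.
Variables (mu : probability vec R) (K : W -> C).
Hypotheses (hK : has_mgf mu (fun w => cexp (K w))) (sK : smooth K).
Local Notation mom := (mom mu).

Lemma mom_nil w : mom [::] w = cexp (K w).
Proof.
rewrite -(hK.2 w); congr cintegral; apply/funext => x.
by rewrite /monomial big_nil mul1r.
Qed.

(** Logarithmic derivative of the moment generating function [cexp (K w)]. *)
Lemma mom_single k w : mom [:: k] w = partial k K w * mom [::] w.
Proof.
rewrite -(partialE (ddir_mom hK.1 [::] k w)); apply: partialE.
rewrite (_ : mom [::] = fun v => cexp (K v)); last by apply/funext => v; exact: mom_nil.
have h := smooth_ddir k w sK.
have := qderiv_comp h (qderiv_cexp _); rewrite scale0r addr0 mulrC.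
by [].
Qed.

Lemma big_subset_setU1 (T : finType) (V : zmodType) (i : T) (A : {set T}) (F : {set T} -> V) :
  i \notin A ->
  \sum_(S : {set T} | S \subset i |: A) F S = \sum_(S : {set T} | S \subset A) (F (i |: S) + F S).
Proof.
move=> iA; rewrite (bigID (fun S : {set T} => i \in S)) /= big_split /=; congr (_ + _).
  rewrite (reindex_onto (fun S : {set T} => i |: S) (fun S => S :\ i)) /=; last first.
    by move=> S /andP[_ iS]; rewrite finset.setD1K.
  apply: eq_bigl => S; rewrite finset.setU11 andbT.
  apply/andP/idP => [[/fintype.subsetP SA /eqP iS]|SA].
    apply/fintype.subsetP => x xS; have := SA x; rewrite !inE xS orbT => /(_ isT) /orP[/eqP xi|//].
    by move: xS; rewrite -iS xi !inE eqxx.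
  split; first exact: finset.setUS.
  by apply/eqP/finset.setU1K; apply: contra iA; exact: (fintype.subsetP SA).
apply: eq_bigl => S; apply/andP/idP => [[/fintype.subsetP SA iS]|SA].
  apply/fintype.subsetP => x xS; have := SA x xS; rewrite !inE => /orP[/eqP xi|//].
  by rewrite -xi xS in iS.
split; first by apply: (fintype.subset_trans SA); exact: finset.subsetUr.
by apply: contra iA; exact: (fintype.subsetP SA).
Qed.

(** Leibniz' formula for the product [partial k K * mom [::]] of [mom_single]. The
    factors to be differentiated are indexed by [s], whose order is kept throughout
    since the partial derivatives are iterated in that order. *)
Lemma mom_leibniz (T : finType) (X : T -> 'I_n) k (s : seq T) w : uniq s ->
  mom (k :: [seq X i | i <- s]) w = \sum_(S : {set T} | S \subset [set x in s])
    foldr partial (partial k K) [seq X i | i <- s & i \in S] w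
      * mom [seq X i | i <- s & i \notin S] w.
Proof.
elim: s w => [|i s ih] w /=.
  move=> _; rewrite (big_pred1 finset.set0) /=; first exact: mom_single.
  by move=> S; rewrite finset.set_nil finset.subset0.
move=> /andP[is_ us].
rewrite (mom_perm mu (L := X i :: k :: [seq X j | j <- s])); last first.
  by rewrite -(perm_catCA [:: _] [:: _]).
rewrite -(partialE (ddir_mom hK.1 (k :: [seq X j | j <- s]) (X i) w)).
rewrite finset.set_cons big_subset_setU1; last by rewrite inE.
apply: partialE.
rewrite (_ : mom _ = fun w => \sum_(S : {set T} | S \subset [set x in s])
    foldr partial (partial k K) [seq X i | i <- s & i \in S] w
      * mom [seq X i | i <- s & i \notin S] w); last by apply/funext => v; exact: ih.
apply: ddir_sum => S SA.
have iS : i \notin S by apply/negP => /(fintype.subsetP SA); rewrite inE (negbTE is_).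
have f1 : [seq j <- s | j \in i |: S] = [seq j <- s | j \in S].
  apply: eq_in_filter => j js; rewrite !inE; case: eqP => // ji.
  by rewrite -ji js in is_.
have f2 : [seq j <- s | j \notin i |: S] = [seq j <- s | j \notin S].
  apply: eq_in_filter => j js; rewrite !inE; case: eqP => // ji.
  by rewrite -ji js in is_.
rewrite finset.setU11 /= f1 f2 (negbTE iS) /=.
have d1 := smooth_ddir (X i) w (smooth_foldr [seq X j | j <- s & j \in S] (smooth_partial k sK)).
have d2 := ddir_mom hK.1 [seq X j | j <- s & j \notin S] (X i) w.
by have := qderivM d1 d2; rewrite scale0r addr0.
Qed.

Variables (T : finType) (X : T -> 'I_n).
Hypothesis K0 : K 0 = 0.

(** [K] is the cumulant generating function. *)
Definition cumulant (B : {set T}) : C := foldr partial K [seq X i | i <- enum B] 0.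

Lemma enum_subset (A B : {set T}) : B \subset A -> enum B = [seq x <- enum A | x \in B].
Proof.
move=> /fintype.subsetP BA; rewrite /enum_mem -filter_predI; apply: eq_filter => x /=.
by case xB : (x \in B) => //=; rewrite BA.
Qed.

(** By induction on [A]. The block [B] containing the element [a] of [A] that comes
    last in the enumeration is chosen first; [mom_leibniz] sums over the rest of [B],
    and the other blocks partition the complement of [B]. Taking the last element
    makes the derivative along [a] the innermost one, as in [cumulant]. *)
Lemma mom_cumulant (A : {set T}) : mom [seq X i | i <- enum A] 0 =
  \sum_(P : {set {set T}} | finset.partition P A) \prod_(B in P) cumulant B.
Proof.
have [m] := ubnP #|A|; elim: m A => // m IH A; rewrite ltnS => Am.
have [->|A0] := eqVneq A finset.set0.
  rewrite enum_set0 /= mom_nil K0 cexp0 (big_pred1 finset.set0); first by rewrite big_set0.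
  by move=> P; rewrite partition_set0.
case/lastP eA : (enum A) => [|s a].
  by case/negP: A0; rewrite -cards_eq0 cardE eA.
have := enum_uniq (mem A); rewrite eA rcons_uniq => /andP[as_ us].
have memA x : (x \in A) = (x == a) || (x \in s) by rewrite -mem_enum eA mem_rcons inE.
have AE : A :\ a = [set x in s].
  apply/setP => x; rewrite !inE memA; case: eqP => [->|] //=.
  by rewrite (negbTE as_).
rewrite map_rcons (mom_perm mu (L := X a :: [seq X i | i <- s])); last by rewrite perm_rcons.
rewrite mom_leibniz //.
have aP (P : {set {set T}}) : finset.partition P A -> a \in finset.cover P.
  by move=> /cover_partition ->; rewrite memA eqxx.
rewrite (partition_big (fun P : {set {set T}} => finset.pblock P a :\ a) (fun S => S \subset [set x in s])) /=; last first.
  move=> P PA; rewrite -AE; apply: finset.setSD.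
  exact: partitionS PA (pblock_mem (aP _ PA)).
apply: eq_bigr => S SA; pose B := a |: S.
have aS : a \notin S by apply/negP => /(fintype.subsetP SA); rewrite inE (negbTE as_).
have aB : a \in B by exact: finset.setU11.
have BA : B \subset A.
  apply/fintype.subsetP => x; rewrite !inE memA => /orP[->//|/(fintype.subsetP SA)].
  by rewrite inE => ->; rewrite orbT.
have sB x : x \in s -> (x \in B) = (x \in S).
  by move=> xs; rewrite !inE; case: eqP => // xa; rewrite -xa xs in as_.
have -> : foldr partial (partial (X a) K) [seq X i | i <- s & i \in S] 0 = cumulant B.
  rewrite /cumulant (enum_subset BA) eA filter_rcons aB map_rcons foldr_rcons.
  by congr (foldr _ _ [seq _ | _ <- _] _); apply: eq_in_filter => x xs; rewrite sB.
have -> : [seq X i | i <- s & i \notin S] = [seq X i | i <- enum (A :\: B)].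
  rewrite (enum_subset (finset.subsetDl A B)) eA filter_rcons inE aB /=.
  congr [seq _ | _ <- _]; apply: eq_in_filter => x xs.
  by rewrite inE sB // memA xs orbT andbT.
rewrite IH; last first.
  apply: leq_trans Am; apply: proper_card; rewrite properE finset.subsetDl /=.
  apply/negP => /fintype.subsetP /(_ a); rewrite memA eqxx => /(_ isT).
  by rewrite inE aB.
have notinB (P : {set {set T}}) : finset.partition P (A :\: B) -> B \notin P.
  move=> PAB; apply/negP => /(partitionS PAB)/fintype.subsetP/(_ a aB).
  by rewrite inE aB.
rewrite big_distrr /= [RHS](reindex_onto (fun P : {set {set T}} => B |: P) (fun P => P :\ B)) /=; last first.
  move=> P /andP[PA /eqP PS]; apply: finset.setD1K.
  have -> : B = finset.pblock P a by rewrite /B -PS finset.setD1K // mem_pblock aP.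
  exact: pblock_mem (aP _ PA).
apply: eq_big => [P|P PAB]; last by rewrite big_setU1 // notinB.
apply/idP/andP => [PAB|[/andP[PA _] /eqP eP]].
  have U : finset.partition (B |: P) A.
    have := partitionU1 PAB (B := B); rewrite (_ : B :|: (A :\: B) = A); last first.
      apply/setP => x; rewrite !inE; case xB : ((x == a) || (x \in S)) => //=.
      by apply/esym; apply: (fintype.subsetP BA); rewrite !inE.
    apply; first by apply/set0Pn; exists a.
    by rewrite -setI_eq0; apply/eqP/setP => x; rewrite !inE; case: (_ || _).
  rewrite U (def_pblock (partition_trivIset U) (finset.setU11 _ _) aB).
  have BS : B :\ a = S by exact: finset.setU1K.
  by rewrite BS eqxx finset.setU1K ?eqxx // notinB.
by rewrite -eP; apply: partitionD1 PA _; exact: finset.setU11.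
Qed.

End leibniz.

Lemma prod_add_subset (K : comPzRingType) (U : finType) (P : {set U}) (f g : U -> K) :
  \prod_(B in P) (f B + g B) =
  \sum_(Q : {set U} | Q \subset P) (\prod_(B in Q) g B) * \prod_(B in P :\: Q) f B.
Proof.
have [m] := ubnP #|P|; elim: m P => // m IH P; rewrite ltnS => Pm.
have [->|/set0Pn[b bP]] := eqVneq P finset.set0.
  rewrite big_set0 (big_pred1 finset.set0); last by move=> Q; rewrite finset.subset0.
  by rewrite finset.setD0 !big_set0 mulr1.
have bN : b \notin P :\ b by rewrite !inE eqxx.
rewrite -(finset.setD1K bP) big_setU1 // big_subset_setU1 // IH; last first.
  by rewrite (cardsD1 b) bP in Pm.
rewrite /= mulr_sumr; apply: eq_bigr => Q QP; rewrite mulrDl addrC.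
have bQ : b \notin Q by apply: contra bN; exact: (fintype.subsetP QP).
congr (_ + _).
  rewrite big_setU1 // -mulrA; congr (_ * (_ * _)); apply: eq_bigl => x.
  by rewrite !inE; case: (x == b) => //=; rewrite andbF.
rewrite mulrCA; congr (_ * _).
have -> : (b |: P :\ b) :\: Q = b |: ((P :\ b) :\: Q).
  apply/setP => x; rewrite !inE; case: eqP => [->|] //=.
  by rewrite (negbTE bQ).
by rewrite big_setU1 // !inE eqxx andbF.
Qed.

(** * Feynman graphs *)

Section graphs.
Context {R : realType} {n : nat}.
Local Notation C := R[i].
Local Notation vec := 'rV[R]_n.
Local Notation W := 'rV[C]_n.
Variables (Psi : W -> C) (t : R) (phi : vec) (mu : probability vec R).
Hypotheses (Psi0 : Psi 0 = 0) (sPsi : smooth Psi)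
  (hmu : has_mgf mu (fun w => lexp w phi * cexp (t%:C * Psi w))).

Let K (w : W) : C := dot w (cvec phi) + t%:C * Psi w.

Let sK : smooth K.
Proof. by apply: smoothD; [apply: smooth_lin; exact: lin_dot|exact: smoothZ]. Qed.

Let hK : has_mgf mu (fun w => cexp (K w)).
Proof. by split; [exact: hmu.1|move=> w; rewrite hmu.2 /K cexpD]. Qed.

Let K0 : K 0 = 0.
Proof. by rewrite /K Psi0 mulr0 addr0 /dot big1 // => k _; rewrite mxE mul0r. Qed.

(** The linear part [dot w phi] of [K] contributes to first derivatives only. *)
Lemma cumulantE (T : finType) (X : T -> 'I_n) (B : {set T}) : B != finset.set0 ->
  cumulant K X B = t%:C * Ccoef Psi [seq X b | b <- enum B]
    + if #|B| == 1%N then \prod_(b in B) (phi ord0 (X b))%:C else 0.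
Proof.
move=> B0; rewrite /cumulant /K foldr_partialD; last 2 first.
  by apply: smooth_lin; exact: lin_dot.
  exact: smoothZ.
rewrite foldr_partialZ // addrC; congr (_ + _).
case/lastP eB : (enum B) => [|s b].
  by case/negP: B0; rewrite -cards_eq0 cardE eB.
rewrite map_rcons foldr_partial_dot cardE eB size_rcons eqSS.
rewrite -[_ == [::]]size_eq0 size_map; case: ifP => // /eqP/size0nil s0.
by rewrite mxE -big_enum /= eB s0 big_seq1.
Qed.

(** The two terms of the cumulant of a block are its two possible marks, inner and
    outer; expanding the product over the blocks of a partition chooses the set [Q]
    of outer vertices. *)
Lemma mom_graphs m (X : leg m -> 'I_n) :
  mom mu [seq X i | i <- enum [set: leg m]%SET] 0 = \sum_(G in graphs m)
    (\prod_(B in G.2) \prod_(b in B) (phi ord0 (X b))%:C)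
    * (\prod_(B in G.1) (t%:C * Ccoef Psi [seq X b | b <- enum B])).
Proof.
rewrite (mom_cumulant hK sK X K0).
pose f (B : {set leg m}) := t%:C * Ccoef Psi [seq X b | b <- enum B].
pose g (B : {set leg m}) := if #|B| == 1%N then \prod_(b in B) (phi ord0 (X b))%:C else 0.
transitivity (\sum_(P : {set {set leg m}} | finset.partition P [set: leg m]%SET)
    \sum_(Q : {set {set leg m}} | Q \subset P) (\prod_(B in Q) g B) * \prod_(B in P :\: Q) f B).
  apply: eq_bigr => P PT; rewrite -prod_add_subset; apply: eq_bigr => B BP.
  by rewrite cumulantE // (partition_neq0 PT).
rewrite pair_big_dep /=.
rewrite (bigID (fun p : {set {set leg m}} * {set {set leg m}} => [forall B in p.2, #|B| == 1%N])) /=.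
rewrite addrC big1 ?add0r; last first.
  move=> [P Q] /= /andP[_ /forallPn[B]]; rewrite negb_imply => /andP[BQ B1].
  by rewrite (bigD1 B) //= /g (negbTE B1) !mul0r.
rewrite (reindex_onto (fun G : {set {set leg m}} * {set {set leg m}} => (G.1 :|: G.2, G.2))
  (fun p => (p.1 :\: p.2, p.2))) /=; last first.
  move=> [P Q] /= /andP[/andP[_ QP] _]; congr (_, _).
  apply/setP => x; rewrite !inE; case xQ : (x \in Q) => //=; rewrite ?orbF //.
  by rewrite (fintype.subsetP QP).
apply: eq_big => [[P Q]|[P Q]] /=.
  rewrite inE /= xpair_eqE eqxx andbT finset.subsetUr andbT.
  have -> : ((P :|: Q) :\: Q == P) = fintype.disjoint (mem P) (mem Q).
    rewrite (_ : (P :|: Q) :\: Q = P :\: Q); first exact/eqP/finset.setDidPl.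
    by apply/setP => x; rewrite !inE; case: (x \in Q); rewrite ?andbF ?orbF.
  by rewrite andbC.
move=> /andP[/andP[_ /forall_inP Q1] /eqP[PQ]]; rewrite PQ; congr (_ * _).
by apply: eq_bigr => B BQ; rewrite /g Q1.
Qed.

Lemma quad_formX (lam : 'M[R]_n) m (x : vec) : quad_form lam x ^+ m =
  \sum_(X : {ffun leg m -> 'I_n})
    (\prod_(j < m) lam (X (ord0, j)) (X (ord_max, j))) * monomial [seq X i | i <- enum [set: leg m]%SET] x.
Proof.
rewrite -[LHS](_ : \prod_(j < m) quad_form lam x = _); last by rewrite prodr_const card_ord.
under eq_bigr do rewrite /quad_form pair_big /=.
rewrite bigA_distr_bigA /=.
pose h (X : {ffun leg m -> 'I_n}) : {ffun 'I_m -> 'I_n * 'I_n} := [ffun j => (X (ord0, j), X (ord_max, j))].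
pose h' (f : {ffun 'I_m -> 'I_n * 'I_n}) : {ffun leg m -> 'I_n} :=
  [ffun l : leg m => if l.1 == ord0 then (f l.2).1 else (f l.2).2].
have hK1 : cancel h h'.
  move=> X; apply/ffunP => -[s j]; rewrite !ffunE /= ?ffunE /=.
  case: eqP => [->//|s0]; congr (X (_, _)); apply/val_inj => /=.
  by case: s s0 => [[|[|k]] hk] //= s0; case: s0; apply/val_inj.
have hK2 : cancel h' h.
  by move=> f; apply/ffunP => j; rewrite !ffunE /=; case: (f j).
rewrite (reindex h) /=; last by exists h' => X _; [exact: hK1|exact: hK2].
apply: eq_bigr => X _.
have -> : monomial [seq X i | i <- enum [set: leg m]%SET] x =
   \prod_(j < m) (x ord0 (X (ord0, j)) * x ord0 (X (ord_max, j))).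
  rewrite /monomial big_map big_enum /=.
  transitivity (\prod_(s < 2) \prod_(j < m) x ord0 (X (s, j))).
    by rewrite pair_big /=; apply: eq_big => [p|[s j] _]; rewrite ?inE.
  rewrite big_ord_recl big_ord1 big_split /=; congr (_ * _).
  apply: eq_bigr => j _; congr (x _ (X (_, _))); exact/val_inj.
rewrite -big_split /=; apply: eq_bigr => j _.
by rewrite !ffunE /= mulrA.
Qed.

(** The Feynman rules contract the moments of monomials with the coefficients of
    [quad_form lam], which gives the moments of the quadratic form. *)
Lemma graph_sumE (lam : 'M[R]_n) m :
  graph_sum Psi lam t phi m = (\int[mu]_x (quad_form lam x ^+ m))%:C.
Proof.
rewrite /graph_sum /graph_value exchange_big /=.
transitivity (\sum_(X : {ffun leg m -> 'I_n}) (\prod_(j < m) lam (X (ord0, j)) (X (ord_max, j)))%:C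
    * mom mu [seq X i | i <- enum [set: leg m]%SET] 0).
  apply: eq_bigr => X _; rewrite mom_graphs mulr_sumr; apply: eq_bigr => G _.
  by rewrite mulrC; congr (_ * _); rewrite rmorph_prod.
have iX (X : {ffun leg m -> 'I_n}) : cintegrable mu setT (fun x => (monomial [seq X i | i <- enum [set: leg m]%SET] x)%:C * lexp 0 x).
  by apply: cintegrable_mom; exact: hmu.1.
rewrite -cintegral_real.
transitivity (cintegral mu setT (fun x => \sum_(X : {ffun leg m -> 'I_n}) (\prod_(j < m) lam (X (ord0, j)) (X (ord_max, j)))%:C
    * ((monomial [seq X i | i <- enum [set: leg m]%SET] x)%:C * lexp 0 x))).
  rewrite cintegral_sum; last by move=> X _; exact: cintegrableZ (iX X).
  by apply: eq_bigr => X _; rewrite cintegralZ.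
congr cintegral; apply/funext => x; rewrite quad_formX rc_sum; apply: eq_bigr => X _.
have -> : lexp (0 : W) x = 1 by rewrite /lexp /dot big1 ?cexp0 // => k _; rewrite mxE mul0r.
by rewrite mulr1 rcM.
Qed.

End graphs.

Section levy_smooth.
Context {R : realType} {n : nat}.
Local Notation C := R[i].
Local Notation vec := 'rV[R]_n.
Local Notation W := 'rV[C]_n.

Lemma smooth_mgf (M : W -> C) : is_mgf M -> smooth M.
Proof.
move=> [mu hM]; rewrite (_ : M = mom mu [::]); first exact: smooth_mom hM.1 _.
apply/funext => w; rewrite -(hM.2 w); congr cintegral; apply/funext => x.
by rewrite /monomial big_nil mul1r.
Qed.

Variables (a : vec) (D : 'M[R]_n) (z : R) (r : probability vec R).
Hypotheses (r_no_atom0 : r [set 0] = 0%E) (r_compact : compact (supp r)).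
Local Notation Psi := (levy_char a D z r).

Let PsiE : Psi = fun w => (- 1) * dot w (cvec a) + cquad D w + z%:C * (jump_mgf r w + - 1).
Proof. by apply/funext => w; rewrite levy_charE // mulN1r. Qed.

Lemma smooth_levy : smooth Psi.
Proof.
rewrite PsiE; apply: smoothD; first apply: smoothD.
- by apply: smoothZ; apply: smooth_lin; exact: lin_dot.
- apply: (@smooth_quad R n (fun v w => dot v (w *m (map_mx (real_complex R) D)^T))).
    by move=> v b u w; rewrite mulmxDl -scalemxAl dotDr dotZr.
  by move=> v b u w; rewrite dotDl dotZl.
- apply: smoothZ; apply: smoothD; last exact: smooth_cst.
  exact: smooth_mgf (is_mgf_opp r_compact).
Qed.

Lemma levy0 : Psi 0 = 0.
Proof.
rewrite PsiE /cquad mul0mx.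
have d0 b : dot (0 : W) b = 0 by rewrite /dot big1 // => k _; rewrite mxE mul0r.
rewrite !d0 mulr0 add0r add0r (_ : jump_mgf r 0 = 1) ?subrr ?mulr0 //.
rewrite /jump_mgf (_ : (fun x => _) = fun=> (1 : R)%:C); last first.
  by apply/funext => x; rewrite /lexp d0 cexp0.
by rewrite cintegral_real Rintegral_one.
Qed.

End levy_smooth.

(** * Borel summability of the graph expansion *)

Lemma shifted_law (R : realType) n (mu : probability 'rV[R]_n R) M (phi : 'rV[R]_n) : has_mgf mu M ->
  exists mu' : probability 'rV[R]_n R, has_mgf mu' (fun w => lexp w phi * M w) /\
    forall f, cmeas f -> cintegrable mu setT (fun x => f (phi + x)) ->
      cintegral mu setT (fun x => f (phi + x)) = cintegral mu' setT f.
Proof.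
move=> hM; have mX : measurable_fun setT (fun x : 'rV[R]_n => phi + x).
  by apply: measurable_rVDD; [exact: measurable_cst|exact: measurable_id].
pose mX' := isMeasurableFun.Build _ _ _ _ _ mX.
pose X' : {mfun 'rV[R]_n >-> 'rV[R]_n} := HB.pack (fun x : 'rV[R]_n => phi + x) mX'.
have push f : cmeas f -> cintegrable mu setT (fun x => f (phi + x)) ->
    cintegral mu setT (fun x => f (phi + x)) = cintegral (distribution mu X') setT f.
  by move=> mf fi; apply: (@cintegral_push _ _ _ _ _ mu _ _ mX).
exists (distribution mu X'); split => //; split.
  move=> v; apply: (@integrable_push _ _ _ _ _ mu _ _ mX) => //; first exact: measurable_expR_dot.
  have := integrableZR (expR (dot v phi)) (hM.1 v).
  by congr integrable; apply/funext => x /=; rewrite dotDr expRD.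
move=> w; have lE : (fun x => lexp w (phi + x)) = fun x => lexp w phi * lexp w x.
  by apply/funext => x; rewrite lexpD.
rewrite -push; [|exact: cmeas_lexp|by rewrite lE; apply: cintegrableZ; exact: expmoments_cintegrable hM.1].
by rewrite lE cintegralZ ?hM.2 //; exact: expmoments_cintegrable hM.1.
Qed.

Lemma analytic_on_eq (R : realType) (U : set R[i]) (f g : R[i] -> R[i]) :
  (forall w, U w -> 0 < complex.Re w) -> (forall w, 0 < complex.Re w -> f w = g w) ->
  analytic_on U g -> analytic_on U f.
Proof.
move=> HU fg ag w0 Uw0; have [e [e0 [c Hc]]] := ag w0 Uw0.
exists (Num.min e (complex.Re w0)); split; first by rewrite lt_min e0 HU.
exists c => w; rewrite cnE ltcR lt_min => /andP[we w1].
rewrite fg; first by apply: Hc; rewrite cnE ltcR.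
have := le_lt_trans (Re_le_cn _) w1; rewrite Re_add Re_opp ltr_norml => /andP[+ _]; lra.
Qed.

Lemma Re_inv_gt0 (R : realType) (w : R[i]) : 0 < complex.Re w^-1 -> 0 < complex.Re w.
Proof.
move=> /Re_inv4; rewrite invfM invrK (_ : 4^-1 = (4^-1)%:C); last by rewrite rcV rc_nat.
by rewrite Re_scale pmulr_rgt0 ?invr_gt0.
Qed.

Theorem theorem2p21 (R : realType) (d : nat)
    (a : 'rV[R]_d) (D : 'M[R]_d) (z : R) (r : probability 'rV[R]_d R)
    (lam : 'M[R]_d) (t : R) (phi : 'rV[R]_d)
    (D_psd : forall x : 'rV[R]_d, 0 <= dot x (x *m D^T))
    (z_ge0 : 0 <= z)
    (r_no_atom0 : r [set 0] = 0%E)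
    (r_compact : compact (supp r))
    (lam_sym : lam^T = lam)
    (lam_posdef : forall x : 'rV[R]_d, x != 0 -> 0 < quad_form lam x)
    (t_gt0 : 0 < t) :
  let Psi := levy_char a D z r in
  let am (m : nat) : R[i] :=
    (-1) ^+ m / m`!%:R * graph_sum Psi lam t phi m in
  [/\ exists A sigma : R, [/\ 0 < A, 0 < sigma &
        forall rho : R, 0 < rho ->
          analytic_on (watson_disc rho) (fun zeta => Phi Psi lam zeta t phi) /\
          forall (N : nat) (zeta : R[i]), watson_disc rho zeta ->
            `|Phi Psi lam zeta t phi - \sum_(m < N) am m * zeta ^+ m|
              <= (A * sigma ^+ N * N`!%:R)%:C * `|zeta| ^+ N],
      solves_cauchy Psi (fun x => cexp (- (quad_form lam x)%:C))
        (Phi Psi lam 1) &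
      exists sigma : R, 0 < sigma /\ exists B : R[i] -> R[i],
        [/\ forall tau : R[i], `|tau| < (sigma^-1)%:C ->
              series (fun m => (- tau) ^+ m / (m`!%:R ^+ 2)
                               * graph_sum Psi lam t phi m) @ \oo --> B tau,
            analytic_on (strip sigma) B,
            cintegrable (@lebesgue_measure R) `[0, +oo[
              (fun tau : R => cexp (- tau%:C) * B tau%:C) &
            Phi Psi lam 1 t phi
            = cintegral (@lebesgue_measure R) `[0, +oo[
                (fun tau : R => cexp (- tau%:C) * B tau%:C)]].
Proof.
move=> Psi am.
have mQ := @measurable_quad_form R d lam.
have [mu0 hmu0] := is_mgf_levy a D_psd z_ge0 r_no_atom0 r_compact (ltW t_gt0).
have [mu [hmu push]] := shifted_law phi hmu0.
have Q0 (x : 'rV[R]_d) : 0 <= quad_form lam x.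
  have [->|x0] := eqVneq x 0; last by have h := lam_posdef x x0; apply: ltW h.
  by rewrite /quad_form big1 // => i _; rewrite big1 // => j _; rewrite !mxE mulr0.
have [L [L0 HL]] := quad_form_le lam.
pose S (x : 'rV[R]_d) := (1 + L) * norm1 x.
have S0 (x : 'rV[R]_d) : 0 <= S x by rewrite mulr_ge0 ?addr_ge0 ?norm1_ge0.
have QS (x : 'rV[R]_d) : quad_form lam x <= S x ^+ 2.
  apply: le_trans (ler_norm _) _; apply: le_trans (HL x) _.
  rewrite exprMn ler_wpM2r ?exprn_ge0 ?norm1_ge0 //; nra.
have iS (b : R) : 0 <= b -> mu.-integrable setT (EFin \o (fun x => expR (b * S x))).
  move=> b0; have b1 : 0 <= b * (1 + L) by rewrite mulr_ge0 // addr_ge0.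
  have := integrable_expR_pnorm1 b1 hmu.1.
  by congr integrable; apply/funext => x /=; rewrite mulrA.
have PhiE zeta : 0 < complex.Re zeta -> Phi Psi lam zeta t phi = laplace mu (quad_form lam) zeta.
  move=> z0; rewrite (Phi_expectation D_psd z_ge0 r_no_atom0 r_compact lam_sym lam_posdef z0 phi (ltW t_gt0) hmu0).
  rewrite (push (gaussian zeta lam)) //; first exact: cmeas_gaussian.
  exact: cintegrable_gaussian_shift.
have graphE m : graph_sum Psi lam t phi m = (moment mu (quad_form lam) m)%:C.
  apply: graph_sumE => //; [exact: levy0|exact: smooth_levy].
split.
- have [K [K0 HK]] := moment_le mQ Q0 QS S0 iS ltr01.
  exists K, 4^-1; split => // rho rho0.
  have HU w : watson_disc rho w -> 0 < complex.Re w.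
    rewrite /watson_disc /= => h; apply: Re_inv_gt0; apply: lt_trans h.
    by rewrite invr_gt0.
  split.
    apply: (analytic_on_eq HU (g := laplace mu (quad_form lam))) => //.
    exact: laplace_analytic HU.
  move=> N zeta /HU z0; rewrite PhiE // !cnE -rcX -rcM lecR.
  have := laplace_taylor mQ Q0 QS S0 iS N z0.
  under eq_bigr do rewrite -graphE.
  move/le_trans; apply; rewrite ler_wpM2r ?exprn_ge0 ?cn_ge0 //.
  have := HK N; rewrite expr1n mul1r ler_pdivrMr ?exprn_gt0 ?ltr0n ?fact_gt0 //.
  rewrite ler_pdivrMr ?ltr0n ?fact_gt0 // => /le_trans; apply.
  by rewrite expr2 [_ * K]mulrC !mulrA.
- have -> : (fun x => cexp (- (quad_form lam x)%:C)) = gaussian 1 lam.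
    by apply/funext => x; rewrite /gaussian mulN1r.
  exact: Phi_solves_cauchy.
- exists 1; split => //; have [B [B1 B2 B3 B4]] := borel_sum mQ Q0 QS S0 iS.
  exists B; split => //.
  + move=> tau _; rewrite [X in X @ _ --> _](_ : _ = fun N => \sum_(m < N) (bessel_coef m * moment mu (quad_form lam) m)%:C * tau ^+ m); first exact: B1.
    apply/funext => N; rewrite /series /= big_mkord; apply: eq_bigr => m _.
    rewrite graphE /bessel_coef !rcM rcV !rcX rc_nat rcN exprNn.
    by move: (_ ^-2) (_%:C) (_ ^+ _) (_ ^+ _) => p q u v; ring.
  + by move=> w _; exact: B2.
  + by rewrite PhiE.
Qed.
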